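(* Let $K$ be a field and $G$ a finite simple graph without isolated vertices on $\{x_1,\dots,x_n\}$, with edge ideal $I(G)\subseteq R=K[x_1,\dots,x_n]$. Then $R/I(G)^2$ is generalized Cohen-Macaulay if and only if (1) $G$ is well-covered, and (2) for every vertex $v$ of $G$, every nontrivial connected component of $G_v$ is a triangle-free graph in $W_2$.
   Context: $R/I$ is generalized Cohen-Macaulay if the local cohomology modules $H^i_{\mathfrak m}(R/I)$ have finite length for all $i<\dim R/I$, $\mathfrak m=(x_1,\dots,x_n)$. $I(G)=(x_ix_j\mid x_ix_j\in E(G))$. $G$ is well-covered if all maximal independent sets have the same size; a well-covered $G$ is in $W_2$ if removing any vertex leaves a well-covered graph with the same independence number. $G_v$ is the induced subgraph of $G$ obtained by deleting $v$ and all its neighbors. A component is nontrivial if it has more than one vertex. *)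

(* Defs.v *)
From HB Require Import structures.
From mathcomp Require Import all_boot all_algebra ring_quotient.
From mathcomp Require Import boolp mpoly zify ring.

Set Implicit Arguments.
Unset Strict Implicit.
Unset Printing Implicit Defensive.

Import GRing.Theory.
Local Open Scope ring_scope.
Local Open Scope quotient_scope.

Section Submodule.
Variables (R : pzRingType) (V : lmodType R) (N : submodClosed V).

(* [submodClosed] does not inherit from [zmodClosed] in the library. *)
Definition submod_pred : V -> bool := fun v => v \in N.

Fact submod_zmod_closed : zmod_closed submod_pred.
Proof.
split=> [|u v Nu Nv]; first exact: (rpred0 N).
by rewrite /in_mem /= /submod_pred -scaleN1r rpredD // rpredZ.
Qed.

Definition submod_zmod : zmodClosed V := HB.pack_for (zmodClosed V) submod_pred
  (GRing.isZmodClosed.Build V submod_pred submod_zmod_closed).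

Definition submod := {v : V | v \in N}.

HB.instance Definition _ := [isSub of submod for @sval V (fun v => v \in N)].
HB.instance Definition _ := [Choice of submod by <:].

Fact submod_submod_closed : GRing.subsemimod_closed N.
Proof. exact: (GRing.subsemimodClosedP N). Qed.

HB.instance Definition _ :=
  GRing.SubChoice_isSubLmodule.Build R V (fun v => v \in N) submod
    submod_submod_closed.

End Submodule.

Section QuotientModule.
Variables (R : pzRingType) (V : lmodType R) (N : submodClosed V).

Definition quotmod := Quotient.quot (submod_zmod N).

HB.instance Definition _ := GRing.Zmodule.on quotmod.

Definition quotmod_pi (v : V) : quotmod := \pi_(Quotient.quot (submod_zmod N)) v.

Lemma quotmod_piP u v : reflect (quotmod_pi u = quotmod_pi v) (u - v \in N).
Proof.
have -> : (u - v \in N) = (quotmod_pi u == quotmod_pi v).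
  exact: (Quotient.idealrBE (submod_zmod N)).
exact: eqP.
Qed.

Lemma quotmod_piD : {morph quotmod_pi : u v / u + v}.
Proof. exact: Quotient.pi_add. Qed.

Definition quotmod_scale (a : R) (u : quotmod) : quotmod :=
  quotmod_pi (a *: repr u).

Lemma quotmod_scaleE a v : quotmod_scale a (quotmod_pi v) = quotmod_pi (a *: v).
Proof.
apply/quotmod_piP; rewrite -scalerBr rpredZ //.
by apply/quotmod_piP; rewrite /quotmod_pi reprK.
Qed.

Lemma quotmod_ind (P : quotmod -> Prop) :
  (forall v, P (quotmod_pi v)) -> forall u, P u.
Proof. by move=> Ppi u; rewrite -[u]reprK; apply: Ppi. Qed.

Fact quotmod_scaleA a b u :
  quotmod_scale a (quotmod_scale b u) = quotmod_scale (a * b) u.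
Proof. by elim/quotmod_ind: u => u; rewrite !quotmod_scaleE scalerA. Qed.

Fact quotmod_scale1 : left_id 1 quotmod_scale.
Proof. by elim/quotmod_ind => u; rewrite quotmod_scaleE scale1r. Qed.

Fact quotmod_scaleDr : right_distributive quotmod_scale +%R.
Proof.
move=> a; elim/quotmod_ind => u; elim/quotmod_ind => v.
by rewrite -quotmod_piD !quotmod_scaleE -quotmod_piD scalerDr.
Qed.

Fact quotmod_scaleDl u : {morph quotmod_scale^~ u : a b / a + b}.
Proof.
move=> a b; elim/quotmod_ind: u => u.
by rewrite !quotmod_scaleE -quotmod_piD scalerDl.
Qed.

HB.instance Definition _ := GRing.Zmodule_isLmodule.Build R quotmod
  quotmod_scaleA quotmod_scale1 quotmod_scaleDr quotmod_scaleDl.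

End QuotientModule.

Section ProductModule.
Variables (R : pzRingType) (I : Type) (V : I -> lmodType R).

Definition prodmod := forall i, V i.

HB.instance Definition _ := gen_eqMixin prodmod.
HB.instance Definition _ := gen_choiceMixin prodmod.

Definition prodmod_add (u v : prodmod) : prodmod := fun i => u i + v i.
Definition prodmod_opp (u : prodmod) : prodmod := fun i => - u i.
Definition prodmod_scale (a : R) (u : prodmod) : prodmod := fun i => a *: u i.

Fact prodmod_addA : associative prodmod_add.
Proof.
by move=> u v w; apply: functional_extensionality_dep => i; apply: addrA.
Qed.
Fact prodmod_addC : commutative prodmod_add.
Proof. by move=> u v; apply: functional_extensionality_dep => i; apply: addrC. Qed.
Fact prodmod_add0 : left_id (fun=> 0 : V _) prodmod_add.
Proof. by move=> u; apply: functional_extensionality_dep => i; apply: add0r. Qed.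
Fact prodmod_addN : left_inverse (fun=> 0 : V _) prodmod_opp prodmod_add.
Proof. by move=> u; apply: functional_extensionality_dep => i; apply: addNr. Qed.

HB.instance Definition _ := GRing.isZmodule.Build prodmod
  prodmod_addA prodmod_addC prodmod_add0 prodmod_addN.

Fact prodmod_scaleA a b u :
  prodmod_scale a (prodmod_scale b u) = prodmod_scale (a * b) u.
Proof. by apply: functional_extensionality_dep => i; apply: scalerA. Qed.
Fact prodmod_scale1 : left_id 1 prodmod_scale.
Proof. by move=> u; apply: functional_extensionality_dep => i; apply: scale1r. Qed.
Fact prodmod_scaleDr : right_distributive prodmod_scale +%R.
Proof. by move=> a u v; apply: functional_extensionality_dep => i; apply: scalerDr. Qed.
Fact prodmod_scaleDl u : {morph prodmod_scale^~ u : a b / a + b}.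
Proof. by move=> a b; apply: functional_extensionality_dep => i; apply: scalerDl. Qed.

HB.instance Definition _ := GRing.Zmodule_isLmodule.Build R prodmod
  prodmod_scaleA prodmod_scale1 prodmod_scaleDr prodmod_scaleDl.

End ProductModule.

Section Localization.
Variables (R : comNzRingType) (M : lmodType R).

Section At.
Variable f : R.

(* The pair [(m, k)] stands for the fraction [m / f ^ k]. *)
Definition loc_equiv : rel (M * nat) := fun u v =>
  `[< exists t, f ^+ (t + v.2) *: u.1 = f ^+ (t + u.2) *: v.1 >].

Fact loc_equiv_is_equiv : equiv_class_of loc_equiv.
Proof.
split=> [u|u v|v u w].
- by apply/asboolP; exists 0%N.
- by apply/asboolP/asboolP => -[t E]; exists t.
move=> /asboolP[s Es] /asboolP[t Et]; apply/asboolP.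
exists (s + t + v.2)%N.
have -> : (s + t + v.2 + w.2 = (t + w.2) + (s + v.2))%N.
  by rewrite [(t + w.2)%N]addnC !addnA -!addnA addnC -!addnA addnCA; lia.
rewrite exprD -scalerA Es scalerA -exprD.
have -> : (t + w.2 + (s + u.2) = (s + u.2) + (t + w.2))%N by rewrite addnC.
rewrite exprD -scalerA Et scalerA -exprD.
by congr (_ ^+ _ *: _); lia.
Qed.

Canonical loc_equivR := EquivRelPack loc_equiv_is_equiv.
Canonical loc_encModRel := defaultEncModRel loc_equiv.

Definition loc := {eq_quot loc_equiv}.

HB.instance Definition _ := Choice.on loc.

Definition frac (m : M) (k : nat) : loc := \pi_({eq_quot loc_equiv}) (m, k).

Lemma fracP m k m' k' :
  frac m k = frac m' k' <->
  exists t, f ^+ (t + k') *: m = f ^+ (t + k) *: m'.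
Proof.
split=> [/eqmodP/asboolP //|E]; apply/eqmodP/asboolP; exact: E.
Qed.

Lemma frac_repr (u : loc) : frac (repr u).1 (repr u).2 = u.
Proof. by rewrite /frac -surjective_pairing reprK. Qed.

Lemma loc_ind (P : loc -> Prop) : (forall m k, P (frac m k)) -> forall u, P u.
Proof. by move=> Pf u; rewrite -[u]frac_repr; apply: Pf. Qed.

Lemma frac_reprE m k : exists t, let u := repr (frac m k) in
  f ^+ (t + k) *: u.1 = f ^+ (t + u.2) *: m.
Proof. by apply/fracP; rewrite frac_repr. Qed.

Definition loc_add (u v : loc) : loc :=
  frac (f ^+ (repr v).2 *: (repr u).1 + f ^+ (repr u).2 *: (repr v).1)
       ((repr u).2 + (repr v).2).
Definition loc_opp (u : loc) : loc := frac (- (repr u).1) (repr u).2.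
Definition loc_scale (a : R) (u : loc) : loc := frac (a *: (repr u).1) (repr u).2.

Lemma loc_addE m k m' k' :
  loc_add (frac m k) (frac m' k') = frac (f ^+ k' *: m + f ^+ k *: m') (k + k').
Proof.
rewrite /loc_add; have [s /= Es] := frac_reprE m k.
have [t /= Et] := frac_reprE m' k'; move: Es Et.
set u := repr _; set v := repr _ => Es Et.
apply/fracP; exists (s + t)%N; rewrite !scalerDr !scalerA -!exprD.
congr (_ + _).
  have -> : (s + t + (k + k') + v.2 = (t + k' + v.2) + (s + k))%N by lia.
  rewrite exprD -scalerA Es scalerA -exprD; congr (_ ^+ _ *: _); lia.
have -> : (s + t + (k + k') + u.2 = (s + k + u.2) + (t + k'))%N by lia.
rewrite exprD -scalerA Et scalerA -exprD; congr (_ ^+ _ *: _); lia.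
Qed.

Lemma loc_oppE m k : loc_opp (frac m k) = frac (- m) k.
Proof.
rewrite /loc_opp; have [s /= Es] := frac_reprE m k.
by apply/fracP; exists s; rewrite !scalerN Es.
Qed.

Lemma loc_scaleE a m k : loc_scale a (frac m k) = frac (a *: m) k.
Proof.
rewrite /loc_scale; have [s /= Es] := frac_reprE m k.
by apply/fracP; exists s; rewrite !scalerA ![_ * a]mulrC -!scalerA Es.
Qed.

Lemma frac_eq m k j : frac (f ^+ j *: m) (k + j) = frac m k.
Proof.
apply/fracP; exists 0%N; rewrite scalerA -exprD; congr (_ ^+ _ *: _); lia.
Qed.

Fact loc_addA : associative loc_add.
Proof.
elim/loc_ind => m k; elim/loc_ind => m' k'; elim/loc_ind => m'' k''.
rewrite !loc_addE addnA !scalerDr !scalerA -!exprD addrA.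
by congr (frac (_ + _ + _) _); congr (_ ^+ _ *: _); lia.
Qed.

Fact loc_addC : commutative loc_add.
Proof.
by elim/loc_ind => m k; elim/loc_ind => m' k'; rewrite !loc_addE addrC addnC.
Qed.

Fact loc_add0 : left_id (frac 0 0) loc_add.
Proof. by elim/loc_ind => m k; rewrite loc_addE scaler0 add0r expr0 scale1r. Qed.

Fact loc_addN : left_inverse (frac 0 0) loc_opp loc_add.
Proof.
elim/loc_ind => m k; rewrite loc_oppE loc_addE scalerN addNr.
by apply/fracP; exists 0%N; rewrite !scaler0.
Qed.

HB.instance Definition _ := GRing.isZmodule.Build loc
  loc_addA loc_addC loc_add0 loc_addN.

Fact loc_scaleA a b u : loc_scale a (loc_scale b u) = loc_scale (a * b) u.
Proof. by elim/loc_ind: u => m k; rewrite !loc_scaleE scalerA. Qed.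

Fact loc_scale1 : left_id 1 loc_scale.
Proof. by elim/loc_ind => m k; rewrite loc_scaleE scale1r. Qed.

Fact loc_scaleDr : right_distributive loc_scale +%R.
Proof.
move=> a; elim/loc_ind => m k; elim/loc_ind => m' k'.
rewrite [frac m k + _]loc_addE !loc_scaleE [RHS]loc_addE scalerDr !scalerA.
by rewrite ![_ * a]mulrC.
Qed.

Fact loc_scaleDl u : {morph loc_scale^~ u : a b / a + b}.
Proof.
move=> a b; elim/loc_ind: u => m k; rewrite !loc_scaleE [RHS]loc_addE.
by rewrite -scalerDr -scalerDl frac_eq.
Qed.

HB.instance Definition _ := GRing.Zmodule_isLmodule.Build R loc
  loc_scaleA loc_scale1 loc_scaleDr loc_scaleDl.

Lemma fracD m k m' k' :
  frac m k + frac m' k' = frac (f ^+ k' *: m + f ^+ k *: m') (k + k').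
Proof. exact: loc_addE. Qed.

Lemma fracZ a m k : a *: frac m k = frac (a *: m) k.
Proof. exact: loc_scaleE. Qed.

End At.

(* The canonical map [M_f -> M_h] when [h = f * g]:
   [m / f ^ k = g ^ k m / h ^ k]. *)
Definition loc_map (f g h : R) (u : loc f) : loc h :=
  frac h (g ^+ (repr u).2 *: (repr u).1) (repr u).2.

Lemma loc_mapE f g h m k : h = f * g ->
  loc_map g h (frac f m k) = frac h (g ^+ k *: m) k.
Proof.
move=> ->; rewrite /loc_map; have [s /= Es] := frac_reprE f m k.
move: Es; set u := repr _ => Es; apply/fracP; exists s.
rewrite !scalerA.
have -> : (f * g) ^+ (s + k) * g ^+ u.2 = g ^+ (s + k + u.2) * f ^+ (s + k).
  by rewrite exprMn !exprD; ring.
have -> : (f * g) ^+ (s + u.2) * g ^+ k = g ^+ (s + k + u.2) * f ^+ (s + u.2).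
  by rewrite exprMn !exprD; ring.
by rewrite -!scalerA Es.
Qed.

Lemma loc_map_linear f g h : h = f * g -> linear (@loc_map f g h).
Proof.
move=> Eh a; elim/loc_ind => m k; elim/loc_ind => m' k'.
rewrite fracZ fracD !loc_mapE // fracZ fracD {}Eh; congr (frac _ _ _).
by rewrite scalerDr !scalerA !exprMn !exprD; congr (_ *: _ + _ *: _); ring.
Qed.

End Localization.

(* Local cohomology of [M] with support in the ideal generated by the [x i],
   as the cohomology of the Cech complex of [M] on [x]: its term of degree [i]
   is the product of the localizations of [M] at [\prod_(j in S) x j] for the
   sets [S] of size [i].  It agrees with the derived functors of the
   [x]-torsion functor when [R] is Noetherian. *)
Section LocalCohomology.
Variables (R : comNzRingType) (n : nat) (x : 'I_n -> R) (M : lmodType R).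

Definition cech_elt (S : {set 'I_n}) : R := \prod_(i in S) x i.

Definition cochain := prodmod (fun S => loc M (cech_elt S)).

HB.instance Definition _ := GRing.Lmodule.on cochain.

Definition cech_diff (c : cochain) : cochain := fun T =>
  \sum_(j in T) (-1) ^+ #|[set k in T | (k < j)%N]| *:
    loc_map (x j) (cech_elt T) (c (T :\ j)).

Lemma cech_eltD1 (T : {set 'I_n}) j :
  j \in T -> cech_elt T = cech_elt (T :\ j) * x j.
Proof. by move=> Tj; rewrite /cech_elt (big_setD1 j) //= mulrC. Qed.

Lemma cochainDE (b c : cochain) S : (b + c) S = b S + c S. Proof. by []. Qed.
Lemma cochainZE a (c : cochain) S : (a *: c) S = a *: c S. Proof. by []. Qed.
Lemma cochain0E S : (0 : cochain) S = 0. Proof. by []. Qed.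

Lemma cech_diff_linear : linear cech_diff.
Proof.
move=> a b c; apply: functional_extensionality_dep => T.
rewrite cochainDE cochainZE /cech_diff scaler_sumr -big_split /=.
apply: eq_bigr => j Tj; rewrite cochainDE cochainZE loc_map_linear; last first.
  exact: cech_eltD1.
by rewrite scalerDr !scalerA mulrC.
Qed.

HB.instance Definition _ :=
  GRing.isLinear.Build R cochain cochain *:%R cech_diff cech_diff_linear.

Lemma cech_diff2_eq0 (c : cochain) : cech_diff (cech_diff c) = 0.
Proof.
apply: functional_extensionality_dep => T; rewrite cochain0E /cech_diff.
pose num (S : {set 'I_n}) : M * nat := repr (c S).
pose sg (S : {set 'I_n}) (j : 'I_n) := #|[set k in S | (k < j)%N]|.
pose F j k : loc M (cech_elt T) :=
  let u := num (T :\: [set j; k]) in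
  frac (cech_elt T) ((x j * x k) ^+ u.2 *: u.1) u.2.
have FC j k : F j k = F k j by rewrite /F setUC mulrC.
transitivity (\sum_(j in T) \sum_(k in T :\ j)
    (-1) ^+ (sg T j + sg (T :\ j) k) *: F j k).
  apply: eq_bigr => j Tj; have ET := cech_eltD1 Tj.
  set L := @loc_map R M (cech_elt (T :\ j)) (x j) (cech_elt T).
  have Llin : linear L := loc_map_linear ET.
  have map0 : L 0 = 0 by have := Llin (-1) 0 0; rewrite scaler0 addr0 scaleN1r addNr.
  have mapD : {morph L : u v / u + v}.
    by move=> u v; have := Llin 1 u v; rewrite !scale1r.
  rewrite (big_morph _ mapD map0) scaler_sumr; apply: eq_bigr => k Tk.
  have mapZ a u : L (a *: u) = a *: L u.
    by have := Llin a u 0; rewrite !addr0 map0 addr0.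
  rewrite mapZ scalerA -exprD; congr (_ *: _).
  rewrite /L -[c _]frac_repr (loc_mapE _ _ (cech_eltD1 Tk)) (loc_mapE _ _ ET).
  rewrite scalerA -exprMn /F -/(num _).
  by rewrite (_ : T :\ j :\ k = T :\: [set j; k]) // setDDl.
have sgD1 (j k : 'I_n) : k \in T -> (k < j)%N -> (sg T j = (sg (T :\ k) j).+1)%N.
  move=> Tk kj; rewrite /sg (cardsD1 k) inE Tk kj add1n; congr _.+1.
  by apply: eq_card => l; rewrite !inE andbA.
have sgD1' (j k : 'I_n) : (j <= k)%N -> sg (T :\ k) j = sg T j.
  move=> jk; apply: eq_card => l; rewrite !inE.
  by case: eqP => //= ->; rewrite ltnNge jk andbF.
rewrite (eq_bigr (fun j : 'I_n =>
    \sum_(k in T | (k < j)%N) (-1) ^+ (sg T j + sg (T :\ j) k) *: F j k +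
    \sum_(k in T | (j < k)%N) (-1) ^+ (sg T j + sg (T :\ j) k) *: F j k));
    last first.
  move=> j Tj; rewrite (bigID (fun k : 'I_n => (k < j)%N)) /=.
  congr (_ + _); apply: eq_bigl => k; rewrite !inE -val_eqE /=.
    by case: ltngtP; rewrite ?andbT ?andbF.
  by case: ltngtP; rewrite ?andbT ?andbF.
rewrite big_split /= [X in _ + X](exchange_big_dep (fun k => k \in T)) /=;
  last by move=> j k _ /andP[].
rewrite -big_split /= big1 //= => j Tj.
rewrite Tj /= -big_split /= big1 //= => k.
case/andP=> Tk kj.
rewrite [sg T j](sgD1 _ k) // (sgD1' k j (ltnW kj)) addnC addnS.
by rewrite exprS mulN1r scaleNr FC addNr.
Qed.

(* [cochain] is the sum of all the terms of the complex; a cochain of degree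
   [i] is one supported on the sets of size [i]. *)
Definition cochain_deg (i : nat) (c : cochain) : Prop :=
  forall S : {set 'I_n}, #|S| != i -> c S = 0.

Definition cocycle_pred (i : nat) (c : cochain) : bool :=
  `[< cochain_deg i c /\ cech_diff c = 0 >].

Fact cocycle_submod i : GRing.subsemimod_closed (cocycle_pred i).
Proof.
apply: GRing.submod_closed_semi; split=> [|a b c].
  by apply/asboolP; split; rewrite ?linear0.
move=> /asboolP[b0 db] /asboolP[c0 dc]; apply/asboolP; split=> [S iS|].
  by rewrite cochainDE cochainZE b0 // c0 // scaler0 addr0.
by rewrite cech_diff_linear db dc scaler0 addr0.
Qed.

Definition cocycle i : submodClosed cochain :=
  HB.pack_for (submodClosed cochain) (cocycle_pred i)
    (GRing.isSubmodClosed.Build R cochain (cocycle_pred i) (cocycle_submod i)).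

(* For [i = 0] this forces [b = 0], so that only [0] is a coboundary. *)
Definition coboundary_pred (i : nat) (c : submod (cocycle i)) : bool :=
  `[< exists b : cochain,
        (forall S : {set 'I_n}, #|S|.+1 != i -> b S = 0) /\
        cech_diff b = \val c >].

Fact coboundary_submod i : GRing.subsemimod_closed (@coboundary_pred i).
Proof.
apply: GRing.submod_closed_semi; split=> [|a c c'].
  by apply/asboolP; exists 0; rewrite linear0; split.
move=> /asboolP[b [b0 Eb]] /asboolP[b' [b'0 Eb']].
apply/asboolP; exists (a *: b + b'); split=> [S iS|].
  by rewrite cochainDE cochainZE b0 // b'0 // scaler0 addr0.
by rewrite cech_diff_linear Eb Eb'.
Qed.

Definition coboundary i : submodClosed (submod (cocycle i)) :=
  HB.pack_for (submodClosed (submod (cocycle i))) (@coboundary_pred i)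
    (GRing.isSubmodClosed.Build R (submod (cocycle i)) (@coboundary_pred i)
      (@coboundary_submod i)).

Definition local_cohomology (i : nat) : lmodType R := quotmod (coboundary i).

End LocalCohomology.

Section Length.
Variables (R : pzRingType) (V : lmodType R).

Definition proper_sub (A B : {pred V}) : Prop :=
  {subset A <= B} /\ ~ {subset B <= A}.

(* The lengths [k] of the strict chains [L 0 < ... < L k] of submodules are
   bounded. *)
Definition finite_length : Prop :=
  exists l : nat, forall (k : nat) (L : nat -> {pred V}),
    (forall i, (i <= k)%N -> submod_closed (L i)) ->
    (forall i, (i < k)%N -> proper_sub (L i) (L i.+1)) ->
    (k <= l)%N.

End Length.

Section Ideals.
Variable R : comNzRingType.

(* Ideals are the submodules of the regular module [R^o]. *)
Definition ideal_gen_pred (S : {pred R}) (p : R^o) : bool :=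
  `[< forall J : {pred R^o}, submod_closed J -> {subset S <= J} -> p \in J >].

Fact ideal_gen_submod (S : {pred R}) :
  GRing.subsemimod_closed (ideal_gen_pred S).
Proof.
apply: GRing.submod_closed_semi; split=> [|a u v].
  by apply/asboolP => J [].
move=> /asboolP Su /asboolP Sv; apply/asboolP => J Jsub SJ.
by case: (Jsub) => _; apply; [apply: Su | apply: Sv].
Qed.

Definition ideal_gen (S : {pred R}) : submodClosed R^o :=
  HB.pack_for (submodClosed R^o) (ideal_gen_pred S)
    (GRing.isSubmodClosed.Build R R^o (ideal_gen_pred S) (ideal_gen_submod S)).

Definition ideal_mul (I J : submodClosed R^o) : submodClosed R^o :=
  ideal_gen (fun p => `[< exists a b, [/\ a \in I, b \in J & p = a * b] >]).

Definition prime_ideal (P : {pred R}) : Prop :=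
  idealr_closed P /\ prime_idealr_closed P.

(* [dim (R / I) > d]: some chain [P 0 < ... < P d.+1] of primes contains [I]. *)
Definition krull_dim_gt (I : submodClosed R^o) (d : nat) : Prop :=
  exists P : nat -> {pred R},
    (forall i, (i <= d.+1)%N -> prime_ideal (P i) /\ {subset I <= P i}) /\
    (forall i, (i <= d)%N -> {subset P i <= P i.+1} /\ ~ {subset P i.+1 <= P i}).

(* [R / I] is generalized Cohen-Macaulay with respect to the ideal [(x)]. *)
Definition generalized_CM n (x : 'I_n -> R) (I : submodClosed R^o) : Prop :=
  forall i, krull_dim_gt I i -> finite_length (local_cohomology x (quotmod I) i).

End Ideals.

Section Graphs.
Variables (T : finType) (e : rel T).
Implicit Types (A C S : {set T}) (v : T).

(* A set [A] of vertices stands for the induced subgraph on [A]. *)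

Definition independent A S : bool :=
  (S \subset A) && [forall u in S, forall w in S, ~~ e u w].

Definition max_independent A S : bool := maxset (independent A) S.

Definition well_covered A : Prop :=
  forall S S', max_independent A S -> max_independent A S' -> #|S| = #|S'|.

Definition independence_number A : nat := \max_(S | independent A S) #|S|.

Definition W2 A : Prop :=
  well_covered A /\
  forall v, v \in A ->
    well_covered (A :\ v) /\
    independence_number (A :\ v) = independence_number A.

Definition triangle_free A : Prop :=
  forall u v w, u \in A -> v \in A -> w \in A -> ~~ [&& e u v, e v w & e u w].

Definition del_nbhd v : {set T} := [set w | (w != v) && ~~ e v w].

Definition components A : {set {set T}} :=
  equivalence_partition
    (connect (fun u w => [&& u \in A, w \in A & e u w])) A.

End Graphs.

Definition edge_ideal (K : fieldType) n (e : rel 'I_n) :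
    submodClosed {mpoly K[n]}^o :=
  ideal_gen (fun p : {mpoly K[n]} =>
    `[< exists i j, e i j /\ p = 'X_i * 'X_j >]).

(* Main.v *)
(** Everything is graded by integer vectors [a].  In degree [a] the Cech complex
    of [R / I^2] is the cochain complex of the family of those sets [S] that
    contain [F = {t | a_t < 0}] and for which [x^a] stays nonzero after
    inverting the variables in [S].  For a monomial ideal this family depends on
    [a] only through [F] and finitely many values of the nonnegative entries, and
    it is a cone as soon as some entry is large; hence [H^i] has finite length
    iff these complexes are exact in degree [i] for every [a] with [F] nonempty.

    Sufficiency.  Let [F] be nonempty and stable, and let [A] be the set of
    vertices outside the closed neighbourhood of [F].  If the graph on [A] is
    triangle-free, the family in degree [a] consists of the [S] for which
    [S] together with the positive support of [a], minus at most one vertex of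
    multiplicity one, is stable.  All these families are cones, or are glued from
    cones and from complexes of stable sets of [A] or of [A] with a nonempty
    stable set [X] removed.  The latter are acyclic: a maximal chain of deletions
    reduces to [X] = the neighbourhood of a vertex, where the complex is a cone.

    Necessity.  Nonvanishing classes come from three kinds of degrees: [-1] on a
    maximal stable set (well-coveredness), and in addition [+1] on a triangle
    (the complex is a single face) or on an edge (it is disconnected). *)

Require Import Defs.
From mathcomp Require Import all_boot all_order all_algebra ring_quotient.
From mathcomp Require Import boolp mpoly zify.

Set Implicit Arguments.
Unset Strict Implicit.
Unset Printing Implicit Defensive.

Import Order.TTheory GRing.Theory Num.Theory.
Local Open Scope ring_scope.

(** * Cochain complexes of families of sets *)

Section SetComplex.
Variables (K : fieldType) (n : nat).
Implicit Types (S T : {set 'I_n}) (D P : pred {set 'I_n}) (g b : {set 'I_n} -> K).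

(** The cohomological degrees concerned are those below the independence number, because that number
    is the dimension of [R / I^2]: a prime contains [I^2] exactly when the variables in it cover
    every edge. Bounding the length of a chain of primes is done by counting monomials.

    The square itself has no description by one removable vertex; the second symbolic power has. In
    degrees with [F] nonempty the two agree as soon as [A] contains no triangle, and this is how
    triangle-freeness enters the sufficiency.

    The families are not simplicial complexes: their members all contain [F], and only closure under
    intermediate sets survives. The degree is the cardinality of [S], with [F] counted. A link is
    therefore written with its vertex moved into [F]; its degrees do not shift, and the bound
    [#|F| + k], with [k] the independence number on [A], is invariant under passing to links. *)

Definition sg T (j : 'I_n) := #|[set k in T | (k < j)%N]|.

Definition cobord g T : K := \sum_(j in T) (-1) ^+ sg T j * g (T :\ j).

Definition cochain_on D i g := forall S, D S && (#|S| == i) = false -> g S = 0.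

(** Cochains vanish off [D], and coboundaries are read on members of [D] only, as in a quotient of a
    subcomplex of the full simplex. *)
Definition exact_at D i := forall g, cochain_on D i g ->
  (forall T, D T -> cobord g T = 0) ->
  exists b, (forall S, D S && (#|S|.+1 == i) = false -> b S = 0) /\
    forall T, D T -> cobord b T = g T.

Definition convex D := forall S T U : {set 'I_n},
  S \subset T -> T \subset U -> D S -> D U -> D T.

Definition restr D g : {set 'I_n} -> K := fun S => if D S then g S else 0.

Lemma sgD1 T j k : k \in T -> sg T j = (sg (T :\ k) j + (k < j))%N.
Proof.
move=> Tk; rewrite /sg addnC (cardsD1 k) inE Tk /=; congr (_ + _)%N.
by apply: eq_card => l; rewrite !inE andbA.
Qed.

Lemma cobordD g b T : cobord (fun S => g S + b S) T = cobord g T + cobord b T.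
Proof. by rewrite -big_split; apply: eq_bigr => j _; rewrite mulrDr. Qed.

Lemma cobordB g b T : cobord (fun S => g S - b S) T = cobord g T - cobord b T.
Proof. by rewrite -sumrB; apply: eq_bigr => j _; rewrite mulrBr. Qed.

Lemma eq_cobord g b T :
  (forall j, j \in T -> g (T :\ j) = b (T :\ j)) -> cobord g T = cobord b T.
Proof. by move=> E; apply: eq_bigr => j /E ->. Qed.

Lemma cobord0 g T : (forall j, j \in T -> g (T :\ j) = 0) -> cobord g T = 0.
Proof. by move=> E; apply: big1 => j /E ->; rewrite mulr0. Qed.

(** Removing the smaller of the two indices lowers the sign exponent of the larger one by one, while
    removing the larger leaves the other exponent unchanged. *)
Lemma sgn_swap T j k : j \in T -> k \in T -> j != k ->
  (-1) ^+ (sg T j + sg (T :\ j) k) = - (-1) ^+ (sg T k + sg (T :\ k) j) :> K.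
Proof.
move=> Tj Tk jk; rewrite (sgD1 j Tk) (sgD1 k Tj) -[RHS]mulN1r.
rewrite -[RHS](exprS (-1)) -signr_odd -[RHS]signr_odd.
congr (_ ^+ nat_of_bool _).
by rewrite /= !oddD !oddb; move: jk; rewrite -val_eqE /=;
  case: ltngtP => //= _ _; do 2!case: (odd _).
Qed.

Lemma cobord_cobord g T : cobord (cobord g) T = 0.
Proof.
pose F j k := (-1) ^+ (sg T j + sg (T :\ j) k) * g (T :\: [set j; k]) : K.
have FN j k : j \in T -> k \in T -> j != k -> F j k = - F k j.
  by move=> Tj Tk jk; rewrite /F sgn_swap // mulNr setUC.
have -> : cobord (cobord g) T = \sum_(j in T) \sum_(k in T | k != j) F j k.
  apply: eq_bigr => j Tj; rewrite /cobord mulr_sumr.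
  rewrite (eq_bigl (fun k => (k \in T) && (k != j))); last first.
    by move=> k; rewrite !inE andbC.
  by apply: eq_bigr => k _; rewrite mulrA -exprD setDDl.
rewrite (eq_bigr (fun j : 'I_n => \sum_(k in T | (k < j)%N) F j k
                         + \sum_(k in T | (j < k)%N) F j k)); last first.
  move=> j Tj; rewrite (bigID (fun k : 'I_n => (k < j)%N)) /=.
  by congr (_ + _); apply: eq_bigl => k; rewrite -val_eqE /= -andbA;
    case: ltngtP.
rewrite big_split /= [X in _ + X](exchange_big_dep (fun k => k \in T)) /=;
  last by move=> j k _ /andP[].
rewrite -big_split /= big1 // => j Tj.
rewrite [X in _ + X](eq_bigr (fun k => - F j k)) ?sumrN; last first.
  by move=> k /and3P[Tk _ kj]; rewrite FN // -val_eqE /= ltn_eqF.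
by apply/eqP; rewrite subr_eq0; apply/eqP/eq_bigl => k; rewrite Tj.
Qed.

(** If [T :\ j] is outside [D] while [T] is inside, convexity keeps every subset of [T :\ j] outside
    [D]; so restricting to [D] discards only zeros below [T]. *)
Lemma cobord_restr D g T : convex D -> (forall S, ~~ D S -> g S = 0) -> D T ->
  cobord (restr D (cobord g)) T = 0.
Proof.
move=> cD g0 DT; rewrite -[RHS](cobord_cobord g T).
apply: eq_cobord => j Tj; rewrite /restr; case: ifP => // nD.
apply/esym/cobord0 => k Tk; apply: g0; apply: contraFN nD => DTk.
by apply: (cD _ _ _ _ _ DTk DT); rewrite subsetDl.
Qed.

Lemma exact_at_void D i : (forall S, D S -> #|S| != i) -> exact_at D i.
Proof.
move=> D0 g g0 _; exists (fun=> 0); split=> // T DT; rewrite cobord0 //.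
by rewrite g0 // DT (negPf (D0 _ DT)).
Qed.

Lemma eq_exact_at D1 D2 i : D1 =1 D2 -> exact_at D1 i -> exact_at D2 i.
Proof.
move=> E ex1 g g0 dg; have [|T|b [b0 db]] := ex1 g.
- by move=> S; rewrite E; apply: g0.
- by rewrite E; apply: dg.
by exists b; split=> [S|T]; rewrite -E; [apply: b0 | apply: db].
Qed.

(** Adjoining [t], with sign, to the sets that avoid it is a contracting homotopy. *)
Lemma cone_exact_at D t i : (forall S, D (t |: S) = D S) -> exact_at D i.
Proof.
move=> Dt g g0 dg.
exists (fun S => if t \in S then 0 else (-1) ^+ sg (t |: S) t * g (t |: S)).
split=> [S nS|T DT].
  case: ifP => // tS; rewrite g0 ?mulr0 // Dt cardsU1 tS add1n.
  by rewrite nS.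
have [tT|tT] := boolP (t \in T).
  rewrite /cobord (bigD1 t) //= setD11 setD1K // big1 => [|j /andP[Tj jt]].
    by rewrite addr0 mulrA -exprD addnn -signr_odd odd_double mul1r.
  by rewrite !inE eq_sym jt tT mulr0.
(* The cocycle equation on [t |: T] expresses [g T] by the values of [g] on sets containing [t]. *)
have := dg (t |: T); rewrite Dt => /(_ DT).
rewrite /cobord (bigD1 t) ?setU11 //= setU1K // => /eqP; rewrite addr_eq0.
move=> /eqP E.
have -> : g T = (-1) ^+ sg (t |: T) t * ((-1) ^+ sg (t |: T) t * g T).
  by rewrite mulrA -exprD addnn -signr_odd odd_double mul1r.
rewrite E mulrN mulr_sumr -sumrN.
rewrite [RHS](eq_bigl (mem T)); last first.
  by move=> j; rewrite !inE; case: (j =P t) => [->|_];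
    rewrite ?(negPf tT) ?andbF ?andbT.
apply: eq_bigr => j Tj.
have jt : j != t by apply: contraNneq tT => <-.
have -> : t |: T :\ j = (t |: T) :\ j.
  by apply/setP=> k; rewrite !inE; case: (k =P t) => [->|] //=; rewrite eq_sym jt.
rewrite !inE (negPf tT) andbF !mulrA -!exprD -mulNr; congr (_ * _).
have tTj : j \in t |: T by rewrite !inE Tj orbT.
have -> : sg T j = sg ((t |: T) :\ t) j by rewrite setU1K.
rewrite (sgD1 t tTj) [sg _ j in RHS](@sgD1 _ j t) ?setU11 //.
set p := sg (_ :\ j) t; set q := sg (_ :\ t) j.
rewrite -[RHS]mulN1r -[RHS](exprS (-1)).
rewrite -signr_odd -[RHS]signr_odd; congr (_ ^+ nat_of_bool _).
rewrite /= !oddD !oddb; move: jt; rewrite -val_eqE /=.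
by case: ltngtP => //= _ _; do 2!case: (odd _).
Qed.

(** * The long exact sequence of a family cut in two *)

Section LongExact.
Variables (D P : pred {set 'I_n}).
Hypotheses (cD : convex D)
  (downP : forall S T, S \subset T -> D S -> D T -> P T -> P S).
Let D1 := [pred S | D S && P S].
Let D2 := [pred S | D S && ~~ P S].

Let cobord_up b T :
  (forall S, ~~ D2 S -> b S = 0) -> D1 T -> cobord b T = 0.
Proof.
move=> b0 /andP[DT PT]; apply: cobord0 => j Tj; apply: b0.
apply/negP=> /andP[DTj /negP[]].
by apply: downP PT => //; rewrite subsetDl.
Qed.

Let cobord_restr1 b T : (forall S, ~~ D S -> b S = 0) -> D1 T ->
  cobord (restr D1 b) T = cobord b T.
Proof.
move=> b0 /andP[DT PT]; apply: eq_cobord => j Tj; rewrite /restr.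
case: ifP => // /negP nD1; rewrite b0 //; apply/negP => DTj; apply: nD1.
by rewrite /= DTj; apply: downP PT => //; rewrite subsetDl.
Qed.

(* [D1] is closed under subsets within [D], so the cochains on [D2] form a
   subcomplex of those on [D], with quotient the cochains on [D1]; the next three
   lemmas are the pieces of the long exact sequence. *)
Lemma exact_at_ext i : exact_at D1 i -> exact_at D2 i -> exact_at D i.
Proof.
move=> ex1 ex2 g g0 dg.
have g00 S : ~~ D S -> g S = 0 by move=> /negPf DS; rewrite g0 // DS.
have [S|T DT|b1 [b10 db1]] := ex1 (restr D1 g).
- by rewrite /restr /=; case: ifP => //= _ E; rewrite g0 // E andbF.
- by rewrite cobord_restr1 // dg //; case/andP: DT.
have b1D S : ~~ D S -> b1 S = 0.
  by move=> /negPf DS; apply: b10; rewrite /= DS.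
(* Subtracting a coboundary kills the part on [D1] and leaves a cocycle of the subcomplex on
   [D2]. *)
pose g2 S := g S - restr D (cobord b1) S.
have g20 S : D1 S -> g2 S = 0.
  by move=> D1S; rewrite /g2 /restr; case/andP: (D1S) => -> _;
    rewrite db1 // /restr D1S subrr.
have [S|T /andP[DT _]|b2 [b20 db2]] := ex2 g2.
- have [D1S _|nD1] := boolP (D1 S); first exact: g20.
  have [DS /= |nD _] := boolP (D S); last by rewrite /g2 /restr (negPf nD) g00 // subrr.
  move=> E; rewrite /g2 /restr DS g0 ?sub0r; last first.
    by move: nD1 E; rewrite /= DS /= => ->.
  have Si : #|S| != i by move: nD1 E; rewrite /= DS /= => -> /= /negbT.
  rewrite cobord0 ?oppr0 // => j Sj; apply: b10.
  apply/negbTE; apply: contra Si => /andP[_ /eqP<-].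
  by rewrite [in X in X == _](cardsD1 j) Sj.
- by rewrite cobordB dg // cobord_restr // subrr.
have b2D S : ~~ D2 S -> b2 S = 0 by move=> /negPf DS; apply: b20; rewrite DS.
exists (fun S => b1 S + b2 S); split=> [S E|T DT].
  by rewrite b10 ?b20 ?addr0 //= ; move: E; case: (D S) => //= ->; rewrite andbF.
rewrite cobordD; have [PT|PT] := boolP (P T).
  have D1T : D1 T by rewrite /= DT.
  by rewrite db1 // cobord_up // addr0 /restr D1T.
by rewrite db2 /= ?DT // /g2 /restr DT addrC subrK.
Qed.

Lemma exact_at_up i : exact_at D i.+1 -> exact_at D1 i -> exact_at D2 i.+1.
Proof.
move=> ex ex1 g g0 dg.
have g2D S : ~~ D2 S -> g S = 0 by move=> /negPf DS; rewrite g0 // DS.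
have [S E|T DT|b [b0 db]] := ex g.
- by apply: g0; move: E => /=; case: (D S) => //= ->; rewrite andbF.
- have [PT|PT] := boolP (P T); first by rewrite cobord_up //= DT.
  by apply: dg; rewrite /= DT.
have bD S : ~~ D S -> b S = 0 by move=> /negPf DS; apply: b0; rewrite DS.
have [S|T D1T|c [c0 dc]] := ex1 (restr D1 b).
- by rewrite /restr; case: ifP => //= /andP[DS _] E; apply: b0; rewrite DS eqSS.
- rewrite cobord_restr1 //; case/andP: D1T => DT PT.
  by rewrite db // g2D //= DT PT.
have cD' S : ~~ D S -> c S = 0 by move=> /negPf DS; apply: c0; rewrite /= DS.
(* On [D1] the primitive [b] is itself a cocycle, hence the coboundary of [c]; the correction makes
   it vanish there. *)
exists (fun S => b S - restr D (cobord c) S); split=> [S E|T D2T]; last first.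
  have /andP[DT _] := D2T.
  by rewrite cobordB db // cobord_restr // subr0.
have [D1S|nD1] := boolP (D1 S).
  have /andP[DS _] := D1S.
  by rewrite {1}/restr DS dc // /restr D1S subrr.
have [DS|nD] := boolP (D S); last by rewrite /restr (negPf nD) bD // subrr.
have Si : #|S| != i by move: nD1 E; rewrite /= DS /= => -> /= /negbT.
rewrite b0 ?DS //=; last by rewrite eqSS (negPf Si).
rewrite /restr DS cobord0 ?subrr // => j Sj; apply: c0.
apply/negbTE; apply: contra Si => /andP[_ /eqP<-].
by rewrite [in X in X == _](cardsD1 j) Sj.
Qed.

Lemma exact_at_down i : exact_at D i -> exact_at D2 i.+1 -> exact_at D1 i.
Proof.
move=> ex ex2 g g0 dg.
have gD S : ~~ D S -> g S = 0 by move=> /negPf DS; rewrite g0 //= DS.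
have ED S : restr D (cobord g) S = restr D2 (cobord g) S.
  rewrite /restr /=; case: (boolP (D S)) => //= DS.
  by case: (boolP (P S)) => //= PS; apply: dg; rewrite /= DS.
(* The connecting map: the coboundary of [g] lives on [D2] and has a primitive [b] there, so [g - b]
   is a cocycle on all of [D]. *)
have [S|T DT|b [b0 db]] := ex2 (restr D2 (cobord g)).
- rewrite /restr; case: ifP => //= _ E; apply: cobord0 => j Sj; apply: g0.
  by rewrite (cardsD1 j) Sj eqSS in E; rewrite E andbF.
- rewrite -[RHS](cobord_restr cD gD (T := T)); last by case/andP: DT.
  by apply: eq_cobord => j _; rewrite ED.
have b2 S : ~~ D2 S -> b S = 0 by move=> /negPf DS; apply: b0; rewrite DS.
have [S E|T DT|c [c0 dc]] := ex (fun S => g S - b S).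
- rewrite g0 ?b0 ?subr0 //=; first by move: E; rewrite eqSS; case: (D S) => //= ->; rewrite andbF.
  by move: E; case: (D S) => //= ->; rewrite andbF.
- rewrite cobordB; have [PT|PT] := boolP (P T).
    by rewrite (cobord_up b2) ?dg ?subrr //= DT PT.
  have D2T : D2 T by rewrite /= DT.
  by rewrite db // /restr D2T subrr.
have cD' S : ~~ D S -> c S = 0 by move=> /negPf DS; apply: c0; rewrite /= DS.
exists (restr D1 c); split=> [S|T D1T].
  by rewrite /restr; case: ifP => //= /andP[DS _] E; apply: c0; rewrite DS.
have /andP[DT PT] := D1T.
by rewrite cobord_restr1 // dc // b2 ?subr0 //= DT PT.
Qed.

End LongExact.

(** The complex is one copy of [K] in degree [#|F|], so the indicator of [F] is a nonzero class. *)
Lemma exact_at_singleton D F : (forall S, D S = (S == F)) -> ~ exact_at D #|F|.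
Proof.
move=> DE /(_ (fun S => (S == F)%:R)) [S|T|b [b0 db]].
- by rewrite DE; case: eqP => // ->; rewrite eqxx.
- rewrite DE => /eqP->; apply: cobord0 => j Fj; case: eqP => // /setP/(_ j).
  by rewrite !inE eqxx Fj.
have := db F; rewrite DE eqxx => /(_ isT); rewrite cobord0.
  by move/eqP; rewrite eq_sym oner_eq0.
move=> j Fj; apply: b0; rewrite DE; case: eqP => // /setP/(_ j).
by rewrite !inE eqxx Fj.
Qed.

End SetComplex.

(** * Graded pieces of the localizations *)

Section Degrees.
Variables (K : fieldType) (n : nat).
Local Notation deg := {ffun 'I_n -> int}.
Local Notation R := {mpoly K[n]}.
Implicit Types (a b : deg) (m : 'X_{1..n}) (p q : R) (S T : {set 'I_n}).

Definition zdeg m : deg := [ffun i => (m i)%:Z].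
Definition ndeg a : 'X_{1..n} := [multinom `|a i|%N | i < n].
(** [ndeg] takes absolute values, so the test says that [a] has no negative entry: coefficients are
    extended by zero to Laurent exponents. *)
Definition zcoef p a : K := if zdeg (ndeg a) == a then p@_(ndeg a) else 0.

Lemma zdegK m : ndeg (zdeg m) = m.
Proof. by apply/mnmP => i; rewrite mnmE ffunE absz_nat. Qed.

Lemma ndegK a : (forall i, 0 <= a i) -> zdeg (ndeg a) = a.
Proof. by move=> a0; apply/ffunP => i; rewrite ffunE mnmE gez0_abs. Qed.

Lemma zdegD m1 m2 : zdeg (m1 + m2) = zdeg m1 + zdeg m2.
Proof. by apply/ffunP => i; rewrite !ffunE mnmDE PoszD. Qed.

Lemma mulmnDr m k l : (m *+ (k + l))%MM = (m *+ k + m *+ l)%MM.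
Proof. by apply/mnmP => i; rewrite mnmDE !mulmnE mulnDr. Qed.

Lemma mulmnDl m1 m2 k : ((m1 + m2) *+ k)%MM = (m1 *+ k + m2 *+ k)%MM.
Proof. by apply/mnmP => i; rewrite mnmDE !mulmnE mnmDE mulnDl. Qed.

Lemma zcoef_zdeg p m : zcoef p (zdeg m) = p@_m.
Proof. by rewrite /zcoef zdegK eqxx. Qed.

Lemma zcoefD p q a : zcoef (p + q) a = zcoef p a + zcoef q a.
Proof. by rewrite /zcoef; case: ifP; rewrite ?mcoeffD ?addr0. Qed.

Lemma zcoefC c p a : zcoef (c%:MP * p) a = c * zcoef p a.
Proof. by rewrite /zcoef; case: ifP; rewrite ?mcoeffCM ?mulr0. Qed.

Lemma zcoef_neg p a i : a i < 0 -> zcoef p a = 0.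
Proof.
move=> ai; rewrite /zcoef; case: eqP => // /ffunP/(_ i).
by rewrite !ffunE mnmE => E; move: ai; rewrite -E.
Qed.

Lemma zcoefX m a : zcoef 'X_[m] a = (zdeg m == a)%:R.
Proof.
rewrite /zcoef mcoeffX; case: (eqVneq (zdeg m) a) => [<-|ne].
  by rewrite zdegK !eqxx.
case: eqP => // E; case: eqP => // Em.
by rewrite Em E eqxx in ne.
Qed.

Lemma zcoefMX p m a : zcoef (p * 'X_[m]) (a + zdeg m) = zcoef p a.
Proof.
have [[m' ->]|na] := pselect (exists m', a = zdeg m').
  by rewrite -zdegD !zcoef_zdeg addmC mcoeffMX.
have [i ai] : exists i, a i < 0.
  apply: contrapT => na'; apply: na; exists (ndeg a); rewrite ndegK // => i.
  by rewrite leNgt; apply/negP => ai; apply: na'; exists i.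
rewrite (zcoef_neg _ ai) /zcoef; case: eqP => // E.
apply/eqP; rewrite mcoeff_eq0 (perm_mem (msuppMX p m)).
apply/mapP => -[m' _ Em]; have /ffunP/(_ i) := E; rewrite Em zdegD !ffunE.
by rewrite addrC => /addIr E'; move: ai; rewrite -E'.
Qed.

End Degrees.

(** * Coefficients of fractions modulo a monomial ideal *)

Section MonomialIdeal.
Variables (K : fieldType) (n : nat) (gens : seq 'X_{1..n}).
Local Notation deg := {ffun 'I_n -> int}.
Local Notation R := {mpoly K[n]}.
Variable J : submodClosed R^o.
Hypothesis J_mem : forall p : R,
  p \in J <-> forall m, m \in msupp p -> has (fun g => (g <= m)%MM) gens.
Local Notation frac := Defs.frac.
Local Notation x := (fun i : 'I_n => 'X_i : R).
Implicit Types (a : deg) (m : 'X_{1..n}) (p q : R) (S T : {set 'I_n}).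

Definition nonneg_off S a := [forall i, (i \notin S) ==> (0 <= a i)].

(* [x ^ a] lies in the localization of [R] at the variables in [S], but not in
   that of [J]. *)
Definition active a S := nonneg_off S a &&
  ~~ has (fun g : 'X_{1..n} =>
       [forall i, (i \notin S) ==> ((g i)%:Z <= a i)]) gens.

Lemma active_sub a S T : S \subset T -> nonneg_off S a -> active a T -> active a S.
Proof.
move=> ST Sa /andP[Ta nT]; apply/andP; split => //; apply: contra nT.
move=> /hasP[g gG /forallP gS]; apply/hasP; exists g => //; apply/forallP => i.
apply/implyP => iT; apply: (implyP (gS i)); apply: contra iT.
exact: (subsetP ST).
Qed.

Definition mset S : 'X_{1..n} := [multinom (i \in S : nat) | i < n].

Lemma cech_eltX S : cech_elt x S = 'X_[mset S].
Proof.
rewrite /cech_elt mpolyXE_id big_mkcond; apply: eq_bigr => i _.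
by rewrite mnmE; case: (i \in S); rewrite ?expr1 ?expr0.
Qed.

Lemma cech_eltXn S k : cech_elt x S ^+ k = 'X_[mset S *+ k].
Proof. by rewrite cech_eltX mpolyXn. Qed.

Lemma msetE S k i : (mset S *+ k)%MM i = ((i \in S) * k)%N.
Proof. by rewrite mulmnE mnmE. Qed.

Lemma zdeg_msetE S k i : zdeg (mset S *+ k) i = ((i \in S) * k)%N.
Proof. by rewrite ffunE msetE. Qed.

Definition jpi p : quotmod J := quotmod_pi J p.

Lemma jpiZ r p : r *: jpi p = jpi (r * p).
Proof. exact: quotmod_scaleE. Qed.

Lemma jpi0 : jpi 0 = 0.
Proof. by rewrite -(scale0r (jpi 0)) jpiZ mul0r. Qed.

Lemma jpiD p q : jpi p + jpi q = jpi (p + q).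
Proof. by rewrite [RHS]quotmod_piD. Qed.

Lemma jpi_repr (u : quotmod J) : u = jpi (repr u).
Proof. by rewrite /jpi /quotmod_pi reprK. Qed.

Lemma jpiP p q : jpi p = jpi q <-> p - q \in J.
Proof. by split=> [/quotmod_piP|/quotmod_piP]. Qed.

Lemma zcoefJ S p a k : p \in J -> active a S ->
  zcoef p (a + zdeg (mset S *+ k)) = 0.
Proof.
move=> /J_mem Jp /andP[_ /negP nJ]; rewrite /zcoef; case: eqP => // E.
apply/eqP; rewrite mcoeff_eq0; apply/negP => /Jp /hasP[g gG /mnm_lepP le_g].
apply: nJ; apply/hasP; exists g => //; apply/forallP => i; apply/implyP => iS.
have /ffunP/(_ i) := E; rewrite ffunE [RHS]ffunE zdeg_msetE (negPf iS) mul0n addr0.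
by move=> <-; rewrite lez_nat.
Qed.

(** Equal fractions have cross-multiplied numerators that differ by an element of [J], and such an
    element has no monomial in an active degree. *)
Lemma frac_zcoef S p q k l a :
  frac (cech_elt x S) (jpi p) k = frac (cech_elt x S) (jpi q) l -> active a S ->
  zcoef p (a + zdeg (mset S *+ k)) = zcoef q (a + zdeg (mset S *+ l)).
Proof.
move=> /fracP[t]; rewrite !jpiZ => /jpiP Jpq Sa.
have := zcoefJ (t + k + l)%N Jpq Sa.
rewrite -mulN1r -mpolyC1 -mpolyCN zcoefD zcoefC mulN1r => /eqP.
rewrite subr_eq0 !cech_eltXn => /eqP.
have Ekl j : forall r k' l' : nat, (r + k' + l')%N = j -> forall s : R,
    zcoef ('X_[mset S *+ (r + l')] * s) (a + zdeg (mset S *+ j)) =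
    zcoef s (a + zdeg (mset S *+ k')).
  move=> r k' l' <- s; rewrite mulrC -[RHS](zcoefMX _ (mset S *+ (r + l'))).
  by rewrite -addrA -zdegD -mulmnDr addnA [(k' + r)%N]addnC.
rewrite (Ekl _ t k l) // (Ekl _ t l k) //; lia.
Qed.

Definition locM S := loc (quotmod J) (cech_elt x S).

(** In an inactive degree the graded piece is zero, while the coefficient of a chosen representative
    may not be; hence the value 0 there. *)
Definition lcoef S (u : locM S) a : K :=
  if active a S then zcoef (repr (repr u).1) (a + zdeg (mset S *+ (repr u).2))
  else 0.

Definition lfrac S p k : locM S := frac (cech_elt x S) (jpi p) k.

Lemma lfrac_ind S (P : locM S -> Prop) :
  (forall p k, P (lfrac S p k)) -> forall u, P u.
Proof.
move=> Pf u; rewrite -[u]frac_repr [(repr u).1]jpi_repr; exact: Pf.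
Qed.

Lemma lcoefE S p k a : lcoef (lfrac S p k) a =
  if active a S then zcoef p (a + zdeg (mset S *+ k)) else 0.
Proof.
rewrite /lcoef; case: ifP => // Sa; apply: frac_zcoef => //.
by rewrite -jpi_repr frac_repr.
Qed.

Lemma lcoef_inactive S (u : locM S) a : ~~ active a S -> lcoef u a = 0.
Proof. by move=> /negPf Sa; rewrite /lcoef Sa. Qed.

Lemma lfracZ S r p k : r *: lfrac S p k = lfrac S (r * p) k.
Proof. by rewrite /lfrac fracZ jpiZ. Qed.

Lemma lfracD S p q k l : lfrac S p k + lfrac S q l =
  lfrac S ('X_[mset S *+ l] * p + 'X_[mset S *+ k] * q) (k + l).
Proof. by rewrite /lfrac fracD !jpiZ jpiD !cech_eltXn. Qed.

Lemma lcoefD S (u v : locM S) a : lcoef (u + v) a = lcoef u a + lcoef v a.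
Proof.
elim/lfrac_ind: u => p k; elim/lfrac_ind: v => q l.
rewrite lfracD !lcoefE; case: ifP => _; last by rewrite addr0.
rewrite zcoefD mulrC ['X_[_] * q]mulrC mulmnDr zdegD; congr (_ + _).
  by rewrite addrA zcoefMX.
by rewrite [zdeg _ + _]addrC addrA zcoefMX.
Qed.

Lemma lcoefC S c (u : locM S) a : lcoef (c%:MP *: u) a = c * lcoef u a.
Proof.
elim/lfrac_ind: u => p k; rewrite lfracZ !lcoefE.
by case: ifP => _; rewrite ?mulr0 // zcoefC.
Qed.

Lemma lcoef0 S a : lcoef (0 : locM S) a = 0.
Proof. by rewrite -[0](scale0r 0) -mpolyC0 lcoefC mul0r. Qed.

Lemma lcoefB S (u v : locM S) a : lcoef (u - v) a = lcoef u a - lcoef v a.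
Proof. by rewrite -scaleN1r -mpolyC1 -mpolyCN lcoefD lcoefC mulN1r. Qed.

Lemma lcoef_sum S (I : Type) (r : seq I) (P : pred I) (F : I -> locM S) a :
  lcoef (\sum_(i <- r | P i) F i) a = \sum_(i <- r | P i) lcoef (F i) a.
Proof.
apply: (big_morph (fun u : locM S => lcoef u a)); last exact: lcoef0.
by move=> u v; apply: lcoefD.
Qed.

Lemma lcoef_eq0 S (u : locM S) : (forall a, lcoef u a = 0) -> u = 0.
Proof.
elim/lfrac_ind: u => p k u0.
(* [t] bounds every exponent of every generator: after multiplication by the [t]-th power of the
   variables in [S], divisibility by a generator is a condition off [S] only. *)
pose t := (\sum_(g <- gens) mdeg g)%N.
apply/fracP; exists t; rewrite scaler0 jpiZ cech_eltXn addn0 -jpi0.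
apply/jpiP; rewrite subr0; apply/J_mem => m.
rewrite mulrC (perm_mem (msuppMX _ _)) => /mapP[m' pm' ->].
have := u0 (zdeg m' - zdeg (mset S *+ k)); rewrite lcoefE subrK zcoef_zdeg.
case: ifP => [_ /eqP|nS _]; first by rewrite mcoeff_eq0 pm'.
have : ~~ active (zdeg m' - zdeg (mset S *+ k)) S by rewrite nS.
rewrite /active negb_and => /orP[/negP[]|].
  apply/forallP => i; apply/implyP => iS.
  by rewrite ffunE [X in _ + X]ffunE zdeg_msetE (negPf iS) mul0n subr0 ffunE.
rewrite negbK => /hasP[g gG /forallP gS]; apply/hasP; exists g => //.
apply/mnm_lepP => i; rewrite mnmDE msetE; have /implyP := gS i.
case: (boolP (i \in S)) => iS /=.
  move=> _; rewrite mul1n; apply: leq_trans (leq_addr _ _).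
  rewrite /t (big_rem g) //=; apply: leq_trans (leq_addr _ _).
  by rewrite mdegE (bigD1 i) //= leq_addr.
move=> /(_ isT); rewrite ffunE [X in _ + X]ffunE zdeg_msetE (negPf iS) mul0n subr0.
by rewrite ffunE lez_nat.
Qed.

Lemma lcoef_inj S (u v : locM S) : (forall a, lcoef u a = lcoef v a) -> u = v.
Proof.
move=> uv; apply/eqP; rewrite -subr_eq0; apply/eqP/lcoef_eq0 => a.
by rewrite lcoefB uv subrr.
Qed.

Lemma lcoef_fin S (u : locM S) :
  exists s : seq deg, forall a, lcoef u a != 0 -> a \in s.
Proof.
elim/lfrac_ind: u => p k.
exists [seq zdeg m - zdeg (mset S *+ k) | m <- msupp p] => a.
rewrite lcoefE; case: ifP => _; last by rewrite eqxx.
rewrite /zcoef; case: (zdeg _ =P _) => [E|]; last by rewrite eqxx.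
rewrite -mcoeff_msupp => pm; apply/mapP; exists (ndeg (a + zdeg (mset S *+ k))) => //.
by rewrite E addrK.
Qed.

Lemma lcoef_map (T : {set 'I_n}) j (u : locM (T :\ j)) a : j \in T ->
  lcoef (loc_map ('X_j : R) (cech_elt x T) u : locM T) a =
  if active a T then lcoef u a else 0.
Proof.
move=> Tj; elim/lfrac_ind: u => p k.
rewrite (loc_mapE _ _ (cech_eltD1 x Tj)) jpiZ -[frac _ _ _]/(lfrac T _ k) !lcoefE.
case: ifP => // Ta; rewrite mulrC mpolyXn.
have -> : zdeg (mset T *+ k) = zdeg (mset (T :\ j) *+ k) + zdeg (U_(j) *+ k).
  rewrite -zdegD -mulmnDl; congr zdeg; congr (_ *+ k)%MM.
  apply/mnmP => i; rewrite mnmDE !mnmE !inE [j == i]eq_sym.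
  by case: eqP => [->|_] /=; rewrite ?Tj ?addn0.
rewrite addrA zcoefMX; case: ifP => // nTj.
(* When [T] is active, [T :\ j] can fail to be so only through a negative entry of [a] outside it,
   and then the coefficient is zero. *)
have [na|[i [iTj ai]]] : nonneg_off (T :\ j) a \/ exists i, i \notin T :\ j /\ a i < 0.
- have [|/forallPn[i]] := boolP (nonneg_off (T :\ j) a); first by left.
  by rewrite negb_imply -ltNge => /andP[]; right; exists i.
- by rewrite (active_sub _ na Ta) ?subsetDl in nTj.
apply: (@zcoef_neg _ _ _ _ i).
by rewrite ffunE zdeg_msetE (negPf iTj) mul0n addr0.
Qed.

(** Localization maps preserve coefficients, so in degree [a] the Cech differential becomes the
    signed coboundary of the family [active a]. *)
Lemma lcoef_diff (c : cochain x (quotmod J)) T a :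
  lcoef (cech_diff c T : locM T) a =
  if active a T then cobord (fun S => lcoef (c S : locM S) a) T else 0.
Proof.
rewrite /cech_diff lcoef_sum; case: ifP => Ta; last first.
  by rewrite big1 // => j Tj; rewrite lcoef_inactive ?Ta.
apply: eq_bigr => j Tj; rewrite -[(-1) ^+ _](_ : ((-1) ^+ sg T j)%:MP = _).
  by rewrite lcoefC lcoef_map // Ta.
by rewrite rmorphXn rmorphN rmorph1.
Qed.

(* [x ^ a] as a fraction; the exponent [k] is large enough for the numerator to be
   a monomial. *)
Definition lmono S a : locM S :=
  let k := (\sum_i `|a i|)%N in lfrac S 'X_[ndeg (a + zdeg (mset S *+ k))] k.

Lemma lcoef_mono S a (b : deg) : nonneg_off S a ->
  lcoef (lmono S a) b = if active b S then (a == b)%:R else 0.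
Proof.
move=> Sa; rewrite lcoefE; case: ifP => // _; rewrite zcoefX ndegK.
  by rewrite (inj_eq (addIr _)).
move=> i; rewrite ffunE zdeg_msetE; case: (boolP (i \in S)) => iS.
  rewrite mul1n (bigD1 i) //= PoszD; lia.
by rewrite mul0n addr0; have /forallP/(_ i)/implyP := Sa; apply.
Qed.

(** A polynomial factor only raises exponents, even those of inverted variables. This keeps the
    multiples of a class out of every degree that is smaller in some coordinate. *)
Lemma lcoef_scale_mono S a (b : deg) r (i : 'I_n) : nonneg_off S a -> b i < a i ->
  lcoef (r *: lmono S a) b = 0.
Proof.
move=> Sa ba; rewrite /lmono; set k := (\sum_i `|a i|)%N.
rewrite lfracZ lcoefE; case: ifP => // _.
set m := ndeg _.
have Em : zdeg m = a + zdeg (mset S *+ k).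
  rewrite ndegK // => l; rewrite ffunE zdeg_msetE; case: (boolP (l \in S)) => lS.
    rewrite mul1n /k (bigD1 l) //= PoszD; lia.
  by rewrite mul0n addr0; have /forallP/(_ l)/implyP := Sa; apply.
have -> : b + zdeg (mset S *+ k) = (b - a) + zdeg m by rewrite Em addrA subrK.
by rewrite zcoefMX (@zcoef_neg _ _ _ _ i) // !ffunE subr_lt0.
Qed.

(** Glues one cochain per degree over a finite list of degrees, as a fraction has finite support;
    [undup] keeps a repeated degree from counting twice. *)
Definition mkcochain (s : seq deg) (b : deg -> {set 'I_n} -> K) :
    cochain x (quotmod J) :=
  fun S => \sum_(a <- undup s) (b a S)%:MP *: lmono S a.

Lemma lcoef_mkcochain s b S a :
  (forall a' S', ~~ active a' S' -> b a' S' = 0) ->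
  lcoef (mkcochain s b S : locM S) a = if a \in s then b a S else 0.
Proof.
move=> b0; rewrite lcoef_sum.
have E a' : lcoef ((b a' S)%:MP *: lmono S a') a = if a' == a then b a S else 0.
  rewrite lcoefC; have [Sa'|/b0 E0] := boolP (active a' S); last first.
    by rewrite E0 mul0r; case: eqP => // <-.
  rewrite lcoef_mono; last by case/andP: Sa'.
  case: eqP => [<-|_]; first by rewrite Sa' mulr1.
  by rewrite if_same mulr0.
rewrite (eq_bigr _ (fun a' _ => E a')) -big_mkcond /= -mem_undup.
rewrite (eq_bigl (fun a' => a == a')); last by move=> a'; rewrite eq_sym.
case: ifP => sa; last first.
  by rewrite big1_seq // => a' /andP[/eqP<-]; rewrite sa.
by rewrite (big_rem a) //= eqxx big1_seq ?addr0 // => a' /andP[/eqP<-];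
  rewrite mem_rem_uniqF ?undup_uniq.
Qed.

End MonomialIdeal.

(** * Finite length *)

Section FiniteLength.
Variables (K : fieldType) (n : nat).
Local Notation R := {mpoly K[n]}.

Lemma submod_closed_sum (V : lmodType R) (L : {pred V}) (I : eqType) (r : seq I)
    (c : I -> R) (v : I -> V) : submod_closed L ->
  (forall i, i \in r -> c i != 0 -> v i \in L) ->
  \sum_(i <- r) c i *: v i \in L.
Proof.
case=> L0 Llin; elim: r => [|i r IHr] vL; first by rewrite big_nil.
have Lr : \sum_(j <- r) c j *: v j \in L.
  by apply: IHr => j jr; apply: vL; rewrite inE jr orbT.
rewrite big_cons; have [->|ci] := eqVneq (c i) 0; first by rewrite scale0r add0r.
by apply: Llin => //; apply: vL; rewrite ?mem_head.
Qed.

(* A chain with [k] strict inclusions yields [k] vectors that are linearly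
   independent over [K]. *)
Lemma finite_length_coords (V : lmodType R) (N : nat)
    (rep : V -> 'rV[K]_N -> Prop) :
  (forall v, exists y, rep v y) ->
  (forall u v y z c, rep u y -> rep v z -> rep (c%:MP *: u + v) (c *: y + z)) ->
  (forall v, rep v 0 -> v = 0) -> finite_length V.
Proof.
move=> rep_ex rep_lin rep_inj; exists N => k L Lsub Lprop.
rewrite leqNgt; apply/negP => ltNk.
have /choice[v vP] : forall i : 'I_k, exists v, v \in L i.+1 /\ v \notin L i.
  move=> i; case: (Lprop i (ltn_ord i)) => _ nsub.
  apply: contrapT => nv; apply: nsub => v Lv.
  by case: (boolP (v \in L i)) => // nLv; case: nv; exists v.
have /choice[y yP] := rep_ex.
have mono i j : (i <= j)%N -> (j <= k)%N -> {subset L i <= L j}.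
  move=> ij jk; elim: j ij jk => [|j IHj]; first by rewrite leqn0 => /eqP-> _ u.
  rewrite leq_eqVlt => /predU1P[-> _ u //|ij jk u Lu].
  by have [sub _] := Lprop j jk; apply: sub; apply: IHj => //; apply: ltnW.
pose A := \matrix_(i < k) y (v i).
have : kermx A != 0.
  rewrite -mxrank_eq0 mxrank_ker -lt0n subn_gt0.
  by apply: leq_ltn_trans (rank_leq_col _) ltNk.
case/rowV0Pn => w /sub_kermxP wA w0.
have rep0 : rep 0 0.
  have := rep_lin _ _ _ _ (-1) (yP 0) (yP 0).
  by rewrite scaler0 addr0 scaleN1r addNr.
have Ev : \sum_i (w 0 i)%:MP *: v i = 0.
  apply: rep_inj; rewrite -wA mulmx_sum_row.
  rewrite (eq_bigr (fun i => w 0 i *: y (v i))); last by move=> i _; rewrite rowK.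
  elim/big_ind2: _ => // [u1 y1 u2 y2 r1 r2|i _].
    have := rep_lin _ _ _ _ 1 r1 r2.
    by rewrite mpolyC1 !scale1r.
  by have := rep_lin _ _ _ _ (w 0 i) (yP (v i)) rep0; rewrite !addr0.
have [i0 wi0] : exists i, w 0 i != 0.
  apply/existsP; apply: contraNT w0 => /existsPn w0; apply/eqP/rowP => i.
  by rewrite mxE; apply/eqP/negbNE/w0.
(* For the last index with a nonzero coefficient, the relation puts [v i] into [L i], against its
   choice. *)
have [i wi imax] := @arg_maxnP _ i0 (fun i => w 0 i != 0) (fun i => nat_of_ord i) wi0.
have [_ /negP nLi] := vP i; apply: nLi.
have E : (w 0 i)%:MP *: v i = - \sum_(j | j != i) (w 0 j)%:MP *: v j.
  by move: Ev; rewrite (bigD1 i) //= => /eqP; rewrite addr_eq0 => /eqP.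
have Li := Lsub i (ltnW (ltn_ord i)); have [L0 Llin] := Li.
have LN u : u \in L i -> - u \in L i.
  by move=> Lu; have := Llin (-1) u 0 Lu L0; rewrite addr0 scaleN1r.
have -> : v i = (w 0 i)^-1%:MP *: ((w 0 i)%:MP *: v i) + 0.
  by rewrite addr0 scalerA -mpolyCM mulVf // mpolyC1 scale1r.
apply: Llin L0; rewrite E; apply: LN; rewrite -big_filter.
apply: submod_closed_sum => // j; rewrite mem_filter mpolyC_eq0 => /andP[ji _] wj.
have [Lj _] := vP j; apply: (mono j.+1 i) Lj; last exact: ltnW.
by rewrite ltn_neqAle val_eqE ji; apply: imax.
Qed.

End FiniteLength.

(** * Local cohomology of monomial ideals, degree by degree *)

Lemma quotmod_pi0 (R : pzRingType) (V : lmodType R) (N : submodClosed V) :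
  quotmod_pi N 0 = 0.
Proof. by apply: (addrI (quotmod_pi N 0)); rewrite -quotmod_piD !addr0. Qed.

Section Takayama.
Variables (K : fieldType) (n : nat) (gens : seq 'X_{1..n}).
Local Notation deg := {ffun 'I_n -> int}.
Local Notation R := {mpoly K[n]}.
Variable J : submodClosed R^o.
Hypothesis J_mem : forall p : R,
  p \in J <-> forall m, m \in msupp p -> has (fun g => (g <= m)%MM) gens.
Local Notation x := (fun i : 'I_n => 'X_i : R).
Local Notation cochains := (cochain x (quotmod J)).
Local Notation lcoef := (@lcoef K n gens J _).
Implicit Types (a : deg) (S T : {set 'I_n}) (c : cochains).

Lemma cochain_lcoef_inj c c' :
  (forall S a, lcoef (c S) a = lcoef (c' S) a) -> c = c'.
Proof.
move=> E; apply: functional_extensionality_dep => S.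
by apply: (lcoef_inj J_mem) => a; apply: E.
Qed.

Lemma cochain_lcoef_fin c :
  exists s : seq deg, forall S a, lcoef (c S) a != 0 -> a \in s.
Proof.
have /choice[s sP] : forall S, exists s : seq deg,
    forall a, lcoef (c S) a != 0 -> a \in s.
  by move=> S; apply: lcoef_fin.
exists (flatten [seq s T | T <- enum {set 'I_n}]) => S a /sP aS.
by apply/flattenP; exists (s S) => //; apply: map_f; rewrite mem_enum.
Qed.

Lemma lcoef_cocycle i c a : cocycle_pred i c ->
  cochain_on (active gens a) i (fun S => lcoef (c S) a) /\
  forall T, active gens a T -> cobord (fun S => lcoef (c S) a) T = 0.
Proof.
move=> /asboolP[c0 dc]; split=> [S|T Ta].
  have [Sa /= /negbT/c0-> |Sa _] := boolP (active gens a S).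
    exact: (lcoef0 J_mem).
  exact: lcoef_inactive.
have := lcoef_diff J_mem c T a; rewrite Ta dc => <-; exact: (lcoef0 J_mem).
Qed.

Lemma mkcochain_deg i s (b : deg -> {set 'I_n} -> K) :
  (forall a S, #|S|.+1 != i -> b a S = 0) ->
  forall S, #|S|.+1 != i -> mkcochain J s b S = 0.
Proof.
move=> b0 S iS; rewrite /mkcochain big1 // => a _.
by rewrite b0 // mpolyC0 scale0r.
Qed.

Lemma cech_diff_deg i c : (forall S, #|S|.+1 != i -> c S = 0) ->
  cochain_deg i (cech_diff c).
Proof.
move=> c0 T iT; apply: (lcoef_eq0 J_mem) => a; rewrite (lcoef_diff J_mem).
case: ifP => // _; apply: cobord0 => j Tj; rewrite c0 ?(lcoef0 J_mem) //.
by move: iT; rewrite (cardsD1 j T) Tj.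
Qed.

Lemma active_large N a t S : (forall g, g \in gens -> forall i, (g i <= N)%N) ->
  (forall i, 0 <= a i) -> N%:Z <= a t ->
  active gens a (t |: S) = active gens a S.
Proof.
move=> gN a0 at_; rewrite /active.
have nn T : nonneg_off T a by apply/forallP => i; rewrite a0 implybT.
rewrite !nn; congr (~~ _); apply: eq_in_has => g gG; apply: eq_forallb => i.
rewrite !inE; case: eqP => [->|] //=; apply/esym.
by apply/implyP => _; apply: le_trans at_; rewrite lez_nat gN.
Qed.

(* Outside the box of degrees with [0 <= a j < N] the complexes are exact, so every
   class has a representative supported in the finitely many degrees of the box. *)
Lemma finite_length_cech i :
  (forall a, (exists j, a j < 0) -> exact_at K (active gens a) i) ->
  finite_length (local_cohomology x (quotmod J) i).
Proof.
move=> ex_neg.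
pose N := (\sum_(g <- gens) mdeg g)%N.
have gN g : g \in gens -> forall j, (g j <= N)%N.
  move=> gG j; rewrite /N (big_rem g) //= mdegE (bigD1 j) //=.
  by rewrite -addnA leq_addr.
pose box a := [forall j, (0 <= a j) && (a j < N%:Z)].
have ex_box a : ~~ box a -> exact_at K (active gens a) i.
  move=> nb; have [|/forallPn[j]] := boolP [forall j, 0 <= a j]; last first.
    by rewrite -ltNge => aj; apply: ex_neg; exists j.
  move=> /forallP a0; case/forallPn: nb => j; rewrite a0 /= -leNgt => aj.
  by apply: (@cone_exact_at _ _ _ j) => S; apply: (active_large S gN).
pose dg (f : {ffun 'I_n -> 'I_N}) : deg := [ffun j => (f j : nat)%:Z].
pose I : finType := ({set 'I_n} * {ffun 'I_n -> 'I_N})%type.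
(* A relation and not a function: the coordinates depend on the representative supported in the
   box. *)
pose rep (v : local_cohomology x (quotmod J) i) (y : 'rV[K]_#|{: I}|) :=
  exists c : submod (cocycle x (quotmod J) i),
  [/\ v = quotmod_pi (coboundary x (quotmod J) i) c,
      forall S a, ~~ box a -> lcoef (\val c S) a = 0
    & forall j, y 0 j = lcoef (\val c (enum_val j).1) (dg (enum_val j).2)].
apply: (@finite_length_coords _ _ _ _ rep).
- elim/quotmod_ind => c; have /asboolP cc := valP c.
  set c0 : cochains := \val c in cc.
  have [s sP] := cochain_lcoef_fin c0.
  have /choice[b bP] : forall a, exists b : {set 'I_n} -> K,
      [/\ forall S, active gens a S && (#|S|.+1 == i) = false -> b S = 0
        & ~~ box a ->
          forall T, active gens a T -> cobord b T = lcoef (c0 T) a].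
    move=> a; have [ba|nb] := boolP (box a); first by exists (fun=> 0).
    have [||b [b0 db]] := ex_box a nb (fun S => lcoef (c0 S) a).
    - by have [] := lcoef_cocycle a (valP c).
    - by have [] := lcoef_cocycle a (valP c).
    by exists b; split.
  (* [b a] is zero for [a] in the box and a primitive of the degree [a] part of [c] outside it; only
     the degrees in [s] occur in [c]. *)
  pose e := mkcochain J s b.
  have e0 S : #|S|.+1 != i -> e S = 0.
    apply: (@mkcochain_deg i) => a S' iS'; have [b0 _] := bP a.
    by apply: b0; rewrite (negPf iS') andbF.
  have de : cech_diff e \in cocycle x (quotmod J) i.
    by apply/asboolP; split; [apply: cech_diff_deg | apply: cech_diff2_eq0].
  pose d : submod (cocycle x (quotmod J) i) := Sub (cech_diff e) de.
  have Ecd S : \val (c - d) S = c0 S - cech_diff e S.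
    by rewrite raddfB /= cochainDE.
  exists (\row_j lcoef (\val (c - d) (enum_val j).1) (dg (enum_val j).2)).
  exists (c - d); split => [|S a nb|j]; last by rewrite mxE.
    apply/quotmod_piP; rewrite opprB addrC subrK.
    by apply/asboolP; exists e.
  rewrite Ecd (lcoefB J_mem) (lcoef_diff J_mem).
  have [b0 db] := bP a.
  have -> : cobord (fun S' => lcoef (e S') a) S =
            cobord (fun S' => if a \in s then b a S' else 0) S.
    apply: eq_cobord => j _; rewrite (lcoef_mkcochain J_mem) // => a' S' na'.
    by have [b0' _] := bP a'; apply: b0'; rewrite (negPf na').
  case: ifP => Sa; last by rewrite lcoef_inactive ?Sa // subr0.
  case: (boolP (a \in s)) => sa; first by rewrite db // subrr.
  have -> : cobord (fun=> 0) S = 0 :> K by apply: cobord0.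
  rewrite subr0; apply/eqP; apply: contraNT sa; exact: sP.
- move=> u v y z r [c [-> c0 yc]] [d [-> d0 zd]].
  have E S : \val (r%:MP *: c + d) S = r%:MP *: \val c S + \val d S.
    by rewrite linearP.
  exists (r%:MP *: c + d); split => [|S a nb|j].
  + by rewrite quotmod_piD -quotmod_scaleE.
  + by rewrite E (lcoefD J_mem) (lcoefC J_mem) c0 // d0 // mulr0 addr0.
  + by rewrite E (lcoefD J_mem) (lcoefC J_mem) !mxE yc zd.
- move=> v [c [-> c0 yc]].
  have -> : c = 0.
    apply: val_inj; apply: cochain_lcoef_inj => S a.
    rewrite raddf0 [RHS](lcoef0 J_mem).
    have [ba|] := boolP (box a); last exact: c0.
    have aN j : (`|a j| < N)%N by have /forallP/(_ j)/andP[] := ba; lia.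
    have Ea : a = dg [ffun j => Ordinal (aN j)].
      apply/ffunP => j; rewrite !ffunE /= gez0_abs //.
      by have /forallP/(_ j)/andP[] := ba.
    by have := yc (enum_rank (S, [ffun j => Ordinal (aN j)]));
      rewrite enum_rankK mxE -Ea.
  exact: quotmod_pi0.
Qed.

Lemma lmonoX S a m : nonneg_off S a ->
  'X_[m] *: lmono J S a = lmono J S (a + zdeg m).
Proof.
move=> Sa; have Sam : nonneg_off S (a + zdeg m).
  apply/forallP => i; apply/implyP => iS; rewrite !ffunE addr_ge0 //.
  by have /forallP/(_ i)/implyP := Sa; apply.
apply: (lcoef_inj J_mem) => b; rewrite lcoef_mono //.
rewrite /lmono lfracZ lcoefE //; case: ifP => // _.
set k := (\sum_i _)%N; rewrite -mpolyXD zcoefX zdegD ndegK; last first.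
  move=> i; rewrite ffunE zdeg_msetE; case: (boolP (i \in S)) => iS.
    rewrite mul1n /k (bigD1 i) //= PoszD; lia.
  by rewrite mul0n addr0; have /forallP/(_ i)/implyP := Sa; apply.
by rewrite addrA (inj_eq (addIr _)) addrC.
Qed.

(* A nonzero class in degree [a] has copies [z k] in the degrees [a - k e_j], with
   [x_j z (k+1) = z k]; by degree reasons they generate a strictly increasing chain
   of submodules. *)
Lemma exact_at_of_finite_length i a (j : 'I_n) :
  finite_length (local_cohomology x (quotmod J) i) -> a j < 0 ->
  exact_at K (active gens a) i.
Proof.
move=> [l lP] aj g g0 dg; apply: contrapT => nb.
pose ak k : deg := a - zdeg (U_(j) *+ k).
have akj k : ak k j < 0 by rewrite !ffunE mulmnE mnm1E eqxx mul1n subr_lt0; apply: lt_le_trans aj _.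
have akE k t : t != j -> ak k t = a t.
  by move=> tj; rewrite !ffunE mulmnE mnm1E eq_sym (negPf tj) mul0n subr0.
(* The entry at [j] stays negative, so [j] belongs to every active set, and off such a set nothing
   has changed. *)
have act k : active gens (ak k) =1 active gens a.
  move=> S; rewrite /active; have [jS|jS] := boolP (j \in S); last first.
    have E (b : deg) : b j < 0 -> nonneg_off S b = false.
      move=> bj; apply/negbTE/forallPn; exists j.
      by rewrite negb_imply jS -ltNge.
    by rewrite !E.
  have EE i' : i' \notin S -> ak k i' = a i'.
    by move=> i'S; apply: akE; apply: contraNneq i'S => ->.
  congr (_ && ~~ _).
    by apply: eq_forallb => t; case: (boolP (t \in S)) => //= tS; rewrite EE.
  apply: eq_has => h; apply: eq_forallb => t.
  by case: (boolP (t \in S)) => //= tS; rewrite EE.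
have g_act S : ~~ active gens a S -> g S = 0.
  by move=> /negPf Sa; apply: g0; rewrite Sa.
pose z k : cochains := fun S => (g S)%:MP *: lmono J S (ak k).
have zE k S b : lcoef (z k S) b = if ak k == b then g S else 0.
  rewrite (lcoefC J_mem); have [Sa|/g_act->] := boolP (active gens a S); last first.
    by rewrite mul0r if_same.
  rewrite lcoef_mono //; last by move: Sa; rewrite -(act k) => /andP[].
  case: eqP => [<-|_]; last by rewrite if_same mulr0.
  by rewrite act Sa mulr1.
have zc k : z k \in cocycle x (quotmod J) i.
  apply/asboolP; split=> [S iS|]; first by rewrite /z g0 ?mpolyC0 ?scale0r // (negPf iS) andbF.
  apply: cochain_lcoef_inj => T b; rewrite (lcoef_diff J_mem) [RHS](lcoef0 J_mem).
  case: ifP => // Tb; rewrite (@eq_cobord _ _ _ (fun S => if ak k == b then g S else 0)) //.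
  case: (eqVneq (ak k) b) Tb => [<-|_ _]; last by rewrite cobord0.
  by rewrite act => /dg.
pose h k := quotmod_pi (coboundary x (quotmod J) i) (Sub (z k) (zc k)).
have hS k : h k = ('X_j : R) *: h k.+1.
  rewrite /h [RHS]quotmod_scaleE; congr quotmod_pi; apply: val_inj.
  rewrite linearZ /=; apply: functional_extensionality_dep => S.
  rewrite cochainZE /z scalerA mulrC -scalerA.
  have [Sa|/g_act->] := boolP (active gens a S); last by rewrite mpolyC0 !scale0r.
  rewrite lmonoX; last by move: Sa; rewrite -(act k.+1) => /andP[].
  congr (_ *: lmono _ _ _); apply/ffunP => t.
  by rewrite !ffunE !mulmnE mnm1E mulnS PoszD opprD addrA [RHS]addrAC subrK.
pose L k : {pred local_cohomology x (quotmod J) i} :=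
  fun v => `[< exists r, v = r *: h k >].
suff /(_ l.+1) : forall k, (k <= l)%N by rewrite ltnn.
move=> k; apply: (lP k L) => k' _.
  split=> [|r u v /asboolP[s ->] /asboolP[t ->]].
    by apply/asboolP; exists 0; rewrite scale0r.
  by apply/asboolP; exists (r * s + t); rewrite scalerDl scalerA.
split=> [v /asboolP[r ->]|sub].
  by apply/asboolP; exists (r * 'X_j); rewrite hS scalerA.
have /asboolP[r] : h k'.+1 \in L k'.
  by apply: sub; apply/asboolP; exists 1; rewrite scale1r.
(* Read in degree [ak k'.+1], the relation makes [g] a coboundary, since a multiple of [z k'] has no
   component there. *)
rewrite {1}/h [RHS]quotmod_scaleE => /quotmod_piP/asboolP[b [b0]].
rewrite raddfB linearZ /= => db; apply: nb.
exists (fun S => lcoef (b S) (ak k'.+1)); split=> [S|T Ta].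
  have [Sa /= /negbT/b0-> |Sa _] := boolP (active gens a S).
    exact: (lcoef0 J_mem).
  by apply: lcoef_inactive; rewrite act.
have := lcoef_diff J_mem b T (ak k'.+1); rewrite act Ta => <-.
have -> : cech_diff b T = z k'.+1 T - r *: z k' T.
  by rewrite db scalerN.
rewrite (lcoefB J_mem) zE eqxx scalerA.
rewrite (@lcoef_scale_mono _ _ _ _ _ _ _ _ _ j) ?subr0 //.
  by move: Ta; rewrite -(act k') => /andP[].
rewrite !ffunE !mulmnE mnm1E eqxx !mul1n.
by rewrite ltrD2l ltrN2 ltz_nat.
Qed.

End Takayama.

(** * Complexes of stable sets *)

Section Graph.
Variables (K : fieldType) (n : nat) (e : rel 'I_n).
Hypotheses (e_sym : ssrbool.symmetric e) (e_irr : irreflexive e).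
Implicit Types (A B F S T U X Y : {set 'I_n}) (u v w : 'I_n).
Local Notation exact_at := (@exact_at K n).
Local Notation del := (del_nbhd e).

Definition stable S := [forall u in S, forall w in S, ~~ e u w].

Lemma stableP S : reflect {in S &, forall u w, ~~ e u w} (stable S).
Proof.
apply: (iffP forall_inP) => [sS u w uS wS|sS u uS].
  by have /forall_inP := sS u uS; apply.
by apply/forall_inP => w wS; apply: sS.
Qed.

Lemma stable_sub S T : S \subset T -> stable T -> stable S.
Proof.
move=> /subsetP ST /stableP sT; apply/stableP => u w /ST uT /ST wT.
exact: sT.
Qed.

Lemma stable0 : stable set0.
Proof. by apply/stableP => u w; rewrite inE. Qed.

Lemma stable1 v : stable [set v].
Proof. by apply/stableP => u w /set1P-> /set1P->; rewrite e_irr. Qed.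

Lemma stableU1 v S : stable (v |: S) = stable S && [forall w in S, ~~ e v w].
Proof.
apply/idP/andP => [sv|[/stableP sS /forall_inP vS]].
  split; first by apply: stable_sub sv; apply: subsetUr.
  apply/forall_inP => w wS; have /stableP := sv; apply; first exact: setU11.
  by rewrite inE wS orbT.
apply/stableP => u w /setU1P[->|uS] /setU1P[->|wS].
- by rewrite e_irr.
- exact: vS.
- by rewrite e_sym vS.
- exact: sS.
Qed.

(** For [F] stable and [A] outside its closed neighbourhood, this is the independence complex of the
    graph on [A], with cardinalities raised by [#|F|]. *)
Definition indfam F A : pred {set 'I_n} :=
  fun S => [&& F \subset S, S \subset F :|: A & stable S].

Lemma convex_indfam F A : convex (indfam F A).
Proof.
move=> S T U ST TU /and3P[FS _ _] /and3P[_ UFA sU]; apply/and3P; split.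
- exact: subset_trans ST.
- exact: subset_trans UFA.
- exact: stable_sub sU.
Qed.

Definition apart F A := forall f a, f \in F -> a \in A -> a \in del f.

Lemma apart_notin F A v : apart F A -> v \in A -> v \notin F.
Proof.
move=> FA vA; apply/negP => vF; have := FA _ _ vF vA.
by rewrite inE eqxx.
Qed.

Lemma apart_sub F A B : B \subset A -> apart F A -> apart F B.
Proof. by move=> /subsetP BA FA f b fF /BA; apply: FA. Qed.

Lemma apart_link F A v : apart F A -> apart (v |: F) (A :&: del v).
Proof.
move=> FA f a /setU1P[->|fF] /setIP[aA av] //; exact: FA.
Qed.

Lemma indfam_del F A v : v \notin F ->
  [pred S | indfam F A S && (v \notin S)] =1 indfam F (A :\ v).
Proof.
move=> vF S; rewrite /= /indfam; apply/andP/and3P => [[/and3P[FS SFA sS] vS]|[FS SFA sS]].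
  split=> //; apply/subsetP => u uS; have := subsetP SFA u uS.
  by rewrite !inE; case: eqP => // E; rewrite E (negPf vS) in uS.
split; first apply/and3P; first split=> //.
  by apply: subset_trans SFA _; apply: setUS; apply: subsetDl.
by apply/negP => /(subsetP SFA); rewrite !inE eqxx (negPf vF).
Qed.

Lemma indfam_link F A v : v \in A ->
  [pred S | indfam F A S && ~~ (v \notin S)] =1 indfam (v |: F) (A :&: del v).
Proof.
move=> vA S; rewrite /= negbK /indfam.
apply/andP/and3P => [[/and3P[FS SFA sS] vS]|[FS SFA sS]].
  split=> //; first by rewrite subUset sub1set vS.
  apply/subsetP => u uS; have := subsetP SFA u uS.
  rewrite !inE; case: (u \in F); rewrite ?orbT //=; case: eqP => //= _ ->.
  by have /stableP := sS; apply.
have vS : v \in S by apply: (subsetP FS); apply: setU11.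
split=> //; apply/and3P; split=> //.
  by apply: subset_trans FS; apply: subsetUr.
apply: subset_trans SFA _; apply/subsetP => u; rewrite !inE.
by case: eqP => [->|_] /=; rewrite ?vA ?orbT //; case: (u \in F); case: (u \in A).
Qed.

Lemma indfam_downset F A v S T : S \subset T -> indfam F A S -> indfam F A T ->
  v \notin T -> v \notin S.
Proof. by move=> /subsetP ST _ _; apply: contra; apply: ST. Qed.

(** The faces without [v] form the deletion and are closed under subsets; those with [v] form the
    link, in unshifted degrees because [v] has joined [F]. *)
Lemma indfam_ext F A v i : v \in A -> v \notin F ->
  exact_at (indfam F (A :\ v)) i ->
  exact_at (indfam (v |: F) (A :&: del v)) i -> exact_at (indfam F A) i.
Proof.
move=> vA vF ex1 ex2.
apply: (exact_at_ext (@convex_indfam F A) (@indfam_downset F A v)).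
  by apply: eq_exact_at ex1 => S; rewrite -indfam_del.
by apply: eq_exact_at ex2 => S; rewrite -indfam_link.
Qed.

Lemma indfam_down F A v i : v \in A -> v \notin F ->
  exact_at (indfam F A) i ->
  exact_at (indfam (v |: F) (A :&: del v)) i.+1 -> exact_at (indfam F (A :\ v)) i.
Proof.
move=> vA vF ex ex2; apply: (eq_exact_at (@indfam_del F A v vF)).
apply: (exact_at_down (@convex_indfam F A) (@indfam_downset F A v) ex).
by apply: eq_exact_at ex2 => S; rewrite -indfam_link.
Qed.

Lemma cone_indfam F A v i : apart F A -> v \in A ->
  (forall u, u \in A -> ~~ e v u) -> exact_at (indfam F A) i.
Proof.
move=> FA vA viso; apply: (@cone_exact_at _ _ _ v) => S.
have vF := apart_notin FA vA.
rewrite /indfam subUset sub1set !inE vA orbT /=.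
have -> : (F \subset v |: S) = (F \subset S).
  apply/idP/idP => [/subsetP FS|FS]; last by apply: subset_trans FS (subsetUr _ _).
  apply/subsetP => f fF; have /setU1P[E|//] := FS f fF.
  by rewrite E in fF; rewrite fF in vF.
apply: andb_id2l => _; apply: andb_id2l => SFA; rewrite stableU1.
rewrite andbC; have [|] := boolP (stable S); rewrite ?andbF ?andbT // => _.
apply/forall_inP => w wS; have /setUP[wF|/viso//] := subsetP SFA w wS.
by have := FA w v wF vA; rewrite inE e_sym => /andP[].
Qed.

(** Well-covered with independence number [k], in a form that passes to links by adjoining a vertex
    and removing it again. *)
Definition covered A k := forall S, S \subset A -> stable S ->
  exists U, [/\ S \subset U, U \subset A, stable U & #|U| = k].

Lemma covered_le A k S : covered A k -> S \subset A -> stable S -> (#|S| <= k)%N.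
Proof. by move=> cA SA sS; have [U [SU _ _ <-]] := cA S SA sS; apply: subset_leq_card. Qed.

(* The W2 condition, formulated so that it ignores isolated vertices and is
   inherited by [A :&: del v]. *)
Definition avoiding A k := forall S w, S \subset A -> stable S -> w \in A ->
  w \notin S -> (exists2 u, u \in A & e w u) ->
  exists U, [/\ S \subset U, U \subset A, stable U, w \notin U & #|U| = k].

Definition no_isolated A := forall w, w \in A -> exists2 u, u \in A & e w u.

Lemma stable_link A v S : S \subset A :&: del v -> stable S -> stable (v |: S).
Proof.
move=> SA sS; rewrite stableU1 sS; apply/forall_inP => w /(subsetP SA).
by rewrite !inE => /and3P[].
Qed.

Lemma link_sub A v U : v |: set0 \subset U -> U \subset A -> stable U ->
  U :\ v \subset A :&: del v.
Proof.
rewrite setU0 sub1set => vU UA sU; apply/subsetP => u /setD1P[uv uU].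
by rewrite !inE uv (subsetP UA) //=; have /stableP := sU; apply.
Qed.

Lemma covered_link A k v : covered A k.+1 -> v \in A -> covered (A :&: del v) k.
Proof.
move=> cA vA S SA sS.
have [||U [SU UA sU cU]] := cA (v |: S); last 1 first.
- have vU : v \in U by apply: (subsetP SU); apply: setU11.
  exists (U :\ v); split; last by apply/eqP; rewrite -eqSS -cU [in X in _ == X](cardsD1 v) vU.
  + rewrite subsetD1; apply/andP; split.
      by apply: subset_trans SU; apply: subsetUr.
    by apply/negP => /(subsetP SA); rewrite !inE eqxx andbF.
  + by apply: link_sub => //; rewrite setU0 sub1set.
  + by apply: stable_sub sU; apply: subsetDl.
- by rewrite subUset sub1set vA (subset_trans SA) ?subsetIl.
- exact: stable_link SA sS.
Qed.

Lemma avoiding_link A k v : avoiding A k.+1 -> v \in A ->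
  avoiding (A :&: del v) k.
Proof.
move=> aA vA S w SA sS /setIP[wA wv] wS [u /setIP[uA _] wu].
have wnv : w != v by move: wv; rewrite inE => /andP[].
have [||||U [SU UA sU wU cU]] := aA (v |: S) w _ _ wA; last 1 first.
- have vU : v \in U by apply: (subsetP SU); apply: setU11.
  exists (U :\ v); split; last by apply/eqP; rewrite -eqSS -cU [in X in _ == X](cardsD1 v) vU.
  + rewrite subsetD1; apply/andP; split.
      by apply: subset_trans SU; apply: subsetUr.
    by apply/negP => /(subsetP SA); rewrite !inE eqxx andbF.
  + by apply: link_sub => //; rewrite setU0 sub1set.
  + by apply: stable_sub sU; apply: subsetDl.
  + by rewrite inE negb_and wU orbT.
- by rewrite subUset sub1set vA (subset_trans SA) ?subsetIl.
- exact: stable_link SA sS.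
- by rewrite !inE negb_or wnv.
- by exists u.
Qed.

(** If [w] were isolated in the link of [v], a stable set of size [k] through [v] that avoids [w]
    could be enlarged by [w]. *)
Lemma no_isolated_link A k v : covered A k -> avoiding A k -> no_isolated A ->
  v \in A -> no_isolated (A :&: del v).
Proof.
move=> cA aA iA vA w /setIP[wA wv]; apply: contrapT => nw.
have wnv : w != v by move: wv; rewrite inE => /andP[].
have [||U [SU UA sU wU cU]] := aA [set v] w _ (stable1 v) wA _ (iA w wA).
- by rewrite sub1set.
- by rewrite inE.
have : stable (w |: U).
  rewrite stableU1 sU; apply/forall_inP => u uU; apply/negP => wu; apply: nw.
  have uA := subsetP UA u uU; exists u => //; rewrite !inE uA /=.
  have vU : v \in U by rewrite -sub1set.
  have /stableP sU' := sU; rewrite (sU' v u) // andbT.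
  apply: contraTneq wu => ->.
  by move: wv; rewrite inE e_sym => /andP[].
move/(covered_le cA); rewrite subUset sub1set wA UA => /(_ isT).
by rewrite cardsU1 wU cU add1n ltnn.
Qed.

(* Triangle-free and in W2, with independence number [k]. *)
Definition good A k :=
  [/\ triangle_free e A, covered A k, avoiding A k & no_isolated A].

Lemma triangle_free_sub A B : B \subset A -> triangle_free e A -> triangle_free e B.
Proof. by move=> /subsetP BA tA u v w /BA uA /BA vA /BA; apply: tA. Qed.

Lemma good_link A k v : good A k.+1 -> v \in A -> good (A :&: del v) k.
Proof.
case=> tA cA aA iA vA; split.
- exact: triangle_free_sub (subsetIl _ _) tA.
- exact: covered_link.
- exact: avoiding_link.
- exact: no_isolated_link cA aA iA vA.
Qed.

Lemma covered_gt0 A k v : covered A k -> v \in A -> (0 < k)%N.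
Proof.
move=> cA vA; have := covered_le cA (S := [set v]); rewrite cards1.
by apply; rewrite ?sub1set // stable1.
Qed.

Lemma stable_nbhd A v : triangle_free e A -> v \in A ->
  stable [set u in A | e v u].
Proof.
move=> tA vA; apply/stableP => u w; rewrite !inE => /andP[uA vu] /andP[wA vw].
by have := tA v u w vA uA wA; rewrite vu vw /= andbT.
Qed.

(* Deleting the vertices of [X] one at a time, each link is a smaller instance
   of the statement as long as some vertex of [X] remains, so only whether [X]
   contains a given vertex [x] matters; and for [X] the neighbourhood of a
   vertex [a], the complex is a cone with apex [a]. *)
Lemma exact_indfam_del A F X k : good A k -> apart F A -> X \subset A ->
  X != set0 -> stable X -> forall i, exact_at (indfam F (A :\: X)) i.
Proof.
have [m] := ubnP #|A|; elim: m A F X k => // m IHm A F X k.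
rewrite ltnS => Am gA FA.
have k_gt0 v : v \in A -> (0 < k)%N by apply: covered_gt0; case: gA.
have link v Y : v \in A -> Y \subset A -> stable (v |: Y) -> v \notin Y -> Y != set0 ->
    forall i, exact_at (indfam (v |: F) ((A :\: Y) :&: del v)) i.
  move=> vA YA svY vY Y0 i.
  have -> : (A :\: Y) :&: del v = (A :&: del v) :\: Y by rewrite setIDAC.
  apply: (IHm _ _ _ k.-1).
  - apply: leq_trans Am; apply: proper_card; apply/properP; split.
      exact: subsetIl.
    by exists v => //; rewrite !inE eqxx andbF.
  - by apply: good_link => //; rewrite prednK ?(k_gt0 v).
  - exact: apart_link.
  - apply/subsetP => y yY; rewrite !inE (subsetP YA) //=.
    apply/andP; split; first by apply: contraNneq vY => <-.
    by move: svY; rewrite stableU1 => /andP[_ /forall_inP]; apply.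
  - by [].
  - by apply: stable_sub svY; apply: subsetUr.
have step v Y : v \in Y -> Y \subset A -> stable Y -> Y :\ v != set0 ->
    (forall i, exact_at (indfam F (A :\: Y)) i) <->
    (forall i, exact_at (indfam F (A :\: (Y :\ v))) i).
  move=> vY YA sY Y0; have vA := subsetP YA v vY.
  have E : A :\: Y = (A :\: (Y :\ v)) :\ v.
    by rewrite setDDl setUC setD1K.
  have lk := link v (Y :\ v) vA; rewrite setD1K // in lk.
  have vF := apart_notin FA vA.
  have vAY : v \in A :\: (Y :\ v) by rewrite !inE eqxx vA.
  have Y1A : Y :\ v \subset A by apply: subset_trans YA; apply: subsetDl.
  split=> ex i.
    apply: (indfam_ext vAY vF); first by rewrite -E; apply: ex.
    by apply: lk => //; rewrite !inE eqxx.
  rewrite E; apply: (indfam_down vAY vF); first exact: ex.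
  by apply: lk => //; rewrite !inE eqxx.
have toone x Y : x \in Y -> Y \subset A -> stable Y ->
    (forall i, exact_at (indfam F (A :\: Y)) i) <->
    (forall i, exact_at (indfam F (A :\: [set x])) i).
  have [c] := ubnP #|Y|; elim: c Y => // c IHc Y; rewrite ltnS => Yc xY YA sY.
  have [Y1|[v]] := set_0Vmem (Y :\ x).
    have -> // : Y = [set x].
    by apply/setP => u; rewrite -(setD1K xY) Y1 setU0.
  case/setD1P=> vx vY.
  have xYv : x \in Y :\ v by rewrite !inE eq_sym vx.
  rewrite (step v Y) //; last by apply/set0Pn; exists x.
  apply: IHc => //; last by apply: stable_sub sY; apply: subsetDl.
    by apply: leq_trans Yc; rewrite [X in (_ < X)%N](cardsD1 v) vY.
  by apply: subset_trans YA; apply: subsetDl.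
case: (gA) => tA cA aA iA XA /set0Pn[x xX] sX.
have xA := subsetP XA x xX; apply/(toone x) => //.
have [a aA' xa] := iA x xA.
apply/(toone x [set u in A | e a u]); rewrite ?inE ?xA 1?e_sym ?xa //.
- by apply/subsetP => u; rewrite inE => /andP[].
- exact: stable_nbhd.
move=> i; apply: (@cone_indfam _ _ a).
- by apply: apart_sub FA; apply: subsetDl.
- by rewrite !inE e_irr aA' andbF.
- by move=> u; rewrite !inE => /andP[/nandP[/negPf->//|//] _].
Qed.

(** Deleting one vertex leaves an acyclic complex, so everything is decided on the link, where one
    unit moves from [k] to [#|F|]. For [k = 0] every face has at least [#|F|] elements. *)
Lemma exact_indfam A F k i : good A k -> apart F A -> (i < #|F| + k)%N ->
  exact_at (indfam F A) i.
Proof.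
elim: k A F i => [|k IHk] A F i gA FA ik; last first.
  have [E|[v vA]] := set_0Vmem A.
    case: gA => _ cA _ _; have [U [_]] := cA set0 (sub0set _) stable0.
    by rewrite E subset0 => /eqP-> _; rewrite cards0.
  have vF := apart_notin FA vA.
  apply: (indfam_ext vA vF).
    apply: (exact_indfam_del gA FA); rewrite ?sub1set ?stable1 //.
    by apply/set0Pn; exists v; rewrite inE.
  apply: IHk; first exact: good_link; first exact: apart_link.
  by rewrite cardsU1 vF add1n addSnnS.
apply: exact_at_void => S /and3P[/subset_leq_card FS _ _].
by rewrite addn0 in ik; rewrite gtn_eqF // (leq_trans ik).
Qed.

End Graph.

(** * Degree complexes of the square of an edge ideal *)

Section Square.
Variables (K : fieldType) (n : nat) (e : rel 'I_n).
Hypotheses (e_sym : ssrbool.symmetric e) (e_irr : irreflexive e).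
Implicit Types (A B F S T U X Y : {set 'I_n}) (u v w : 'I_n).
Local Notation exact_at := (@exact_at K n).
Local Notation del := (del_nbhd e).
Local Notation stable := (stable e).

Lemma unstableP S : ~~ stable S -> exists u w, [/\ u \in S, w \in S & e u w].
Proof.
case/forall_inPn => u uS /forall_inPn[w wS /negPn uw]; by exists u, w.
Qed.

Lemma stableU S T : stable (S :|: T) =
  [&& stable S, stable T & [forall u in S, forall w in T, ~~ e u w]].
Proof.
apply/idP/and3P => [sST|[/stableP sS /stableP sT /forall_inP cST]].
  split; first exact: stable_sub (subsetUl _ _) sST.
    exact: stable_sub (subsetUr _ _) sST.
  apply/forall_inP => u uS; apply/forall_inP => w wT.
  by have /stableP := sST; apply; rewrite inE ?uS ?wT ?orbT.
have c u w : u \in S -> w \in T -> ~~ e u w.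
  by move=> uS wT; have /forall_inP := cST u uS; apply.
apply/stableP => u w /setUP[uS|uT] /setUP[wS|wT].
- exact: sS.
- exact: c.
- by rewrite e_sym c.
- exact: sT.
Qed.

Definition common_link F : {set 'I_n} := [set u | [forall f in F, u \in del f]].

Lemma apart_common_link F : apart e F (common_link F).
Proof. by move=> f u fF; rewrite inE => /forall_inP; apply. Qed.

Lemma stable_common_link F S u : F \subset S -> stable S -> u \in S ->
  u \in F :|: common_link F.
Proof.
move=> /subsetP FS /stableP sS uS; rewrite inE; case: (boolP (u \in F)) => //= uF.
rewrite inE; apply/forall_inP => f fF; rewrite inE; apply/andP; split.
  by apply: contraNneq uF => ->.
by apply: sS => //; apply: FS.
Qed.

Variable a : 'I_n -> int.

(* [x ^ a] is a multiple of a product of two edges, up to inverting the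
   variables in [S]. *)
Definition two_edges S := [exists p : ('I_n * 'I_n) * ('I_n * 'I_n),
  [&& e p.1.1 p.1.2, e p.2.1 p.2.2 & [forall t, (t \notin S) ==>
    (((p.1.1 == t) + (p.1.2 == t) + ((p.2.1 == t) + (p.2.2 == t)))%N%:Z <= a t)]]].

Let F := [set t | a t < 0].
Let T := [set t | 0 < a t].
Let A := common_link F.

Definition sq_face S := (F \subset S) && ~~ two_edges S.

(* [x ^ a] avoids the second symbolic power: it has order at most one along some
   minimal prime of the edge ideal that survives the localization at [S]. *)
Definition near_stable S :=
  (F \subset S) && [exists c, (a c <= 1) && stable (S :|: (T :\ c))].

(** Off [S], a vertex of one edge needs exponent one, which membership in [T] gives, and a vertex of
    both edges needs two; [F \subset S] makes the remaining exponents nonnegative. *)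
Lemma two_edgesI S i j k l : F \subset S -> e i j -> e k l ->
  [/\ i \in S :|: T, j \in S :|: T, k \in S :|: T & l \in S :|: T] ->
  (forall t, t \notin S -> t \in [set i; j] -> t \in [set k; l] -> 2 <= a t) ->
  two_edges S.
Proof.
move=> /subsetP FS eij ekl [iST jST kST lST] H.
apply/existsP; exists ((i, j), (k, l)); rewrite /= eij ekl /=.
apply/forallP => t; apply/implyP => tS.
have ij : i != j by apply: contraTneq eij => ->; rewrite e_irr.
have kl : k != l by apply: contraTneq ekl => ->; rewrite e_irr.
have := H t tS; rewrite !inE ![t == _]eq_sym.
have at0 : 0 <= a t by rewrite leNgt; apply: contra tS => ta; apply: FS; rewrite inE.
have at1 u : u \in S :|: T -> u = t -> 0 < a t.
  by move=> uST E; move: uST; rewrite E !inE (negPf tS).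
have /at1 := iST; have /at1 := jST; have /at1 := kST; have /at1 := lST.
move: ij kl.
case: (i =P t) => [->|_]; case: (j =P t) => [->|_]; rewrite ?eqxx //;
case: (k =P t) => [->|_]; case: (l =P t) => [->|_]; rewrite ?eqxx //= => _ _;
rewrite ?add0n ?addn0 ?addn1;
  do ?[by move=> _ _ _ _ /(_ isT isT)];
  do ?[by move=> _ _ _ _ _];
  do ?[by move=> /(_ erefl)|by move=> _ /(_ erefl)|by move=> _ _ /(_ erefl)
      |by move=> _ _ _ /(_ erefl)].
Qed.

(** As [S :|: (T :\ c)] is stable, both edges of a product dividing [x^a] off [S] must contain [c],
    with [c] outside [S]; that requires exponent two at [c]. *)
Lemma near_stable_sq_face S : near_stable S -> sq_face S.
Proof.
case/andP=> FS /existsP[c /andP[ac /stableP sc]]; rewrite /sq_face FS /=.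
apply/existsP => -[[[i j] [k l]] /= /and3P[eij ekl /forallP H]].
have FS' t : t \notin S -> 0 <= a t.
  by rewrite leNgt; apply: contra => ta; apply: (subsetP FS); rewrite inE.
have cS u w : e u w -> u \notin S :|: (T :\ c) \/ w \notin S :|: (T :\ c).
  by move=> euw; apply/orP; rewrite -negb_and; apply: contraL euw => /andP[]; apply: sc.
have cE u w : e u w -> (forall t, t \notin S -> ((u == t) + (w == t))%N%:Z <= a t) ->
    (c \notin S) /\ (0 < (u == c) + (w == c))%N.
  move=> /cS H1 H2.
  have [z zz zuw] : exists2 z, z \notin S :|: (T :\ c) & (z == u) || (z == w).
    by case: H1 => ?; [exists u|exists w]; rewrite ?eqxx ?orbT.
  move: zz; rewrite !inE negb_or => /andP[zS]; have := H2 z zS.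
  case: (eqVneq z c) => [E _ _|zc /=].
    by rewrite -E ![_ == z]eq_sym; split=> //; case/orP: zuw => ->; rewrite ?addn1.
  rewrite -leNgt => H3 H4; have := le_trans H3 H4.
  by rewrite lez_nat leqn0 addn_eq0; case/orP: zuw => /eqP <-; rewrite eqxx ?andbF.
have [|cNS c1] := cE i j eij.
  by move=> t tS; apply: le_trans (implyP (H t) tS); rewrite lez_nat leq_addr.
have [|_ c2] := cE k l ekl.
  by move=> t tS; apply: le_trans (implyP (H t) tS); rewrite lez_nat leq_addl.
have := le_trans (implyP (H c) cNS) ac; rewrite lez_nat leqNgt.
by rewrite -[2%N]/(1 + 1)%N (leq_add c1 c2).
Qed.

(* If [S] is in [sq_face] but no [c] works, the choices [c] in [F], then [c = i] and
   [c = j] produce edges [i j], [j l] and [i q] any two of which must overlap outside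
   [S]; this forces [l = q] and a triangle in [A]. *)
Lemma sq_face_near_stable S : F != set0 -> triangle_free e A ->
  sq_face S -> near_stable S.
Proof.
move=> /set0Pn[f fF] tA /andP[FS /negP ntwo]; rewrite /near_stable FS /=.
apply: contrapT => /negP/existsPn nc.
have bad c : a c <= 1 -> ~~ stable (S :|: (T :\ c)).
  by move=> ac; have := nc c; rewrite ac.
have subT c u : u \in S :|: (T :\ c) -> u \in S :|: T.
  by rewrite !inE => /orP[->//|/andP[_ ->]]; rewrite orbT.
have noH i j k l : e i j -> e k l ->
    [/\ i \in S :|: T, j \in S :|: T, k \in S :|: T & l \in S :|: T] ->
    ~ (forall t, t \notin S -> t \in [set i; j] -> t \in [set k; l] -> 2 <= a t).
  by move=> eij ekl ijkl H; apply: ntwo; apply: two_edgesI H.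
have sS : stable S.
  apply: contrapT => /negP/unstableP[i [j [iS jS eij]]].
  apply: (noH i j i j) => //; first by rewrite !inE iS jS.
  by move=> t tS; rewrite !inE => /orP[/eqP E|/eqP E]; rewrite E ?iS ?jS in tS.
have [i [j [eij iT iS ai jST]]] : exists i j,
    [/\ e i j, i \in T, i \notin S, a i <= 1 & j \in S :|: T].
  have [i [j [eij iT iS jST]]] : exists i j,
      [/\ e i j, i \in T, i \notin S & j \in S :|: T].
    have /bad/unstableP[i [j [iST jST eij]]] : a f <= 1.
      by move: fF; rewrite inE => /ltW af; apply: le_trans af _.
    have [iS|iS] := boolP (i \in S).
      have jS : j \notin S by apply/negP => jS; have /stableP/(_ i j iS jS) := sS; rewrite eij.
      exists j, i; split=> //; first by rewrite e_sym.
        by move: jST; rewrite !inE (negPf jS) => /andP[].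
      exact: subT iST.
    exists i, j; split=> //; last exact: subT jST.
    by move: iST; rewrite !inE (negPf iS) => /andP[].
  have iST : i \in S :|: T by rewrite inE iT orbT.
  have [ai|ai] := leP (a i) 1; first by exists i, j.
  have [jS|jS] := boolP (j \in S).
    case: (noH i j i j) => // t tS _; rewrite !inE => /orP[/eqP->|/eqP E] //.
    by rewrite E jS in tS.
  have jT : j \in T by move: jST; rewrite inE (negPf jS).
  have [aj|aj] := leP (a j) 1; first by exists j, i; rewrite e_sym.
  by case: (noH i j i j) => // t tS _; rewrite !inE => /orP[/eqP->|/eqP->].
have iST : i \in S :|: T by rewrite inE iT orbT.
have notin c u : c \notin S -> u \in S :|: (T :\ c) -> u != c.
  by move=> cS; rewrite !inE => /orP[uS|/andP[]] //; apply: contraNneq cS => <-.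
have [l [ejl jS li lST]] : exists l, [/\ e j l, j \notin S, l != i & l \in S :|: T].
  have /bad/unstableP[k [l [kST lST ekl]]] := ai.
  have ki := notin _ _ iS kST; have li := notin _ _ iS lST.
  have kST' := subT _ _ kST; have lST' := subT _ _ lST.
  have [/andP[jS jkl]|nj] := boolP ((j \notin S) && (j \in [set k; l])).
    move: jkl; rewrite !inE => /orP[/eqP E|/eqP E].
      by exists l; split=> //; rewrite E.
    by exists k; split=> //; rewrite E e_sym.
  case: (noH i j k l) => // t tS; rewrite !inE => /orP[/eqP->|/eqP E].
    by rewrite ![i == _]eq_sym (negPf ki) (negPf li).
  by move: nj; rewrite -E tS /= !inE => /negPf->.
have jT : j \in T by move: jST; rewrite inE (negPf jS).
have ij : i != j by apply: contraTneq eij => ->; rewrite e_irr.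
have jl : j != l by apply: contraTneq ejl => ->; rewrite e_irr.
have aj : a j <= 1.
  rewrite leNgt; apply/negP => aj; case: (noH i j j l) => // t tS.
  rewrite !inE => /orP[/eqP->|/eqP-> //].
  by rewrite (negPf ij) eq_sym (negPf li).
have [q [eiq qj qST]] : exists q, [/\ e i q, q != j & q \in S :|: T].
  have /bad/unstableP[k [q [kST qST ekq]]] := aj.
  have kj := notin _ _ jS kST; have qj := notin _ _ jS qST.
  have kST' := subT _ _ kST; have qST' := subT _ _ qST.
  have [ikq|ni] := boolP (i \in [set k; q]).
    move: ikq; rewrite !inE => /orP[/eqP E|/eqP E]; first by exists q; split=> //; rewrite E.
    by exists k; split=> //; rewrite E e_sym.
  case: (noH i j k q) => // t tS; rewrite !inE => /orP[/eqP->|/eqP->].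
    by move: ni; rewrite !inE => /negPf->.
  by rewrite ![j == _]eq_sym (negPf kj) (negPf qj).
have iq : i != q by apply: contraTneq eiq => ->; rewrite e_irr.
have [lS lq] : l \notin S /\ l = q.
  have [lS|lS] := boolP (l \in S); last first.
    split=> //; apply/eqP; apply: contraT => lq; case: (noH j l i q) => // t tS.
    rewrite !inE => /orP[/eqP->|/eqP->].
      by rewrite [j == i]eq_sym (negPf ij) [j == q]eq_sym (negPf qj).
    by rewrite (negPf li) (negPf lq).
  case: (noH j l i q) => // t tS.
  rewrite !inE => /orP[/eqP->|/eqP E]; last by rewrite E lS in tS.
  by rewrite [j == i]eq_sym (negPf ij) [j == q]eq_sym (negPf qj).
rewrite -{q iq qST qj}lq in eiq.
have inA u v w : u \notin S -> u \in S :|: T -> v \in S :|: T -> w \in S :|: T ->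
    e v w -> u != v -> u != w -> u \in A.
  move=> uS uST vST wST evw uv uw; rewrite inE; apply/forall_inP => g gF.
  have gS : g \in S by apply: (subsetP FS).
  rewrite inE; apply/andP; split; first by apply: contraNneq uS => ->.
  apply/negP => egu; case: (noH g u v w) => //; first by rewrite inE gS.
  move=> t tS; rewrite !inE => /orP[/eqP E|/eqP->]; first by rewrite E gS in tS.
  by rewrite (negPf uv) (negPf uw).
have iA : i \in A by apply: (inA i j l) => //; rewrite eq_sym.
have jA : j \in A by apply: (inA j i l) => //; rewrite eq_sym.
have lA : l \in A by apply: (inA l i j) => //; rewrite eq_sym.
by have := tA i j l iA jA lA; rewrite eij ejl eiq.
Qed.

End Square.

(** * Exactness of the families of the second symbolic power *)

Section SquareExact.
Variables (K : fieldType) (n : nat) (e : rel 'I_n).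
Hypotheses (e_sym : ssrbool.symmetric e) (e_irr : irreflexive e).
Implicit Types (A B F S T U X Y : {set 'I_n}) (u v w : 'I_n).
Local Notation exact_at := (@exact_at K n).
Local Notation del := (del_nbhd e).
Local Notation stable := (stable e).
Local Notation indfam := (indfam e).

Lemma exact_near_stable (a : 'I_n -> int) k i :
  let F := [set t | a t < 0] in let A := common_link e F in
  F != set0 -> triangle_free e A -> covered e A k -> avoiding e A k ->
  (i < #|F| + k)%N -> exact_at (near_stable e a) i.
Proof.
move=> F A F0 tA cA aA ik.
pose T := [set t | 0 < a t].
have FT t : t \in T -> t \notin F.
  by rewrite !inE => at_; rewrite -leNgt ltW.
have cone t : (t \notin F) ->
    (forall S c, F \subset S -> a c <= 1 ->
       stable (S :|: (T :\ c)) = stable (t |: S :|: (T :\ c))) ->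
    exact_at (near_stable e a) i.
  move=> tF E; apply: (@cone_exact_at _ _ _ t) => S; rewrite /near_stable.
  have -> : (F \subset t |: S) = (F \subset S).
    apply/idP/idP => [/subsetP FS|FS]; last by apply: subset_trans FS (subsetUr _ _).
    apply/subsetP => f fF; have /setU1P[Ef|//] := FS f fF.
    by rewrite Ef in fF; rewrite fF in tF.
  apply: andb_id2l => FS; apply: eq_existsb => c.
  by apply: andb_id2l => ac; rewrite -E.
(* If the removed vertex [c] is never [t], then [t] is always present in [T :\ c] and adjoining it
   to [S] changes nothing. This happens when [a t] is at least two, or when [F :|: (T :\ t)] is not
   stable. *)
have coneT t : t \in T -> (forall S c, F \subset S -> a c <= 1 ->
     stable (S :|: (T :\ c)) \/ stable (t |: S :|: (T :\ c)) -> c != t) ->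
    exact_at (near_stable e a) i.
  move=> tT H; apply: (cone t (FT t tT)) => S c FS ac.
  have Eq : c != t -> t |: S :|: (T :\ c) = S :|: (T :\ c).
    move=> ct; apply/setP => u; rewrite !inE; case: eqP => [->|_] //=.
    by rewrite eq_sym ct; move: tT; rewrite inE => ->; rewrite orbT.
  apply/idP/idP => st.
    by rewrite Eq //; apply: (H S) => //; left.
  by rewrite -Eq //; apply: (H S) => //; right.
have FAd : apart e F A by move=> f u; apply: apart_common_link.
(* A vertex of [A] without neighbours in [A] can be added to every face; otherwise [A] is [good]. *)
have [iso|/forall_inPn[w wA /exists_inPn wiso]] :=
    boolP [forall w in A, [exists u in A, e w u]]; last first.
  have wF := apart_notin FAd wA.
  apply: (cone w wF) => S c FS ac; rewrite -setUA stableU1 //.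
  have [sX|//] := boolP (stable _); apply/esym/forall_inP => u uX.
  have FX : F \subset S :|: (T :\ c) by apply: subset_trans FS (subsetUl _ _).
  have /setUP[uF|/wiso//] := stable_common_link FX sX uX.
  by have := FAd u w uF wA; rewrite inE e_sym => /andP[].
have gA : good e A k.
  split=> // w wA; have /exists_inP[u uA wu] := forall_inP iso w wA.
  by exists u.
have [a1|/forall_inPn[t tT]] := boolP [forall t in T, a t <= 1]; last first.
  rewrite -ltNge => at2; apply: (coneT t tT) => S c _ ac _.
  by apply: contraTneq ac => ->; rewrite -ltNge.
have [sF|/forall_inPn[t tT nst]] := boolP [forall t in T, stable (F :|: (T :\ t))]; last first.
  apply: (coneT t tT) => S c FS _ H; apply: contraNneq nst => E.
  case: H; rewrite E; apply: stable_sub; apply: setSU => //.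
  exact: subset_trans FS (subsetUr _ _).
have {}a1 c : a c <= 1.
  have [/(forall_inP a1)//|] := boolP (c \in T).
  by rewrite inE -leNgt => /le_trans; apply.
have {}sF t : t \in T -> stable (F :|: (T :\ t)) by apply: (forall_inP sF).
have cvx : convex (near_stable e a).
  move=> S1 S2 S3 S12 S23 /andP[FS1 _] /andP[_ /existsP[c /andP[ac sc]]].
  rewrite /near_stable (subset_trans FS1) //; apply/existsP; exists c.
  by rewrite ac; apply: stable_sub sc; apply: setSU.
have nsP S : reflect (F \subset S /\ exists c, stable (S :|: (T :\ c))) (near_stable e a S).
  apply: (iffP andP) => -[FS].
    by move=> /existsP[c /andP[_ sc]]; split=> //; exists c.
  by case=> c sc; split=> //; apply/existsP; exists c; rewrite a1.
have subUD c : T :\ c \subset T by apply: subsetDl.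
have indE S : F \subset S -> stable S -> indfam F A S.
  move=> FS sS; apply/and3P; split=> //; apply/subsetP => u.
  exact: stable_common_link.
(* With at most one element in [T], removing it leaves the stable sets containing [F]. With more,
   each element of [T] survives some removal, next to [F] in a stable set, and so lies in [A]. *)
have [T1|T2] := leqP #|T| 1.
  apply: (eq_exact_at _ (exact_indfam e_sym e_irr gA FAd ik)) => S.
  apply/idP/nsP => [/and3P[FS _ sS]|[FS [c sc]]]; last first.
    by apply: indE => //; apply: stable_sub sc; apply: subsetUl.
  split=> //; have [E|[t tT]] := set_0Vmem T.
    have [f fF] := set0Pn _ F0; exists f.
    by apply: stable_sub sS; rewrite E set0D setU0.
  exists t; apply: stable_sub sS; rewrite subUset subxx /=.
  apply/subsetP => u /setD1P[/negP ut uT]; case: ut.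
  by apply/eqP; move/card_le1_eqP: T1; apply.
have /card_gt1P[t [u [tT uT tu]]] := T2.
have inA v w : v \in T -> w \in T -> v != w -> v \in A.
  move=> vT wT vw; have := sF w wT => sFw.
  have vFA : v \in F :|: A.
    apply: stable_common_link (subsetUl _ _) sFw _.
    by rewrite inE !inE vw; move: vT; rewrite inE => ->; rewrite orbT.
  by move: vFA; rewrite inE (negPf (FT v vT)).
have FU v S : v \in T -> (F \subset v |: S) = (F \subset S).
  move=> vT; apply/idP/idP => [/subsetP FS|FS]; last by apply: subset_trans FS (subsetUr _ _).
  apply/subsetP => f fF; have /setU1P[Ef|//] := FS f fF.
  by have := FT v vT; rewrite -Ef fF.
have P_down v : forall S1 S2 : {set 'I_n}, S1 \subset S2 -> near_stable e a S1 ->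
    near_stable e a S2 -> stable (v |: S2) -> stable (v |: S1).
  by move=> S1 S2 S12 _ _; apply: stable_sub; apply: setUS.
have TtE t' S c : t' \in T -> c != t' -> t' |: S \subset S :|: (T :\ c).
  move=> t'T ct; rewrite subUset subsetUl andbT sub1set inE !inE eq_sym ct.
  by move: t'T; rewrite inE => ->; rewrite orbT.
have [sT|nsT] := boolP (stable T).
(* the faces [S] with [t |: S] stable form a cone over [t], the others one over [u] *)
  apply: (exact_at_ext cvx (P_down t)).
    apply: (@cone_exact_at _ _ _ t) => S /=.
    rewrite setUA setUid; apply: andb_id2r => stS.
    apply/nsP/nsP => -[FS [c sc]].
      split; first by rewrite -(FU t).
      by exists c; apply: stable_sub sc; apply: setSU; apply: subsetUr.
    split; first by rewrite FU.
    have [E|ct] := eqVneq c t; last first.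
      exists c; apply: stable_sub sc; rewrite subUset subsetUr andbT.
      exact: TtE.
    exists t; rewrite stableU // stS (stable_sub _ sT) //=.
    apply/forall_inP => v vtS; apply/forall_inP => w wT.
    case/setU1P: vtS => [->|vS].
      by have /stableP := sT; apply => //; apply: (subsetP (subUD t)).
    have /stableP := sc; apply; first by rewrite inE vS.
    by rewrite inE E wT orbT.
  apply: (@cone_exact_at _ _ _ u) => S /=.
  have tuE : t |: (u |: S) = u |: (t |: S) by rewrite setUCA.
  apply/andP/andP => -[/nsP[FS [c sc]] nst].
    split.
      apply/nsP; split; first by rewrite -(FU u).
      by exists c; apply: stable_sub sc; apply: setSU; apply: subsetUr.
    apply: contra nst => stS; rewrite tuE stableU1 // stS.
    apply/forall_inP => w /setU1P[->|wS].
      by have /stableP := sT; apply.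
    have /stableP := sc; apply; rewrite !inE ?eqxx ?wS ?orbT //.
  have E : c = t.
    apply/eqP; apply: contraNT nst => ct; apply: stable_sub sc.
    exact: TtE.
  split; last first.
    by apply: contra nst; apply: stable_sub; rewrite tuE subsetUr.
  apply/nsP; split; first by rewrite FU.
  exists c; apply: stable_sub sc; rewrite subUset subsetUr andbT.
  by apply: TtE; rewrite // E.
(* now [T] is an edge [p q], and the complex is the union of a cone over [p] and a
   cone over [q] *)
have [p [q [pT qT epq]]] := unstableP nsT.
have pq : p != q by apply: contraTneq epq => ->; rewrite e_irr.
have TE r : r \in T -> (r == p) || (r == q).
  move=> rT; apply: contraT; rewrite negb_or => /andP[rp rq].
  have /stableP/(_ p q) := sF r rT; rewrite epq !inE; move: pT qT; rewrite !inE => -> ->.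
  by rewrite eq_sym rp eq_sym rq !orbT => /(_ isT isT).
have nsE S : near_stable e a S = (F \subset S) && (stable (p |: S) || stable (q |: S)).
  apply/nsP/andP => -[FS].
    case=> c sc; split=> //; have [E|cp] := eqVneq c p; apply/orP; last first.
      by left; apply: stable_sub sc; apply: TtE.
    by right; apply: stable_sub sc; apply: TtE => //; rewrite E.
  move=> /orP[sp|sq]; split=> //.
    exists q; apply: stable_sub sp; rewrite subUset subsetUr /=.
    by apply/subsetP => r /setD1P[rq /TE]; rewrite (negPf rq) orbF !inE => ->.
  exists p; apply: stable_sub sq; rewrite subUset subsetUr /=.
  by apply/subsetP => r /setD1P[rp /TE]; rewrite (negPf rp) !inE /= => ->.
have pA : p \in A by apply: (inA p q).
have qA : q \in A by apply: (inA q p) => //; rewrite eq_sym.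
pose D v := [pred S : {set 'I_n} | (F \subset S) && stable (v |: S)].
have coneD v j : v \in T -> exact_at (D v) j.
  by move=> vT; apply: (@cone_exact_at _ _ _ v) => S; rewrite /= FU // setUA setUid.
have cvxD v : convex (D v).
  move=> S1 S2 S3 S12 S23 /andP[FS1 _] /andP[_ s3] /=.
  by rewrite (subset_trans FS1) //=; apply: stable_sub s3; apply: setUS.
apply: (exact_at_ext cvx (P_down p)).
  apply: (eq_exact_at _ (coneD p i pT)) => S /=; rewrite nsE.
  by case: (stable (p |: S)); rewrite ?andbF ?andbT.
have E2 : [pred S : {set 'I_n} | D q S && ~~ stable (p |: S)] =1
          [pred S | near_stable e a S && ~~ stable (p |: S)].
  by move=> S /=; rewrite nsE; case: (stable (p |: S)); rewrite ?andbF ?andbT ?orFb.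
(* Degree zero is apart, as [exact_at_up] only reaches successors; there [F] nonempty leaves no
   face. *)
apply: (eq_exact_at E2); case: i ik {cone coneT} => [|i] ik.
  apply: exact_at_void => S /andP[/andP[FS _] _]; rewrite -lt0n.
  by apply: leq_trans (subset_leq_card FS); rewrite card_gt0.
apply: exact_at_up => //.
- by move=> S1 S2 S12 _ _; apply: stable_sub; apply: setUS.
- exact: coneD.
(* The intersection of the two cones consists of the stable sets of the link [B] of [p] with the
   neighbourhood [X] of [q] removed. The degree lost in [exact_at_up] matches the drop from [k] to
   [k.-1]. *)
pose B := A :&: del p; pose X := [set v in B | e q v].
have kE : k = k.-1.+1 by rewrite prednK // (covered_gt0 e_irr cA pA).
have gB : good e B k.-1 by apply: good_link => //; rewrite -kE.
have BA : B \subset A by apply: subsetIl.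
have FB : apart e F B by apply: apart_sub FAd.
have ik' : (i < #|F| + k.-1)%N by move: ik; rewrite {1}kE addnS.
have E3 : indfam F (B :\: X) =1 [pred S : {set 'I_n} | D q S && stable (p |: S)].
  move=> S; apply/and3P/andP => /= [[FS SFB sS]|[/andP[FS sq] sp]].
    have H v : v \in S -> ~~ e p v && ~~ e q v.
      move=> /(subsetP SFB) /setUP[vF|].
        have := FAd v p vF pA; have := FAd v q vF qA; rewrite !inE.
        by rewrite ![e v _]e_sym => /andP[_ ->] /andP[_ ->].
      case/setDP=> vB; rewrite inE vB /= => ->; move: vB; rewrite inE andbT.
      by case/andP=> _; rewrite inE => /andP[].
    rewrite !stableU1 // sS FS /=; split; apply/forall_inP => v /H /andP[] //.
  have sS : stable S by apply: stable_sub sp; apply: subsetUr.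
  split=> //; apply/subsetP => v vS.
  have /setUP[vF|vA] := stable_common_link FS sS vS; first by rewrite inE vF.
  move: sq sp; rewrite !stableU1 // => /andP[_ /forall_inP/(_ v vS) qv].
  move=> /andP[_ /forall_inP/(_ v vS) pv].
  rewrite inE /X /B; apply/orP; right.
  rewrite in_setD in_setI vA !inE (negPf qv) pv andbF /= andbT.
  by apply: contraNneq qv => ->; rewrite e_sym.
apply: (eq_exact_at E3); have [X0|X0] := eqVneq X set0.
  by rewrite X0 setD0; apply: (exact_indfam e_sym e_irr gB FB ik').
apply: (exact_indfam_del e_sym e_irr gB FB) => //.
  by apply/subsetP => v; rewrite inE => /andP[].
apply: stable_sub (stable_nbhd tA qA); apply/subsetP => v; rewrite !inE.
by move=> /andP[/andP[-> _] ->].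
Qed.

End SquareExact.

(** * Necessity of the graph conditions *)

Section Necessity.
Variables (K : fieldType) (n : nat) (e : rel 'I_n).
Hypotheses (e_sym : ssrbool.symmetric e) (e_irr : irreflexive e).
Implicit Types (A B F M S T U X Y : {set 'I_n}) (u v w : 'I_n).
Local Notation del := (del_nbhd e).
Local Notation stable := (stable e).

Variable alpha : nat.
Hypothesis alpha_max : forall S, stable S -> (#|S| <= alpha)%N.
Hypothesis exact_lt : forall a : 'I_n -> int, (exists j, a j < 0) ->
  forall i, (i < alpha)%N -> exact_at K (sq_face e a) i.

Definition wdeg F T (t : 'I_n) : int := if t \in F then -1 else (t \in T)%:Z.

Lemma wdeg_neg F T : [set t | wdeg F T t < 0] = F.
Proof. by apply/setP => t; rewrite inE /wdeg; case: (t \in F); case: (t \in T). Qed.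

Lemma wdeg_pos F T t : (0 < wdeg F T t) = (t \in T :\: F).
Proof. by rewrite inE /wdeg; case: (t \in F); case: (t \in T). Qed.

Lemma wdeg_sub F T S : sq_face e (wdeg F T) S -> F \subset S.
Proof. by case/andP; rewrite wdeg_neg. Qed.

(** All positive entries are one, so two edges inside [S :|: T] contradict [S] being a face as soon
    as they share no vertex outside [S]. *)
Lemma sq_face_no_edges F T S i j k l : sq_face e (wdeg F T) S ->
  e i j -> e k l ->
  [/\ i \in S :|: T, j \in S :|: T, k \in S :|: T & l \in S :|: T] ->
  ~ (forall t, t \notin S -> t \in [set i; j] -> t \in [set k; l] -> False).
Proof.
move=> fS eij ekl [iST jST kST lST] H.
have FS := wdeg_sub fS.
have ST z : z \in S :|: T -> z \in S :|: [set t | 0 < wdeg F T t].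
  rewrite !inE wdeg_pos inE => /orP[->//|->]; rewrite andbT.
  by case: (boolP (z \in F)) => [/(subsetP FS)->|_] //; rewrite orbT.
case/andP: fS => _ /negP nt; apply: nt.
apply: (two_edgesI e_irr _ eij ekl); first by rewrite wdeg_neg.
  by split; apply: ST.
by move=> t tS t1 t2; case: (H t).
Qed.

Lemma sq_face_stable F T S : sq_face e (wdeg F T) S -> stable S.
Proof.
move=> fS; apply: contrapT => /negP/unstableP[i [j [iS jS eij]]].
apply: (sq_face_no_edges fS eij eij); first by rewrite !inE iS jS.
by move=> t tS; rewrite !inE => /orP[/eqP E|/eqP E]; rewrite E ?iS ?jS in tS.
Qed.

Lemma near_stable_wdeg F T S c : F \subset S -> c \in F :|: T ->
  stable (S :|: (T :\ c)) -> sq_face e (wdeg F T) S.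
Proof.
move=> FS cFT sc; apply: near_stable_sq_face; rewrite /near_stable wdeg_neg FS.
apply/existsP; exists c; apply/andP; split.
  by rewrite /wdeg; case: (c \in F); case: (c \in T).
apply: stable_sub sc; apply: setUS; apply: setSD; apply/subsetP => t.
by rewrite inE wdeg_pos inE => /andP[].
Qed.

Lemma alpha_le_singleton F T : F != set0 ->
  (forall S, sq_face e (wdeg F T) S = (S == F)) -> (alpha <= #|F|)%N.
Proof.
move=> /set0Pn[f fF] E; rewrite leqNgt; apply/negP => lt_alpha.
apply: (exact_at_singleton E); apply: exact_lt => //.
by exists f; rewrite /wdeg fF.
Qed.

Lemma card_maximal_stable F : F != set0 -> stable F ->
  (forall u, stable (u |: F) -> u \in F) -> #|F| = alpha.
Proof.
move=> F0 sF Fmax; apply/eqP; rewrite eqn_leq alpha_max //=.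
apply: (@alpha_le_singleton _ set0) => // S; apply/idP/eqP => [fS|->].
  apply/eqP; rewrite eqEsubset (wdeg_sub fS) andbT; apply/subsetP => u uS.
  apply: Fmax; apply: stable_sub (sq_face_stable fS).
  by rewrite subUset sub1set uS (wdeg_sub fS).
have [f fF] := set0Pn _ F0; apply: (near_stable_wdeg (c := f)) => //.
  by rewrite inE fF.
by rewrite set0D setU0.
Qed.

Lemma common_linkU1 F u t : (t \in common_link e (u |: F)) =
  (t \in del u) && (t \in common_link e F).
Proof.
apply/idP/andP => [|[tu]]; rewrite !inE.
  move=> /forall_inP H; split; first by have := H u (setU11 _ _); rewrite inE.
  by apply/forall_inP => f fF; apply: H; rewrite inE fF orbT.
by move=> /forall_inP H; apply/forall_inP => f /setU1P[->|/H].
Qed.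

Lemma stable_common F t : t \in common_link e F -> stable F -> stable (t |: F).
Proof.
rewrite inE => /forall_inP H sF; rewrite stableU1 // sF; apply/forall_inP => f fF.
by have := H f fF; rewrite inE e_sym => /andP[].
Qed.

Lemma common_link_notin F t : t \in common_link e F -> t \notin F.
Proof.
by rewrite inE => /forall_inP H; apply/negP => /H; rewrite inE eqxx.
Qed.

(** [M] is maximal only among the stable sets whose closed neighbourhood misses [T]; a vertex that
    could still be added is thus equal or adjacent to some element of [T]. *)
Lemma maximal_common F T : stable F -> T \subset common_link e F ->
  exists M, [/\ F \subset M, stable M, T \subset common_link e M &
    forall w, stable (w |: M) -> w \in M \/ exists2 t, t \in T & t \notin del w].
Proof.
move=> sF TF; pose P M := stable M && (T \subset common_link e M).
have [|M /maxsetP[/andP[sM TM] Mmax] FM] := @maxset_exists _ P F.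
  by rewrite /P sF.
exists M; split=> // w swM; have [|/exists_inPn nT] := boolP [exists t in T, t \notin del w].
  by case/exists_inP; right; exists x.
left; rewrite -(Mmax (w |: M)); [exact: setU11| | exact: subsetUr].
rewrite /P swM; apply/subsetP => t tT; rewrite common_linkU1 (subsetP TM) // andbT.
exact/negbNE/nT.
Qed.

(* In degree [-1] on a maximal [M] and [+1] on the triangle, [M] is the only face. *)
Lemma link_triangle_free v : triangle_free e (del v).
Proof.
move=> i j k iv jv kv; apply/negP => /and3P[eij ejk eik].
pose T := [set i; j; k].
have neq x y : e x y -> x != y by apply: contraTneq => ->; rewrite e_irr.
have [||M [vM sM TM Mmax]] := @maximal_common [set v] T.
- exact: stable1.
- apply/subsetP => t tT; rewrite inE; apply/forall_inP => f /set1P->.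
  by move: tT; rewrite !in_setU !in_set1 => /orP[/orP[]|] /eqP->.
have vinM : v \in M by rewrite -sub1set.
have MT t f : t \in T -> f \in M -> t \in del f.
  by move=> /(subsetP TM); rewrite inE => /forall_inP; apply.
have iT : i \in T by rewrite !inE eqxx.
have jT : j \in T by rewrite !inE eqxx orbT.
have kT : k \in T by rewrite !inE eqxx orbT.
have : (alpha <= #|M|)%N.
  apply: (@alpha_le_singleton _ T); first by apply/set0Pn; exists v.
  move=> S; apply/idP/eqP => [fS|->].
    apply/eqP; rewrite eqEsubset (wdeg_sub fS) andbT; apply/subsetP => w wS.
    have [|//|[t tT tw]] := Mmax w.
      apply: stable_sub (sq_face_stable fS).
      by rewrite subUset sub1set wS (wdeg_sub fS).
    have wST : w \in S :|: T by rewrite inE wS.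
    have TST z : z \in T -> z \in S :|: T by move=> zT; rewrite in_setU zT orbT.
    (* The edge from [w] to [p] and the side of the triangle opposite to [p] share no vertex outside
       [S]. *)
    have adj p q r : p \in T -> q \in T -> r \in T -> e q r -> p != q -> p != r ->
        e w p -> w \in M.
      move=> pT qT rT eqr pq pr ewp; exfalso.
      apply: (sq_face_no_edges fS ewp eqr); first by split=> //; apply: TST.
      move=> z zS; rewrite !inE => /orP[/eqP E|/eqP->]; first by rewrite E wS in zS.
      by rewrite (negPf pq) (negPf pr).
    have [x xT ewx] : exists2 x, x \in T & e w x.
      move: tw; rewrite inE negb_and !negbK => /orP[/eqP Etw|]; last by exists t.
      rewrite -Etw; move: tT; rewrite !inE => /orP[/orP[]|] /eqP->.
      - by exists j.
      - by exists k.
      - by exists i; rewrite // e_sym.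
    move: xT ewx; rewrite {1}/T !inE => /orP[/orP[]|] /eqP->.
    + by apply: (adj i j k) => //; apply: neq.
    + by apply: (adj j i k) => //; [rewrite eq_sym; apply: neq|apply: neq].
    + by apply: (adj k i j) => //; rewrite eq_sym; apply: neq.
  (* Conversely [M] is a face: no end of the two edges lies in [M], so the exponents force four
     distinct ends in [T], which has at most three elements. *)
  rewrite /sq_face wdeg_neg subxx /=; apply/existsP => -[[[p q] [r s]]] /=.
  case/and3P=> epq ers /forallP H.
  have inT x : (forall t, (x == t) <= (p == t) + (q == t) + ((r == t) + (s == t)))%N ->
      x \notin M -> x \in T.
    move=> xle xM; have := implyP (H x) xM; rewrite /wdeg (negPf xM) lez_nat => Hx.
    by have := leq_trans (xle x) Hx; rewrite eqxx; case: (x \in T).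
  have pT' : p \notin M -> p \in T by apply: inT => t; rewrite -!addnA leq_addr.
  have qT' : q \notin M -> q \in T by apply: inT => t; rewrite -addnA addnCA leq_addr.
  have rT' : r \notin M -> r \in T by apply: inT => t; rewrite addnCA leq_addr.
  have sT' : s \notin M -> s \in T.
    by apply: inT => t; rewrite !addnA leq_addl.
  have noM x y : (x \notin M -> x \in T) -> (y \notin M -> y \in T) -> e x y ->
      x \notin M.
    move=> xT yT exy; apply/negP => xM; have [yM|/yT/MT/(_ xM)] := boolP (y \in M).
      by have /stableP/(_ x y xM yM) := sM; rewrite exy.
    by rewrite inE exy andbF.
  have pM := noM p q pT' qT' epq.
  have qM : q \notin M by apply: (noM q p) => //; rewrite e_sym.
  have rM := noM r s rT' sT' ers.
  have sM' : s \notin M by apply: (noM s r) => //; rewrite e_sym.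
  have cnt x : x \notin M -> ((p == x) + (q == x) + ((r == x) + (s == x)) <= 1)%N.
    move=> xM; have := implyP (H x) xM; rewrite /wdeg (negPf xM) lez_nat.
    by move=> /leq_trans; apply; case: (x \in T).
  have u4 : uniq [:: p; q; r; s].
    move: (cnt p pM) (cnt q qM) (cnt r rM) (cnt s sM'); rewrite /= !inE !eqxx.
    rewrite ![q == p]eq_sym ![r == p]eq_sym ![s == p]eq_sym ![r == q]eq_sym.
    rewrite ![s == q]eq_sym ![s == r]eq_sym.
    by do !case: (_ == _).
  have : (#|[:: p; q; r; s]| <= #|T|)%N.
    apply: subset_leq_card; apply/subsetP; apply/allP.
    by rewrite /= pT' ?qT' ?rT' ?sT'.
  rewrite (card_uniqP u4) /= /T => /leq_trans/(_ (leq_card_setU _ _)).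
  by rewrite cards1 addn1 ltnS cards2; case: (i != j).
have := alpha_max (stable_common (subsetP TM i iT) sM).
rewrite cardsU1 (common_link_notin (subsetP TM i iT)) add1n => h1 h2.
by have := leq_trans h1 h2; rewrite ltnn.
Qed.

(* In degree [-1] on a maximal [M] and [+1] on [u] and [s], the complex is the union
   of a cone over [u] and a cone over [s] that only share the face [M]. *)
Lemma edge_bound F u s : F != set0 -> stable F -> e u s ->
  u \in common_link e F -> s \in common_link e F ->
  exists M, [/\ F \subset M, stable M, u \in common_link e M,
    s \in common_link e M & (alpha <= #|M|.+1)%N].
Proof.
move=> /set0Pn[f fF] sF eus uF sF'; pose T := [set u; s].
have us : u != s by apply: contraTneq eus => ->; rewrite e_irr.
have uT : u \in T by rewrite !inE eqxx.
have sT : s \in T by rewrite !inE eqxx orbT.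
have [|M [FM sM TM Mmax]] := @maximal_common F T sF.
  by rewrite subUset !sub1set uF.
have uM := subsetP TM u uT; have sM' := subsetP TM s sT.
exists M; split=> //; rewrite leqNgt; apply/negP => lt_alpha.
have fM : f \in M by apply: (subsetP FM).
have ex : exact_at K (sq_face e (wdeg M T)) #|M|.+1.
  by apply: exact_lt => //; exists f; rewrite /wdeg fM.
pose D v := [pred S : {set 'I_n} | (M \subset S) && stable (v |: S)].
have uNM := common_link_notin uM; have sNM := common_link_notin sM'.
have DE S : sq_face e (wdeg M T) S = D u S || D s S.
  apply/idP/orP => [fS|].
    have MS := wdeg_sub fS; have sS := sq_face_stable fS.
    rewrite /= MS /= !stableU1 // sS /=.
    have [|/forall_inPn[w wS /negPn euw]] := boolP [forall w in S, ~~ e u w]; first by left.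
    have [|/forall_inPn[z zS /negPn esz]] := boolP [forall w in S, ~~ e s w]; first by right.
    exfalso; apply: (sq_face_no_edges fS euw esz).
      by rewrite !inE !eqxx wS zS !orbT.
    move=> t tS; rewrite !inE => /orP[/eqP E|/eqP E]; last by rewrite E wS in tS.
    move=> /orP[/eqP E'|/eqP E']; last by rewrite E' zS in tS.
    by rewrite -E E' eqxx in us.
  case=> /andP[MS sS].
    apply: (near_stable_wdeg (c := s)) => //; first by rewrite inE sT orbT.
    apply: stable_sub sS; rewrite subUset subsetUr /=; apply/subsetP => t.
    by rewrite !inE => /andP[/negPf->]; rewrite orbF => ->.
  apply: (near_stable_wdeg (c := u)) => //; first by rewrite inE uT orbT.
  apply: stable_sub sS; rewrite subUset subsetUr /=; apply/subsetP => t.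
  by rewrite !inE => /andP[/negPf->] /= ->.
have MU v S : v \in T -> (M \subset v |: S) = (M \subset S).
  move=> vT; apply/idP/idP => [/subsetP MS|MS]; last by apply: subset_trans MS (subsetUr _ _).
  apply/subsetP => g gM; have /setU1P[E|//] := MS g gM.
  by have := common_link_notin (subsetP TM v vT); rewrite -E gM.
have coneD v i : v \in T -> exact_at K (D v) i.
  by move=> vT; apply: (@cone_exact_at _ _ _ v) => S; rewrite /= MU // setUA setUid.
have cvxD v : convex (D v).
  move=> S1 S2 S3 S12 S23 /andP[MS1 _] /andP[_ s3] /=.
  by rewrite (subset_trans MS1) //=; apply: stable_sub s3; apply: setUS.
have cvx : convex (sq_face e (wdeg M T)).
  move=> S1 S2 S3 S12 S23; rewrite !DE => /orP D1 D3; have MS2 : M \subset S2.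
    by case: D1 => /andP[MS1 _]; apply: subset_trans MS1 S12.
  by rewrite /= !MS2 /=; case/orP: D3 => /andP[_ s3]; apply/orP; [left|right];
    apply: stable_sub s3; apply: setUS.
have down (Q : pred {set 'I_n}) S1 S2 : S1 \subset S2 -> Q S1 -> Q S2 ->
    stable (s |: S2) -> stable (s |: S1).
  by move=> S12 _ _; apply: stable_sub; apply: setUS.
(* Mayer-Vietoris in two moves: exactness of the union at [#|M|.+1] passes to [D u] without [D s],
   and from there to the intersection at [#|M|], which is the single face [M]. *)
have ex2 : exact_at K [pred S | D u S && ~~ stable (s |: S)] #|M|.+1.
  apply: eq_exact_at (exact_at_up cvx (@down _) ex _) => [S|] /=.
    by rewrite DE /=; case: (stable (s |: S)); rewrite ?andbF ?andbT ?orbF.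
  apply: (eq_exact_at _ (coneD s #|M| sT)) => S /=; rewrite DE /=.
  by case: (stable (s |: S)); rewrite ?andbF ?andbT ?orbT // orbC; case: (M \subset S).
have := exact_at_down (cvxD u) (@down _) (coneD u #|M| uT) ex2.
apply: exact_at_singleton => S; apply/idP/eqP => [/andP[/andP[MS suS] ssS]|->].
  apply/eqP; rewrite eqEsubset MS andbT; apply/subsetP => w wS.
  have [|//|[t tT tw]] := Mmax w.
    by apply: stable_sub suS; rewrite subUset sub1set inE wS orbT (subset_trans MS) ?subsetUr.
  have stS : stable (t |: S) by move: tT; rewrite !inE => /orP[] /eqP->.
  have tS x y : x \in T -> y \in T -> stable (y |: S) -> e x y -> x \notin S.
    move=> xT yT syS exy; apply/negP => xS; have /stableP/(_ x y) := syS.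
    by rewrite !inE eqxx xS orbT exy => /(_ isT isT).
  exfalso; move: tw; rewrite inE negb_and !negbK => /orP[/eqP Etw|ewt].
    move: tT wS; rewrite -Etw !inE => /orP[] /eqP->.
      by apply/negP; apply: (tS u s).
    by apply/negP; apply: (tS s u) => //; rewrite e_sym.
  have /stableP/(_ w t) := stS; rewrite !inE eqxx wS orbT ewt => /(_ isT isT).
  by [].
by rewrite /= subxx !stable_common.
Qed.

(* If [v |: U] is not maximum although [U] is a maximal stable set of
   [G_v - w], choose a neighbour [u] of [w] with the fewest neighbours in [U]
   and one such neighbour [s]; a maximum stable set through [s] given by
   [edge_bound] must contain a neighbour of [w] with fewer neighbours in [U]. *)
Lemma link_avoiding v : avoiding e (del v) alpha.-1.
Proof.
move=> S w Sv sS wv wS [u0 u0v wu0].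
have [|U /maxsetP[/and3P[sU Uv wU] Umax] SU] :=
    @maxset_exists _ (fun U => [&& stable U, U \subset del v & w \notin U]) S.
  by rewrite sS Sv.
exists U; split=> //.
have vU : v \notin U by apply/negP => /(subsetP Uv); rewrite inE eqxx.
have U_ext y : y \in del v -> y != w -> stable (y |: U) -> y \in U.
  move=> yv yw syU; rewrite -(Umax (y |: U)) ?setU11 ?subsetUr // syU.
  by rewrite subUset sub1set yv Uv !inE negb_or eq_sym yw.
have svU : stable (v |: U).
  rewrite stableU1 // sU; apply/forall_inP => y /(subsetP Uv).
  by rewrite inE => /andP[].
have del_of y X : stable (v |: X) -> y \in X -> y != v -> y \in del v.
  move=> svX yX yv; rewrite inE yv /=; have /stableP := svX; apply; first exact: setU11.
  by rewrite inE yX orbT.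
(* If [w] cannot be added, [v |: U] is maximal in the whole graph and has [alpha] elements; the
   other case is contradictory. *)
have [svUw|nsvUw] := boolP (stable (w |: (v |: U))); last first.
  have cU : #|v |: U| = alpha.
    apply: card_maximal_stable => // [|y sy].
      by apply/set0Pn; exists v; apply: setU11.
    have [->|yv] := eqVneq y v; first exact: setU11.
    have yw : y != w by apply: contraNneq nsvUw => <-.
    rewrite inE; apply/orP; right; apply: U_ext => //.
      by apply: (del_of y (y |: U)); rewrite ?setU11 // setUCA.
    by apply: stable_sub sy; apply: setUS; apply: subsetUr.
  by rewrite -cU cardsU1 vU.
exfalso.
pose nU u := [set z in U | e u z].
have Pu0 : (u0 \in del v) && e w u0 by rewrite u0v.
have [u /andP[uv wu] umin] :=
  @arg_minnP _ u0 (fun u => (u \in del v) && e w u) (fun u => #|nU u|) Pu0.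
have uw : u != w by apply: contraTneq wu => ->; rewrite e_irr.
have wUv : w \notin v |: U by rewrite !inE negb_or wU andbT; move: wv; rewrite inE => /andP[].
have notU y : e w y -> y \notin v |: U.
  move=> wy; apply/negP => yU; have /stableP/(_ w y) := svUw.
  by rewrite setU11 inE yU orbT wy => /(_ isT isT).
have [s sU' us] : exists2 s, s \in U & e u s.
  apply/exists_inP; apply: contraT => /exists_inPn nu.
  have := notU u wu; rewrite inE negb_or U_ext ?andbF // stableU1 // sU.
  exact/forall_inP.
(* Dropping the neighbours of [u] makes [u] compatible with [F]; [s], one of those dropped, is
   compatible because [v |: U] is stable. *)
pose F := v |: (U :\: nU u).
have FvU : F \subset v |: U by apply: setUS; apply: subsetDl.
have sF : stable F by apply: stable_sub svU.
have vF : v \in F by apply: setU11.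
have sv : s != v by apply: contraNneq vU => <-.
have uF : u \in common_link e F.
  rewrite inE; apply/forall_inP => f /setU1P[->|/setDP[fU]]; first by [].
  rewrite !inE fU /= => nuf; rewrite e_sym nuf andbT.
  by apply: contraNneq (notU u wu) => ->; rewrite inE fU orbT.
have sF' : s \in common_link e F.
  rewrite inE; apply/forall_inP => f fF; rewrite inE.
  have fvU := subsetP FvU f fF.
  have -> : ~~ e f s by have /stableP := svU; apply; rewrite // inE sU' orbT.
  rewrite andbT; apply: contraTneq fF => <-.
  by rewrite !inE (negPf sv) sU' us.
have [|M [FM sM uM sM' aM]] := edge_bound _ sF us uF sF'.
  by apply/set0Pn; exists v.
have sNM := common_link_notin sM'.
have wNM : w \notin M.
  apply/negP => wM; move: uM; rewrite inE => /forall_inP/(_ w wM).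
  by rewrite inE wu andbF.
have ws : w != s by apply: contraNneq wU => ->.
have ssM := stable_common sM' sM.
have vM : v \in M by apply: (subsetP FM).
(* [s |: M] has at least [alpha] elements, so [w] cannot be added to it, and [w] is not adjacent to
   [s]. *)
have [y yM wy] : exists2 y, y \in M & e w y.
  apply/exists_inP; apply: contraT => /exists_inPn nw.
  have : stable (w |: (s |: M)).
    rewrite stableU1 // ssM; apply/forall_inP => z /setU1P[->|]; last exact: nw.
    have /stableP := svUw; apply; first exact: setU11.
    by rewrite !inE sU' !orbT.
  move/alpha_max; rewrite !cardsU1 !inE negb_or ws wNM sNM !add1n => h.
  by have := leq_trans h aM; rewrite ltnn.
have yv : y \in del v.
  have /stableP/(_ v y vM yM) vy := sM; rewrite inE vy andbT.
  by apply: contraNneq (notU y wy) => ->; apply: setU11.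
(* A neighbour of [y] in [U] is outside [M], hence outside [F], hence adjacent to [u]; and [s] is
   adjacent to [u] but not to [y]. *)
have /umin : (y \in del v) && e w y by rewrite yv.
apply/negP; rewrite -ltnNge; apply: proper_card; apply/properP; split.
  apply/subsetP => z; rewrite !inE => /andP[zU yz]; rewrite zU /=.
  apply: contraTT yz => nuz; have /stableP := sM; apply => //.
  by apply: (subsetP FM); rewrite !inE zU nuz orbT.
exists s; rewrite !inE sU' ?us //=; apply/negP => eys.
by move: sM'; rewrite inE => /forall_inP/(_ y yM); rewrite inE eys andbF.
Qed.

End Necessity.

(** * Connected components *)

Section Components.
Variables (n : nat) (e : rel 'I_n).
Hypotheses (e_sym : ssrbool.symmetric e) (e_irr : irreflexive e).
Implicit Types (A B C F M S T U X Y : {set 'I_n}) (u v w : 'I_n).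
Local Notation del := (del_nbhd e).
Local Notation stable := (stable e).
Local Notation edge_in A := (fun u w => [&& u \in A, w \in A & e u w]).

Lemma connect_edge_in_sym A : connect_sym (edge_in A).
Proof.
apply: sym_connect_sym => u w; rewrite e_sym.
by case: (u \in A); case: (w \in A).
Qed.

Lemma componentsP A C : C \in components e A ->
  exists2 x, x \in A & C = [set y in A | connect (edge_in A) x y].
Proof. by case/imsetP => x xA ->; exists x. Qed.

Lemma component_sub A C : C \in components e A -> C \subset A.
Proof. by case/componentsP => x _ ->; apply/subsetP => y; rewrite inE => /andP[]. Qed.

Lemma component_closed A C u w : C \in components e A -> u \in C -> w \in A ->
  e u w -> w \in C.
Proof.
case/componentsP => x _ ->; rewrite !inE => /andP[uA xu] wA euw.
by rewrite wA; apply: connect_trans xu (connect1 _); rewrite uA wA.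
Qed.

Lemma component_exists A w : w \in A -> exists2 C, C \in components e A & w \in C.
Proof.
move=> wA; exists [set y in A | connect (edge_in A) w y]; first exact: imset_f.
by rewrite inE wA connect0.
Qed.

Lemma component_neighbour A C w : C \in components e A -> (1 < #|C|)%N -> w \in C ->
  exists2 u, u \in C & e w u.
Proof.
move=> CA C1 wC.
have [w' w'C w'w] : exists2 w', w' \in C & w' != w.
  have [y [z [yC zC yz]]] := card_gt1P C1.
  by have [E|] := eqVneq y w; [exists z; rewrite // -E eq_sym|exists y].
have /connectP[[|z p] /=] : connect (edge_in A) w w'.
  have [x _ E] := componentsP CA; move: wC w'C; rewrite E !inE.
  move=> /andP[_ xw] /andP[_]; apply: connect_trans.
  by rewrite connect_edge_in_sym.
- by move=> _ E; rewrite E eqxx in w'w.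
case/andP=> /and3P[_ zA ewz] _ _; exists z => //.
exact: component_closed CA wC zA ewz.
Qed.

Lemma independentE A S : independent e A S = (S \subset A) && stable S.
Proof. by []. Qed.

Lemma max_independentP A S : max_independent e A S ->
  [/\ S \subset A, stable S &
    forall U, U \subset A -> stable U -> S \subset U -> U = S].
Proof.
move=> /maxsetP[/andP[SA sS] Smax]; split=> // U UA sU.
by apply: Smax; rewrite independentE UA.
Qed.

Lemma max_independent_exists A S : S \subset A -> stable S ->
  exists2 U, max_independent e A U & S \subset U.
Proof.
move=> SA sS; have [|U maxU SU] := @maxset_exists _ (independent e A) S.
  by rewrite independentE SA.
by exists U.
Qed.

Lemma independence_number_const A c :
  (forall S, max_independent e A S -> #|S| = c) -> independence_number e A = c.
Proof.
move=> Ac; apply/eqP; rewrite eqn_leq; apply/andP; split.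
  apply/bigmax_leqP => S /andP[SA sS].
  have [U maxU SU] := max_independent_exists SA sS.
  by rewrite -(Ac U maxU) subset_leq_card.
have [U maxU _] := max_independent_exists (sub0set A) (stable0 e).
by rewrite -(Ac U maxU); apply: leq_bigmax_cond; have /maxsetP[] := maxU.
Qed.

Lemma well_covered_covered A :
  well_covered e A -> covered e A (independence_number e A).
Proof.
move=> wA S SA sS; have [U maxU SU] := max_independent_exists SA sS.
have [UA sU _] := max_independentP maxU.
exists U; split=> //; apply/esym/independence_number_const => S' maxS'.
exact: wA.
Qed.

Lemma covered_max A k S : covered e A k -> max_independent e A S -> #|S| = k.
Proof.
move=> cA /max_independentP[SA sS Smax]; have [U [SU UA sU <-]] := cA S SA sS.
by rewrite (Smax U).
Qed.

(** No edge of [A] leaves [C], so a fixed maximal stable set [Y] of the rest can be adjoined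
    throughout, and both conditions restrict to [C] with [k - #|Y|]. As [C] is nontrivial, each of
    its vertices has a neighbour, as [avoiding] demands. *)
Lemma component_W2 A C k : covered e A k -> avoiding e A k ->
  C \in components e A -> (1 < #|C|)%N -> W2 e C.
Proof.
move=> cA aA CA C1; have CsA := component_sub CA.
have [Y /max_independentP[YAC sY Ymax] _] :=
  max_independent_exists (sub0set (A :\: C)) (stable0 e).
have YA : Y \subset A by apply: subset_trans YAC (subsetDl _ _).
have sSY S : S \subset C -> stable S -> stable (S :|: Y).
  move=> /subsetP SC sS; rewrite stableU // sS sY /=.
  apply/forall_inP => u uS; apply/forall_inP => w wY; apply/negP => euw.
  have /setDP[wA /negP] := subsetP YAC w wY; apply.
  exact: component_closed CA (SC u uS) wA euw.
have card_split U B S : S :|: Y \subset U -> U \subset A -> stable U -> B \subset C ->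
    max_independent e B S -> U :&: C \subset B -> (#|S| + #|Y|)%N = #|U|.
  move=> SYU UA sU BC /max_independentP[SB sS Smax] UB.
  have ES : U :&: C = S.
    apply: Smax => //; first by apply: stable_sub sU; apply: subsetIl.
    rewrite subsetI (subset_trans SB BC) andbT.
    by apply: subset_trans SYU; apply: subsetUl.
  have EY : U :\: C = Y.
    apply: Ymax; first exact: setSD.
      by apply: stable_sub sU; apply: subsetDl.
    apply/subsetP => y yY; have /setDP[_ yC] := subsetP YAC y yY.
    by rewrite inE yC (subsetP SYU) // inE yY orbT.
  by rewrite -(cardsID C U) ES EY.
have card_max S : max_independent e C S -> #|S| = (k - #|Y|)%N.
  move=> maxS; have [SC sS _] := max_independentP maxS.
  have [|U [SYU UA sU cU]] := cA (S :|: Y) _ (sSY S SC sS).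
    by rewrite subUset YA andbT; apply: subset_trans SC CsA.
  by rewrite -cU -(card_split U C S) ?addnK // subsetIr.
have card_max_del w S : w \in C -> max_independent e (C :\ w) S -> #|S| = (k - #|Y|)%N.
  move=> wC maxS; have [SCw sS _] := max_independentP maxS.
  have /subsetD1P[SC wS] := SCw.
  have [||||U [SYU UA sU wU cU]] := aA (S :|: Y) w _ (sSY S SC sS).
  - by rewrite subUset YA andbT; apply: subset_trans SC CsA.
  - exact: (subsetP CsA).
  - rewrite inE negb_or wS; apply/negP => /(subsetP YAC).
    by rewrite inE wC.
  - have [u uC wu] := component_neighbour CA C1 wC.
    by exists u => //; apply: (subsetP CsA).
  rewrite -cU -(card_split U (C :\ w) S) ?addnK ?subsetDl //.
  by rewrite subsetD1 subsetIr inE negb_and wU.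
split; first by move=> S S' /card_max-> /card_max->.
move=> w wC; split; first by move=> S S' /(card_max_del w)-> // /(card_max_del w)->.
rewrite (independence_number_const card_max).
by apply: independence_number_const => S; apply: card_max_del.
Qed.

(** Extend [S] to a maximal stable set [U] of [A :\ w]. If [w] could be added to [U], then inside
    the component [C] of [w] the set [U :&: C], already of full size by W2, could be enlarged. *)
Lemma avoiding_components A k : covered e A k ->
  (forall C, C \in components e A -> (1 < #|C|)%N -> W2 e C) -> avoiding e A k.
Proof.
move=> cA W S w SA sS wA wS [u uA wu].
have [|U maxU SU] := @max_independent_exists (A :\ w) S _ sS.
  by rewrite subsetD1 SA.
have [/subsetD1P[UA wU] sU Umax] := max_independentP maxU.
exists U; split=> //; have [swU|nswU] := boolP (stable (w |: U)); last first.
  have [U' [UU' U'A sU' <-]] := cA U UA sU.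
  have wU' : w \notin U'.
    apply: contra nswU => wU'; apply: stable_sub sU'.
    by rewrite subUset sub1set wU'.
  by rewrite (Umax U') // subsetD1 U'A.
exfalso; have [C CA wC] := component_exists wA; have CsA := component_sub CA.
have uC : u \in C by apply: component_closed CA wC uA wu.
have C1 : (1 < #|C|)%N.
  apply/card_gt1P; exists w, u; split=> //.
  by apply: contraTneq wu => ->; rewrite e_irr.
have [_ /(_ w wC) [wcC iC]] := W C CA C1.
have maxUC : max_independent e (C :\ w) (U :&: C).
  apply/maxsetP; split.
    rewrite independentE subsetD1 subsetIr inE negb_and wU /=.
    by apply: stable_sub sU; apply: subsetIl.
  move=> X /andP[/subsetD1P[XC wX] sX] UCX; apply/eqP.
  rewrite eqEsubset UCX andbT subsetI XC andbT; apply/subsetP => x xX.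
  have xA : x \in A by apply: (subsetP CsA); apply: (subsetP XC).
  suff <- : x |: U = U by apply: setU11.
  apply: Umax; last exact: subsetUr.
    rewrite subsetD1 subUset sub1set xA UA !inE negb_or wU !andbT /=.
      by apply: contraNneq wX => ->.
  rewrite stableU1 // sU; apply/forall_inP => y yU; apply/negP => exy.
  have yC : y \in C.
    by apply: component_closed CA (subsetP XC x xX) (subsetP UA y yU) exy.
  have yX : y \in X by apply: (subsetP UCX); rewrite inE yU.
  by have /stableP/(_ x y xX yX) := (sX : stable X); rewrite exy.
have cUC : #|U :&: C| = independence_number e C.
  by rewrite -iC; apply: covered_max maxUC; apply: well_covered_covered.
have : (#|w |: (U :&: C)| <= independence_number e C)%N.
  apply: leq_bigmax_cond; rewrite independentE subUset sub1set wC subsetIr.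
  by apply: stable_sub swU; apply: setUS; apply: subsetIl.
by rewrite cardsU1 inE negb_and wU cUC ltnn.
Qed.

Lemma triangle_free_components A :
  (forall C, C \in components e A -> (1 < #|C|)%N -> triangle_free e C) ->
  triangle_free e A.
Proof.
move=> tC u v w uA vA wA; apply/negP => /and3P[uv vw uw].
have [C CA uC] := component_exists uA.
have vC : v \in C by apply: component_closed CA uC vA uv.
have wC : w \in C by apply: component_closed CA uC wA uw.
have C1 : (1 < #|C|)%N.
  apply/card_gt1P; exists u, v; split=> //.
  by apply: contraTneq uv => ->; rewrite e_irr.
by have := tC C CA C1 u v w uC vC wC; rewrite uv vw uw.
Qed.

Local Notation alpha := (independence_number e [set: 'I_n]).

Lemma alpha_ge S : stable S -> (#|S| <= alpha)%N.
Proof. by move=> sS; apply: leq_bigmax_cond; rewrite independentE subsetT. Qed.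

Lemma covered_del v : covered e [set: 'I_n] alpha -> covered e (del v) alpha.-1.
Proof.
move=> cV; have := @covered_link _ e e_sym e_irr setT alpha.-1 v.
rewrite prednK; last by apply: leq_trans (alpha_ge (stable1 e_irr v)); rewrite cards1.
by rewrite setTI => /(_ cV (in_setT v)).
Qed.

Lemma sq_face_necessary (K : fieldType) :
  (forall a : 'I_n -> int, (exists j, a j < 0) ->
     forall i, (i < alpha)%N -> exact_at K (sq_face e a) i) ->
  well_covered e [set: 'I_n] /\
  forall v C, C \in components e (del v) -> (1 < #|C|)%N ->
    triangle_free e C /\ W2 e C.
Proof.
move=> ex.
have wcV : well_covered e [set: 'I_n].
  (* A degree with a negative entry needs a nonempty set; an empty maximal stable set means that
     there are no vertices. *)
  have card0 S S' : max_independent e setT S -> stable S' -> S = set0 -> S' = set0.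
    move=> /max_independentP[_ _ Smax] _ S0; apply/eqP; rewrite -subset0.
    apply/subsetP => u _; rewrite -S0 -(Smax [set u]) ?set11 ?subsetT ?S0 ?sub0set //.
    exact: stable1.
  have cardN0 S : max_independent e setT S -> S != set0 -> #|S| = alpha.
    move=> /max_independentP[_ sS Smax] S0.
    apply: (card_maximal_stable e_irr alpha_ge ex S0 sS) => u suS.
    by rewrite -(Smax (u |: S)) ?setU11 ?subsetT // subsetUr.
  move=> S S' maxS maxS'; have [S0|S0] := eqVneq S set0.
    have [_ sS' _] := max_independentP maxS'.
    by rewrite (card0 S S') // S0.
  have [S'0|S'0] := eqVneq S' set0.
    have [_ sS _] := max_independentP maxS.
    by rewrite (card0 S' S) // S'0.
  by rewrite !cardN0.
split=> // v C Cv C1; have cv := @covered_del v (well_covered_covered wcV).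
have av := link_avoiding e_sym e_irr alpha_ge ex (v:=v).
split; last exact: component_W2 cv av Cv C1.
apply: triangle_free_sub (component_sub Cv) _.
exact: (link_triangle_free e_sym e_irr alpha_ge ex (v:=v)).
Qed.

Lemma sq_face_sufficient (K : fieldType) :
  well_covered e [set: 'I_n] ->
  (forall v C, C \in components e (del v) -> (1 < #|C|)%N ->
    triangle_free e C /\ W2 e C) ->
  forall a : 'I_n -> int, (exists j, a j < 0) ->
    forall i, (i < alpha)%N -> exact_at K (sq_face e a) i.
Proof.
move=> wcV comp a [v av] i i_alpha.
have cV := well_covered_covered wcV.
set F := [set t | a t < 0]; have vF : v \in F by rewrite inE.
(* If an edge lies inside [F], its square is a unit after localization and there are no faces. *)
have [sF|nsF] := boolP (stable F); last first.
  apply: exact_at_void => S /andP[FS /negP[]].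
  have [j [k [jF kF ejk]]] := unstableP nsF.
  apply: (two_edgesI e_irr FS ejk ejk); first by rewrite !inE !(subsetP FS).
  by move=> t tS; rewrite !inE => /orP[] /eqP E; rewrite E (subsetP FS) in tS.
have Fv : F :\ v \subset del v.
  apply/subsetP => u /setD1P[uv uF]; rewrite inE uv.
  by have /stableP := sF; apply.
pose A := common_link e F.
have Av : A \subset del v by apply/subsetP => u; rewrite inE => /forall_inP/(_ v vF).
have outside U : F \subset U -> stable U -> U :\: F \subset A.
  move=> FU sU; apply/subsetP => u /setDP[uU uF].
  by have := stable_common_link FU sU uU; rewrite inE (negPf uF).
have sAF S : S \subset A -> stable S -> stable (S :|: F).
  move=> /subsetP SA sS; rewrite stableU // sS sF; apply/forall_inP => u /SA.
  rewrite inE => /forall_inP uA; apply/forall_inP => f /uA.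
  by rewrite inE e_sym => /andP[].
have disj S : S \subset A -> [disjoint S & F].
  move=> /subsetP SA; rewrite disjoints_subset; apply/subsetP => u /SA uA.
  by rewrite inE; apply: common_link_notin uA.
have cF : #|F| = (#|F|.-1).+1 by rewrite prednK // card_gt0; apply/set0Pn; exists v.
have cA : covered e A (alpha - #|F|).
  move=> S SA sS; have [U [SFU _ sU <-]] := cV _ (subsetT _) (sAF S SA sS).
  have /andP[SU FU] : (S \subset U) && (F \subset U) by rewrite -subUset.
  exists (U :\: F); split.
  - by rewrite subsetD SU disj.
  - exact: outside.
  - by apply: stable_sub sU; apply: subsetDl.
  - by rewrite cardsD (setIidPr FU).
(* A stable set of [A] joined with [F :\ v] is stable in [del v]; an extension there that avoids
   [w], with [v] added and [F] taken away, lies in [A]. *)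
have aA : avoiding e A (alpha - #|F|).
  move=> S w SA sS wA wS [u uA wu].
  have av' : avoiding e (del v) alpha.-1.
    by apply: avoiding_components (@covered_del v cV) _ => C Cv /(comp v C Cv)[].
  have sSF : stable (S :|: (F :\ v)).
    by apply: stable_sub (sAF S SA sS); apply: setUS; apply: subsetDl.
  have wF := common_link_notin wA.
  have [||||U [SFU Uv sU wU cU]] := av' _ w _ sSF.
  - by rewrite subUset Fv andbT; apply: subset_trans Av.
  - exact: (subsetP Av).
  - by rewrite in_setU in_setD1 (negPf wS) (negPf wF) andbF.
  - by exists u => //; apply: (subsetP Av).
  have /andP[SU FU] : (S \subset U) && (F :\ v \subset U) by rewrite -subUset.
  have svU : stable (v |: U) by apply: (@stable_link _ e e_sym e_irr setT); rewrite ?setTI.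
  have FvU : F \subset v |: U by rewrite -(setD1K vF); apply: setUS.
  have vU : v \notin U by apply/negP => /(subsetP Uv); rewrite inE eqxx.
  have wv : w != v by apply: contraNneq wF => ->.
  exists ((v |: U) :\: F); split.
  - by rewrite subsetD disj // andbT; apply: subset_trans SU (subsetUr _ _).
  - exact: outside.
  - by apply: stable_sub svU; apply: subsetDl.
  - by rewrite in_setD in_setU1 (negPf wv) (negPf wU) andbF.
  - rewrite cardsD (setIidPr FvU) cardsU1 vU cU add1n prednK //.
    by apply: leq_trans (alpha_ge (stable1 e_irr v)); rewrite cards1.
have tA : triangle_free e A.
  apply: triangle_free_sub Av _; apply: triangle_free_components => C Cv.
  by move/(comp v C Cv) => [].
have F0 : F != set0 by apply/set0Pn; exists v.
have FE : near_stable e a =1 sq_face e a.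
  move=> S; apply/idP/idP; first exact: near_stable_sq_face.
  exact: sq_face_near_stable.
apply: (eq_exact_at FE).
apply: (exact_near_stable e_sym e_irr F0 tA cA aA).
by rewrite subnKC // alpha_ge.
Qed.

End Components.

(** * The square of the edge ideal is monomial *)

Section EdgeIdeal.
Variables (K : fieldType) (n : nat) (e : rel 'I_n).
Local Notation R := {mpoly K[n]}.
Local Notation I := (edge_ideal K e).
Local Notation J := (ideal_mul I I).
Implicit Types (p q : R) (m : 'X_{1..n}).

Lemma submod_closed_monomials (Q : 'X_{1..n} -> Prop) :
  (forall m m', Q m -> Q (m' + m)%MM) ->
  submod_closed (fun p : R^o => `[< forall m, m \in msupp (p : R) -> Q m >]).
Proof.
move=> Qup; split=> [|r u v /asboolP Qu /asboolP Qv]; apply/asboolP => m.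
  by rewrite msupp0.
move=> /msuppD_le; rewrite mem_cat => /orP[|/Qv//].
by move=> /msuppM_le /allpairsP[[m1 m2] /= [_ /Qu Qm2 ->]]; apply: Qup.
Qed.

Lemma ideal_gen_min (S P : {pred R}) : submod_closed (P : {pred R^o}) ->
  {subset S <= P} -> {subset ideal_gen S <= P}.
Proof. by move=> Psub SP p /asboolP; apply. Qed.

Lemma mem_ideal_gen (S : {pred R}) p : p \in S -> p \in ideal_gen S.
Proof. by move=> Sp; apply/asboolP => L _; apply. Qed.

Lemma submodClosed_monomials (L : submodClosed R^o) p :
  (forall m, m \in msupp p -> ('X_[m] : R) \in L) -> p \in L.
Proof.
move=> LX; rewrite [p]mpolyE big_seq; apply: rpred_sum => m /LX Lm.
by rewrite -mul_mpolyC; apply: (@rpredZ _ _ L).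
Qed.

Definition edge_pairs : seq (('I_n * 'I_n) * ('I_n * 'I_n)) :=
  [seq d <- enum {: ('I_n * 'I_n) * ('I_n * 'I_n)} | e d.1.1 d.1.2 && e d.2.1 d.2.2].

Definition sq_gens : seq 'X_{1..n} :=
  [seq (U_(d.1.1) + U_(d.1.2) + (U_(d.2.1) + U_(d.2.2)))%MM | d <- edge_pairs].

Lemma edge_ideal_mem p m : p \in I -> m \in msupp p ->
  exists i j, e i j /\ (U_(i) + U_(j) <= m)%MM.
Proof.
move=> Ip; move: m; apply/asboolP; move: p Ip.
apply: (@ideal_gen_min _ (fun p : R =>
  `[< forall m, m \in msupp p -> exists i j, e i j /\ (U_(i) + U_(j) <= m)%MM >])).
  apply: submod_closed_monomials => m m' [i [j [eij le_m]]].
  by exists i, j; split=> //; apply: lepm_trans le_m (lem_addl _ _).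
move=> p /asboolP[i [j [eij ->]]]; apply/asboolP => m.
by rewrite -mpolyXD msuppX inE => /eqP->; exists i, j; split=> //; apply: lepm_refl.
Qed.

Lemma edge_mem i j : e i j -> ('X_i * 'X_j : R) \in I.
Proof. by move=> eij; apply: mem_ideal_gen; apply/asboolP; exists i, j. Qed.

Lemma lem_add2 m1 m2 m3 m4 :
  (m1 <= m3)%MM -> (m2 <= m4)%MM -> (m1 + m2 <= m3 + m4)%MM.
Proof.
move=> /mnm_lepP le13 /mnm_lepP le24; apply/mnm_lepP => i.
by rewrite !mnmDE leq_add.
Qed.

Lemma sq_mem p : p \in J <->
  forall m, m \in msupp p -> has (fun g => (g <= m)%MM) sq_gens.
Proof.
split=> [Jp|H]; last first.
  apply: submodClosed_monomials => m /H /hasP[g /mapP[[[i j] [k l]]]].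
  rewrite mem_filter => /andP[/andP[/= eij ekl] _] -> le_m.
  rewrite -(submK le_m) !mpolyXD; apply: (@rpredZ _ _ J).
  by apply: mem_ideal_gen; apply/asboolP;
    exists ('X_i * 'X_j), ('X_k * 'X_l); split; [apply: edge_mem..|].
apply/asboolP; move: p Jp.
apply: (@ideal_gen_min _ (fun p : R =>
  `[< forall m, m \in msupp p -> has (fun g => (g <= m)%MM) sq_gens >])).
  apply: (submod_closed_monomials
    (Q := fun m => has (fun g => (g <= m)%MM) sq_gens)) => m m' /hasP[g gG le_g].
  by apply/hasP; exists g => //; apply: lepm_trans le_g (lem_addl _ _).
move=> p /asboolP[a [b [Ia Ib ->]]]; apply/asboolP => m.
move=> /msuppM_le /allpairsP[[m1 m2] /= [am1 bm2 ->]].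
have [i [j [eij le1]]] := edge_ideal_mem Ia am1.
have [k [l [ekl le2]]] := edge_ideal_mem Ib bm2.
apply/hasP; exists (U_(i) + U_(j) + (U_(k) + U_(l)))%MM; last exact: lem_add2.
apply/mapP; exists ((i, j), (k, l)) => //.
by rewrite mem_filter /= eij ekl mem_enum.
Qed.

Lemma active_sq_gens (a : {ffun 'I_n -> int}) :
  active sq_gens a =1 sq_face e a.
Proof.
move=> S; rewrite /active /sq_face; congr (_ && ~~ _).
  apply/forallP/subsetP => [H i|H i].
    by rewrite inE ltNge; apply: contraR => /(implyP (H i)).
  by apply/implyP => iS; rewrite leNgt; apply: contra iS => ai; apply: H; rewrite inE.
apply/hasP/existsP => [[g /mapP[d]]|[d /and3P[e1 e2 H]]].
  rewrite mem_filter => /andP[/andP[e1 e2] _] -> H; exists d; rewrite e1 e2 /=.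
  by move: H; congr is_true; apply: eq_forallb => t; rewrite !mnmDE !mnm1E.
exists (U_(d.1.1) + U_(d.1.2) + (U_(d.2.1) + U_(d.2.2)))%MM.
  by apply/mapP; exists d; rewrite // mem_filter e1 e2 mem_enum.
by move: H; congr is_true; apply: eq_forallb => t; rewrite !mnmDE !mnm1E.
Qed.

End EdgeIdeal.

(** * Krull dimension *)

Section PrimeIdeals.
Variable R : comNzRingType.
Implicit Type P : {pred R}.

Lemma prime_idealD P u v : prime_ideal P -> u \in P -> v \in P -> u + v \in P.
Proof. by case=> [[_ _ H] _] Pu Pv; rewrite -[u]mul1r; apply: H. Qed.

Lemma prime_idealMl P a u : prime_ideal P -> u \in P -> a * u \in P.
Proof. by case=> [[P0 _ H] _] Pu; rewrite -[_ * _]addr0; apply: H. Qed.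

Lemma prime_idealN P u : prime_ideal P -> u \in P -> - u \in P.
Proof. by move=> PP Pu; rewrite -mulN1r; apply: prime_idealMl. Qed.

Lemma prime_idealDl P u v : prime_ideal P -> v \in P -> u + v \in P -> u \in P.
Proof.
move=> PP Pv Puv; rewrite -(addrK v u); apply: (prime_idealD PP Puv).
exact: prime_idealN.
Qed.

Lemma prime_idealM P u v : prime_ideal P -> u * v \in P -> (u \in P) || (v \in P).
Proof. by case=> _; apply. Qed.

Lemma prime_idealX P u k : prime_ideal P -> u ^+ k \in P -> u \in P.
Proof.
move=> PP; elim: k => [|k IHk]; first by case: PP => [[_ /negP nP1 _] _]; rewrite expr0.
by rewrite exprS => /(prime_idealM PP)/orP[|/IHk].
Qed.

Lemma prime_ideal_sum P (I : Type) (r : seq I) (Q : pred I) (F : I -> R) :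
  prime_ideal P -> (forall i, Q i -> F i \in P) -> \sum_(i <- r | Q i) F i \in P.
Proof.
move=> PP H; elim/big_ind: _ => //; first by case: PP => [[]].
by move=> u v; apply: prime_idealD.
Qed.

Lemma prime_ideal_submod P : prime_ideal P -> submod_closed (P : {pred R^o}).
Proof. by case=> [[P0 _ H] _]; split. Qed.

End PrimeIdeals.

Section TupleSum.
Variables (V : nmodType) (T : finType) (r : nat).

Lemma sum_tupleS (F : r.+1.-tuple T -> V) :
  \sum_t F t = \sum_k \sum_(t : r.-tuple T) F [tuple of k :: t].
Proof.
rewrite pair_bigA /= (reindex (fun p : T * r.-tuple T => [tuple of p.1 :: p.2])) //=.
exists (fun t : r.+1.-tuple T => (thead t, [tuple of behead t])).
  move=> [k t] _ /=; congr (_, _); exact: val_inj.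
by move=> t _; rewrite -tuple_eta.
Qed.

End TupleSum.

(** * Algebraic independence along chains of primes *)

Section Chains.
Variables (K : fieldType) (n : nat).
Local Notation R := {mpoly K[n]}.

(** The value at [f 0, ..., f r.-1] of the polynomial with coefficients [c], of degree less than [N]
    in each variable. *)
Definition alg_comb N r (c : r.-tuple 'I_N -> K) (f : nat -> R) : R :=
  \sum_(t : r.-tuple 'I_N) (c t)%:MP * \prod_(i < r) f i ^+ tnth t i.

(* A prime chain makes [f 0, f 1, ...] algebraically independent modulo its
   first term: divide a relation by the least power of [f 0] and pass to the
   next prime. *)
Lemma chain_alg_indep N r (P : nat -> {pred R}) (f : nat -> R)
    (c : r.-tuple 'I_N -> K) :
  (forall i, (i <= r)%N -> prime_ideal (P i)) ->
  (forall i, (i < r)%N -> [/\ {subset P i <= P i.+1}, f i \in P i.+1 & f i \notin P i]) ->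
  alg_comb c f \in P 0%N -> forall t, c t = 0.
Proof.
elim: r P f c => [|r IHr] P f c primeP chainP Pc t.
  have P0 := primeP 0%N (leqnn _).
  apply/eqP; apply: contraT => ct.
  have E : alg_comb c f = (c t)%:MP.
    rewrite /alg_comb (bigD1 t) //= big_ord0 mulr1 big1 ?addr0 // => t' /negP[].
    by rewrite [t']tuple0 [t]tuple0.
  move: Pc; rewrite E => /(prime_idealMl ((c t)^-1)%:MP P0).
  rewrite -mpolyCM mulVf // mpolyC1 => P1.
  by case: P0 => [[_ /negP]].
pose g (k : 'I_N) := alg_comb (fun t : r.-tuple 'I_N => c [tuple of k :: t]) (fun i => f i.+1).
have E : alg_comb c f = \sum_(k < N) f 0%N ^+ k * g k.
  rewrite /alg_comb sum_tupleS; apply: eq_bigr => k _; rewrite mulr_sumr.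
  apply: eq_bigr => t' _; rewrite big_ord_recl tnth0 mulrCA; congr (_ * (_ * _)).
  by apply: eq_bigr => i _; rewrite tnthS.
have [sub01 f01 f00] := chainP 0%N (ltn0Sn _).
have P0 := primeP 0%N (leq0n _); have P1 := primeP 1%N (ltn0Sn _).
have gP k : g k \in P 1%N -> forall t' : r.-tuple 'I_N, c [tuple of k :: t'] = 0.
  apply: (IHr (fun i => P i.+1)) => i ir; first exact: primeP.
  exact: chainP.
suff gk k : g k \in P 1%N.
  by rewrite [t]tuple_eta; apply: (gP (thead t)).
have [j] := ubnP (k : nat); elim: j k => // j IHj k; rewrite ltnS => kj.
have g0 (k' : 'I_N) : (k' < k)%N -> g k' = 0.
  move=> k'k; have /gP H := IHj k' (leq_trans k'k kj).
  by rewrite /g /alg_comb big1 // => t' _; rewrite H mpolyC0 mul0r.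
have Ek : alg_comb c f =
    f 0%N ^+ k * (g k + f 0%N * \sum_(k' : 'I_N | (k < k')%N) f 0%N ^+ (k' - k.+1) * g k').
  rewrite E mulrDr mulrA (bigD1 k) //=; congr (_ + _); rewrite mulr_sumr.
  rewrite (bigID (fun k' : 'I_N => (k < k')%N)) /= [X in _ + X]big1 ?addr0.
    apply: eq_big => [k'|k' /andP[_ kk']].
      by rewrite -val_eqE /=; case: ltngtP.
    by rewrite mulrA -exprSr -exprD subnKC.
  move=> k' /andP[k'k]; rewrite -leqNgt => le; rewrite g0 ?mulr0 //.
  by rewrite ltn_neqAle le andbT.
move: Pc; rewrite Ek => /(prime_idealM P0)/orP[/(prime_idealX P0)|].
  by rewrite (negPf f00).
move=> /sub01; apply: prime_idealDl => //; rewrite mulrC.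
exact: prime_idealMl.
Qed.

(* There are more monomials in the [f i] of bounded degree than monomials in the
   variables of [S] of the corresponding degree. *)
Lemma alg_dependent (S : {set 'I_n}) r (f : nat -> R) : (#|S| < r)%N ->
  (forall i m j, m \in msupp (f i) -> j \notin S -> m j = 0%N) ->
  exists N (c : r.-tuple 'I_N -> K), (exists t, c t != 0) /\ alg_comb c f = 0.
Proof.
move=> Sr fS.
pose bnd B (p : R) := forall m, m \in msupp p -> forall j, (m j <= if j \in S then B else 0)%N.
have bndM B B' p q : bnd B p -> bnd B' q -> bnd (B + B')%N (p * q).
  move=> bp bq m /msuppM_le /allpairsP[[m1 m2] /= [/bp h1 /bq h2 ->]] j.
  by rewrite mnmDE; move: (h1 j) (h2 j); case: ifP => _; lia.
have bnd1 : bnd 0%N 1.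
  by move=> m; rewrite msupp1 inE => /eqP-> j; rewrite mnm0E.
have bndX B p k : bnd B p -> bnd (k * B)%N (p ^+ k).
  by move=> bp; elim: k => [|k IHk]; rewrite ?expr0 // exprS mulSn; apply: bndM.
have bndW B B' p : (B <= B')%N -> bnd B p -> bnd B' p.
  move=> le bp m /bp mB j; have := mB j; case: ifP => // _ h; exact: leq_trans h le.
pose D := (\sum_(i < r) \sum_(m <- msupp (f i)) mdeg m)%N.
have bndf i : (i < r)%N -> bnd D (f i).
  move=> ir m mf j; case: ifP => jS; last by rewrite (fS i m j) ?jS.
  rewrite /D (bigD1 (Ordinal ir)) //= (big_rem m) //= mdegE (bigD1 j) //=.
  by rewrite -!addnA leq_addr.
(* The constants give [M <= N * Q] and [Q ^ s < N], hence [M ^ s < N ^ s.+1 <= N ^ r]: more products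
   than monomials to express them. *)
pose s := #|S|; pose Q := (r * D).+1; pose N := (Q ^ s).+1.
pose M := (r * (N * D)).+1.
have bndP (t : r.-tuple 'I_N) : bnd (r * (N * D))%N (\prod_(i < r) f i ^+ tnth t i).
  have : bnd (\sum_(i < r) (N * D))%N (\prod_(i < r) f i ^+ tnth t i).
    apply: (big_ind2 (fun p B => bnd B p)) => //; first by move=> p B q B'; apply: bndM.
    move=> i _; apply: bndW (bndX _ _ _ (bndf i (ltn_ord i))).
    by rewrite leq_mul2r ltnW ?orbT.
  by rewrite sum_nat_const card_ord.
pose mon (h : {ffun 'I_s -> 'I_M}) : 'X_{1..n} := (\sum_(j < s) U_(enum_val j) *+ h j)%MM.
have coords p : bnd (r * (N * D))%N p -> (forall h, p@_(mon h) = 0) -> p = 0.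
  move=> bp p0; apply/mpolyP => m; rewrite mcoeff0; apply/eqP.
  rewrite mcoeff_eq0; apply/negP => mp.
  have hM j : (m (enum_val (j : 'I_s)) < M)%N.
    by have := bp m mp (enum_val j); rewrite enum_valP ltnS.
  have Em : m = mon [ffun j => Ordinal (hM j)].
    apply/mnmP => i; rewrite mnm_sumE; have := bp m mp i.
    case: (boolP (i \in S)) => iS => [_|].
      have [j0 Ej0] : exists j0 : 'I_s, enum_val j0 = i.
        by exists (enum_rank_in iS i); rewrite enum_rankK_in.
      rewrite (bigD1 j0) //= mulmnE mnm1E Ej0 eqxx mul1n ffunE /= Ej0.
      rewrite big1 ?addn0 // => j ji; rewrite mulmnE mnm1E; case: eqP => // E.
      by case/negP: ji; apply/eqP/enum_val_inj; rewrite E Ej0.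
    rewrite leqn0 => /eqP->; rewrite big1 // => j _; rewrite mulmnE mnm1E.
    by case: eqP => // E; rewrite -E enum_valP in iS.
  by move: mp; rewrite Em mcoeff_msupp p0 eqxx.
pose A := \matrix_(t < #|{: r.-tuple 'I_N}|, h < #|{: {ffun 'I_s -> 'I_M}}|)
  (\prod_(i < r) f i ^+ tnth (enum_val t) i)@_(mon (enum_val h)).
have : kermx A != 0.
  rewrite -mxrank_eq0 mxrank_ker -lt0n subn_gt0.
  apply: leq_ltn_trans (rank_leq_col _) _.
  rewrite card_tuple card_ffun !card_ord.
  have leMN : (M <= N * Q)%N.
    by rewrite /M /Q mulnS mulnCA addnC -addn1 leq_add2l.
  have leX : (M ^ s <= (N * Q) ^ s)%N by case: (s) => // k; rewrite leq_exp2r.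
  apply: leq_ltn_trans leX _.
  rewrite expnMn; apply: (@leq_trans (N ^ s.+1)).
    by rewrite expnSr ltn_pmul2l ?expn_gt0.
  by rewrite leq_pexp2l.
case/rowV0Pn => w /sub_kermxP wA w0.
exists N, (fun t => w 0 (enum_rank t)); split.
  have [i wi] : exists i, w 0 i != 0.
    apply/existsP; apply: contraNT w0 => /existsPn w0; apply/eqP/rowP => i.
    by rewrite mxE; apply/eqP/negbNE/w0.
  by exists (enum_val i); rewrite enum_valK.
apply: coords => [|h].
  move=> m; rewrite /alg_comb => /msupp_sum_le /flatten_mapP[t _].
  by rewrite mul_mpolyC => /msuppZ_le; apply: bndP.
have /rowP/(_ (enum_rank h)) := wA; rewrite !mxE => wh.
rewrite /alg_comb raddf_sum /= -[RHS]wh (reindex_onto enum_val enum_rank); last first.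
  by move=> t _; rewrite enum_rankK.
rewrite (eq_bigl predT) => [|t]; last by rewrite enum_valK eqxx.
by apply: eq_bigr => t _; rewrite mcoeffCM !mxE enum_valK enum_rankK.
Qed.

End Chains.

(** * Primes generated by variables *)

Section VariablePrimes.
Variables (K : fieldType) (n : nat).
Local Notation R := {mpoly K[n]}.
Implicit Types (W : {set 'I_n}) (p : R).

Definition kill W p : R := p \mPo [tuple (if i \in W then 0 else 'X_i : R) | i < n].

(** The ideal generated by the variables in [W], taken as the kernel of a substitution so that
    primality comes from the target being a domain. *)
Definition var_prime W : {pred R} := fun p => kill W p == 0.

Lemma killD W p q : kill W (p + q) = kill W p + kill W q.
Proof. exact: raddfD. Qed.

Lemma killM W p q : kill W (p * q) = kill W p * kill W q.
Proof. exact: rmorphM. Qed.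

Lemma killU W i : kill W 'X_i = if i \in W then 0 else 'X_i.
Proof. by rewrite /kill comp_mpolyXU -tnth_nth tnth_mktuple. Qed.

Lemma killX W m : kill W 'X_[m] = \prod_(i < n) (if i \in W then 0 else 'X_i) ^+ m i.
Proof. by rewrite /kill comp_mpolyX; apply: eq_bigr => i _; rewrite tnth_mktuple. Qed.

Lemma kill_sum W (I : Type) (r : seq I) (F : I -> R) :
  kill W (\sum_(i <- r) F i) = \sum_(i <- r) kill W (F i).
Proof. exact: raddf_sum. Qed.

Lemma kill_prod W (I : Type) (r : seq I) (F : I -> R) :
  kill W (\prod_(i <- r) F i) = \prod_(i <- r) kill W (F i).
Proof. exact: rmorph_prod. Qed.

Lemma kill_exp W p k : kill W (p ^+ k) = kill W p ^+ k.
Proof. exact: rmorphXn. Qed.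

Lemma killZ W c p : kill W (c *: p) = c *: kill W p.
Proof. exact: comp_mpolyZ. Qed.

Lemma kill_kill W W' p : W \subset W' -> kill W' (kill W p) = kill W' p.
Proof.
move=> /subsetP WW'.
have E V q : kill V q = \sum_(m <- msupp q) q@_m *: kill V 'X_[m].
  rewrite (eq_bigr (fun m => kill V (q@_m *: 'X_[m]))) => [|m _].
    by rewrite -kill_sum -mpolyE.
  by rewrite killZ.
rewrite (E W p) kill_sum (E W' p); apply: eq_bigr => m _.
rewrite killZ !killX kill_prod; congr (_ *: _); apply: eq_bigr => i _.
rewrite kill_exp; congr (_ ^+ _); case: ifP => [/WW'->|_]; last exact: killU.
exact: comp_mpoly0.
Qed.

Lemma var_primeP W : prime_ideal (var_prime W).
Proof.
split; first split.
- by rewrite /var_prime /in_mem /= /kill comp_mpoly0.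
- by rewrite /var_prime /in_mem /= /kill comp_mpoly1 oner_eq0.
- move=> a u v; rewrite /var_prime /in_mem /= => /eqP u0 /eqP v0.
  by rewrite killD killM u0 v0 mulr0 addr0.
- by move=> u v; rewrite /var_prime /in_mem /= killM mulf_eq0.
Qed.

Lemma mem_var_prime W i : (('X_i : R) \in var_prime W) = (i \in W).
Proof.
rewrite -[LHS]/(kill W 'X_i == 0) killU; case: ifP => _; first exact: eqxx.
by apply/negbTE; rewrite -msupp_eq0 msuppX.
Qed.

Lemma var_prime_sub W W' : W \subset W' -> {subset var_prime W <= var_prime W'}.
Proof.
move=> WW' p; rewrite /var_prime /in_mem /= => /eqP Wp.
by rewrite -(kill_kill p WW') Wp /kill comp_mpoly0.
Qed.

End VariablePrimes.

(** * The dimension is the independence number *)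

Section Dimension.
Variables (K : fieldType) (n : nat) (e : rel 'I_n).
Hypotheses (e_sym : ssrbool.symmetric e) (e_irr : irreflexive e).
Local Notation R := {mpoly K[n]}.
Local Notation I := (edge_ideal K e).
Local Notation J := (ideal_mul I I).
Local Notation alpha := (independence_number e [set: 'I_n]).

Lemma sq_sub_prime (P : {pred R}) : prime_ideal P ->
  {subset J <= P} <-> (forall i j, e i j -> ('X_i \in P) || ('X_j \in P)).
Proof.
move=> PP; split=> [JP i j eij|H].
  have : ('X_i * 'X_j) * ('X_i * 'X_j) \in P.
    apply/JP/mem_ideal_gen/asboolP; exists ('X_i * 'X_j), ('X_i * 'X_j).
    by split=> //; apply: edge_mem.
  by move=> /(prime_idealM PP)/orP[] /(prime_idealM PP).
apply: ideal_gen_min; first exact: prime_ideal_submod.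
move=> p /asboolP[a [b [Ia _ ->]]]; rewrite mulrC; apply: prime_idealMl => //.
move: a Ia; apply: ideal_gen_min; first exact: prime_ideal_submod.
move=> _ /asboolP[i [j [/H/orP[Pi|Pj] ->]]]; last exact: prime_idealMl.
by rewrite mulrC; apply: prime_idealMl.
Qed.

(** The complement of a largest stable set [S] covers all edges; adding the elements of [S] one at a
    time gives [#|S|] strict steps between variable primes. *)
Lemma krull_dim_gt_alpha d : (d < alpha)%N -> krull_dim_gt J d.
Proof.
have [S /andP[_ sS] ->] : exists2 S, independent e setT S & alpha = #|S|.
  have h : (0 < #|[pred S | independent e [set: 'I_n] S]|)%N.
    by apply/card_gt0P; exists set0; rewrite inE independentE sub0set stable0.
  by have [S iS ES] := eq_bigmax_cond (fun S : {set 'I_n} => #|S|) h; exists S.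
move=> dS; pose s := enum S.
have ss : size s = #|S| by rewrite cardE.
pose W k : {set 'I_n} := ~: S :|: [set i in take k s].
exists (fun k => @var_prime K n (W k)); split=> [k _|k kd].
  split; first exact: var_primeP.
  apply/sq_sub_prime; first exact: var_primeP.
  move=> i j eij; rewrite !mem_var_prime !inE.
  have [iS|//] := boolP (i \in S); have [jS|_] := boolP (j \in S); last by rewrite orbT.
  by have /stableP/(_ i j iS jS) := (sS : stable e S); rewrite eij.
have ks : (k < size s)%N by rewrite ss (leq_ltn_trans kd).
have [x0 _] : exists x0 : 'I_n, True by case: (s) ks => // x0; exists x0.
have WS : W k \subset W k.+1.
  apply: setUS; apply/subsetP => i; rewrite !inE (take_nth x0) // mem_rcons inE.
  by move=> ->; rewrite orbT.
split; first exact: var_prime_sub.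
move=> /(_ ('X_(nth x0 s k))); rewrite !mem_var_prime !inE.
have -> : nth x0 s k \in S by rewrite -mem_enum mem_nth.
rewrite (take_nth x0) // mem_rcons inE eqxx /= => /(_ isT).
have : uniq (take k.+1 s) by rewrite take_uniq ?enum_uniq.
by rewrite (take_nth x0) // rcons_uniq => /andP[/negPf->].
Qed.

(** The variables outside [P 0] form a stable set [S]. The chain yields [d.+1] elements independent
    modulo [P 0], which can be taken in the variables of [S]; so [d < #|S|]. *)
Lemma krull_dim_gt_le d : krull_dim_gt J d -> (d < alpha)%N.
Proof.
case=> P [PP Pchain].
have primeP i : (i <= d.+1)%N -> prime_ideal (P i) by move=> /PP[].
have P0 : prime_ideal (P 0%N) := primeP 0%N (leq0n _).
pose S := [set i : 'I_n | ('X_i : R) \notin P 0%N].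
have sS : stable e S.
  apply/stableP => i j; rewrite !inE => iS jS; apply/negP => eij.
  have [_ /(sq_sub_prime P0)/(_ i j eij)] := PP 0%N (leq0n _).
  by rewrite (negPf iS) (negPf jS).
apply: leq_trans (alpha_ge sS); rewrite ltnNge; apply/negP => Sd.
have /choice[f fP] : forall i, exists f, (i <= d)%N -> f \in P i.+1 /\ f \notin P i.
  move=> i; have [id|_] := leqP i d; last by exists 0.
  have [_ nsub] := Pchain i id.
  apply: contrapT => nf; apply: nsub => u Pu.
  by case: (boolP (u \in P i)) => // nPu; case: nf; exists u.
(* Monomials involving a variable outside [S] lie in [P 0]; discarding them from [f i] gives [g i],
   which lies in the same members of the chain. *)
pose good (m : 'X_{1..n}) := [forall j, (j \notin S) ==> (m j == 0%N)].
pose g i : R := \sum_(m <- msupp (f i) | good m) (f i)@_m *: 'X_[m].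
have P0k k : (k <= d.+1)%N -> {subset P 0%N <= P k}.
  elim: k => [|k IHk] kd u Pu; first by [].
  by have [sub _] := Pchain k kd; apply/sub/IHk => //; apply: ltnW.
have fg i : f i - g i \in P 0%N.
  have -> : f i - g i = \sum_(m <- msupp (f i) | ~~ good m) (f i)@_m *: 'X_[m].
    by apply/eqP; rewrite subr_eq {1}[f i]mpolyE (bigID good) /= addrC.
  apply: prime_ideal_sum => // m /forallPn[j]; rewrite negb_imply => /andP[jS mj].
  rewrite -mul_mpolyC; apply: prime_idealMl => //.
  have lej : (U_(j) <= m)%MM.
    by apply/mnm_lepP => t; rewrite mnm1E; case: eqP => // <-; rewrite lt0n.
  rewrite -(submK lej) mpolyXD; apply: prime_idealMl => //.
  by move: jS; rewrite inE negbK.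
have gP i k : (k <= d.+1)%N -> (g i \in P k) = (f i \in P k).
  move=> kd; have Pk := primeP k kd; have fgk := P0k k kd _ (fg i).
  apply/idP/idP => [gk|fk]; first by rewrite -(subrK (g i) (f i)); apply: prime_idealD.
  have -> : g i = - (f i - g i) + f i by rewrite opprB subrK.
  by apply: prime_idealD => //; apply: prime_idealN.
have [||N [c [[t ct] c0]]] := @alg_dependent K n S d.+1 g.
- by rewrite ltnS.
- move=> i m j /msupp_sum_le /flatten_mapP[m'].
  rewrite mem_filter => /andP[/forallP gm' _] /msuppZ_le.
  by rewrite msuppX inE => /eqP-> jS; apply/eqP/(implyP (gm' j)).
have /negP[] := ct; apply/eqP; apply: (@chain_alg_indep K n N d.+1 P g c primeP).
  move=> i id; have [sub _] := Pchain i id; have [fi nfi] := fP i id.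
  by rewrite !gP // ltnW.
by rewrite c0; case: P0 => [[]].
Qed.

End Dimension.

Theorem theorem1p1 (K : fieldType) (n : nat) (e : rel 'I_n)
    (e_sym : ssrbool.symmetric e) (e_irr : irreflexive e)
    (no_isolated : forall v, exists w, e v w) :
  generalized_CM (fun i : 'I_n => 'X_i : {mpoly K[n]})
    (ideal_mul (edge_ideal K e) (edge_ideal K e))
  <->
  well_covered e [set: 'I_n] /\
  (forall v, forall C, C \in components e (del_nbhd e v) -> (1 < #|C|)%N ->
     triangle_free e C /\ W2 e C).
Proof.
have J_mem := @sq_mem K n e.
split=> [gCM|[wcV comp] i /krull_dim_gt_le i_alpha].
  apply: (@sq_face_necessary _ _ e_sym e_irr K) => a [j aj] i i_alpha.
  have Ea : ([ffun t => a t] : 'I_n -> int) = a.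
    by apply: functional_extensionality_dep => t; rewrite ffunE.
  rewrite -Ea; apply: (eq_exact_at (@active_sq_gens _ e _)).
  apply: (exact_at_of_finite_length J_mem (j := j)); last by rewrite ffunE.
  by apply: gCM; apply: krull_dim_gt_alpha.
apply: (finite_length_cech J_mem) => a neg.
apply: (@eq_exact_at _ _ (sq_face e a)) => [S|]; first by rewrite active_sq_gens.
exact: sq_face_sufficient.
Qed.
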